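(* Let $P$ be a real ternary form of degree $6$ that is nonnegative on $\mathbb{R}^3$, spans an extreme ray of the convex cone $P_{3,6}$, and is not a sum of squares (that is, $P\notin\Sigma_{3,6}$). Then $P$ is stubborn, i.e. for every integer $k\ge 0$ the form $P^{2k+1}$ is not a sum of squares of forms, $P^{2k+1}\notin \Sigma_{3,6(2k+1)}$.
   Context: $F_{n,d}$ is the space of real forms (homogeneous polynomials) of degree $d$ in $n$ variables. $P_{n,d}\subset F_{n,d}$ is the closed convex cone of nonnegative forms, i.e. $P(\mathbf{X})\ge 0$ for all $\mathbf{X}\in\mathbb{R}^n$. $\Sigma_{n,d}\subset P_{n,d}$ is the cone of sums of squares, i.e. forms $H_1^2+\dots+H_r^2$ with $H_1,\dots,H_r\in F_{n,d/2}$. A form $P\in P_{n,d}$ is extremal if it spans an extreme ray of $P_{n,d}$. A nonnegative form $P$ is stubborn if $P^k$ is not a sum of squares for any odd $k\ge 1$. *)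

(* Defs.v *)
From mathcomp Require Import all_boot all_order all_algebra.
From mathcomp Require Import reals.
From mathcomp Require Import mpoly.

Set Implicit Arguments.
Unset Strict Implicit.
Unset Printing Implicit Defensive.

Import Order.TTheory GRing.Theory Num.Theory.
Local Open Scope ring_scope.

Definition ray (R : numDomainType) (V : lmodType R) (v : V) (w : V) : Prop :=
  exists2 c : R, 0 <= c & w = c *: v.

(* An extreme ray is a ray of the cone [C] that is a face of [C]. *)
Definition spans_extreme_ray (R : numDomainType) (V : lmodType R)
    (C : V -> Prop) (v : V) : Prop :=
  [/\ C v, v != 0 &
      forall a b : V, C a -> C b -> ray v (a + b) -> ray v a /\ ray v b].

Definition nonneg_form (R : realType) (n d : nat) (P : {mpoly R[n]}) : Prop :=
  P \is d.-homog /\ forall x : 'I_n -> R, 0 <= P.@[x].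

(* The degree [d] is required to be even: for odd [d] there are none. *)
Definition sos_form (R : realType) (n d : nat) (P : {mpoly R[n]}) : Prop :=
  exists e : nat, d = (2 * e)%N /\
  exists2 H : seq {mpoly R[n]},
    {in H, forall h, h \is e.-homog} & P = \sum_(h <- H) h ^+ 2.

Definition stubborn (R : realType) (n d : nat) (P : {mpoly R[n]}) : Prop :=
  nonneg_form d P /\
  forall k : nat, odd k -> ~ sos_form (d * k) (P ^+ k).

(* Main.v *)
Require Import Defs.
From HB Require Import structures.
From mathcomp Require Import all_boot all_order all_algebra all_fingroup.
From mathcomp Require Import reals boolp classical_sets.
From mathcomp Require Import polyrcf.
From mathcomp Require Import mpoly.
From mathcomp Require Import ring lra zify.

(** Write V_k for the set of forms H of degree 3k such that H^2 <= C P^k for some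
    constant C. If P^k is a sum of squares of forms H_i, every H_i lies in V_k, so
    it is enough to show that V_k = 0 for odd k. For k = 1 this is where the
    hypotheses on P enter: if G^2 <= C P then C P = G^2 + (C P - G^2), so G^2 is
    proportional to P by extremality, and P would be a sum of squares if G were not
    0. From then on only this property of the nonnegative sextic P is used
    ([no_square_below]).

    Nonnegative forms of degree 2 or 4 dominate the square of a nonzero form of half
    their degree ([low_degree_dominates_square]). Hence P has no factorization into
    nonnegative forms and no square factor, and an argument on signs shows that P,
    made monic in x, is irreducible over R[y]. So P divides H as soon as the
    resultant of P and H vanishes ([no_square_below_resultant]); in particular P has
    finitely many zeros. Moreover P does not vanish to order 4 at a zero, for
    otherwise it would be quadratic in one variable and dominate a square
    ([qform_dominates_square]).

    Let (x0, y0) be a zero of P in generic affine coordinates. There is a curve x =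
    phi(y) that agrees to some maximal order m with the two complex branches of P:
    near the zero P is comparable with (x - phi(y))^2 + (y - y0)^(2m). It is m
    linear conditions on a cubic G that G(phi(y), y) vanish to order m at y0, and
    they imply that G^2 <= C P near the zero. If the orders m of all the zeros add
    up to 9 at most, some nonzero cubic satisfies all the conditions, because cubics
    form a space of dimension 10, and G^2 <= C P holds everywhere by compactness,
    against V_1 = 0. So the orders add up to at least 10
    ([no_square_below_has_contacts]).

    If H is in V_k, the resultant of P and H with respect to x vanishes at y0 to
    order at least 2km, H being of order km on each of the two branches
    ([resultant_contact]). This is proved on the Sylvester matrix, by weights on its
    rows and columns. The total order is at least 20k, and the degree of the
    resultant is at most 18k. So the resultant is 0, P divides H, and H / P is in
    V_(k-2). The descent ends in V_1 = 0 ([odd_power_bounded_eq0]). *)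

Set Implicit Arguments.
Unset Strict Implicit.
Unset Printing Implicit Defensive.

Import Order.TTheory GRing.Theory Num.Theory.
Local Open Scope ring_scope.

(** * Nonnegative univariate polynomials *)
(** Evaluation of polynomials without the reordering of products that [hornerE]
    performs. *)
Definition evalE := (@horner_exp, @hornerXsubC, @hornerZ, @hornerM, @hornerN,
  @hornerD, @hornerC, @hornerX, @hornerMn).

Section Univariate.
Variable R : rcfType.
Implicit Types (p q f : {poly R}).

Lemma poly_neg_near p r : p.[r] < 0 ->
  exists2 d, 0 < d & forall x, `|x - r| < d -> p.[x] < 0.
Proof.
move=> p_lt0; have e_gt0 : 0 < - p.[r] by rewrite oppr_gt0.
have [d d_gt0 dP] := poly_cont r p e_gt0.
exists d => // x /dP; rewrite ltr_norml => /andP[_]; lra.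
Qed.

Lemma poly_ge0_limit p r e : 0 < e ->
  (forall x, r < x < r + e -> 0 <= p.[x]) -> 0 <= p.[r].
Proof.
move=> e_gt0 p_ge0; rewrite leNgt; apply/negP => /poly_neg_near[d d_gt0 dP].
pose m := Num.min d e / 2.
have min_gt0 : 0 < Num.min d e by rewrite lt_min d_gt0.
have m_gt0 : 0 < m by rewrite divr_gt0.
have mm : m < Num.min d e by rewrite /m; lra.
have md : m < d by apply: (lt_le_trans mm); rewrite ge_min lexx.
have me : m < e by apply: (lt_le_trans mm); rewrite ge_min lexx orbT.
have := p_ge0 (r + m); rewrite ltrDl m_gt0 ltrD2l me => /(_ isT).
by rewrite leNgt dP // addrC addKr gtr0_norm.
Qed.

Lemma poly_ge0_off p r : (forall x, x != r -> 0 <= p.[x]) ->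
  forall x, 0 <= p.[x].
Proof.
move=> p_ge0 x; have [->|/p_ge0//] := eqVneq x r.
by apply: (@poly_ge0_limit p r 1) => // y /andP[ry _]; rewrite p_ge0 // gt_eqF.
Qed.

Lemma poly_finite_roots p : p != 0 -> exists s : seq R, forall x, root p x -> x \in s.
Proof.
move=> p_neq0; exists (roots p (- cauchy_bound p) (cauchy_bound p)) => x rx.
rewrite -roots_on_roots // rx andbT.
exact: root_in_cauchy_bound.
Qed.

(** To the right of any point there is an interval free of roots of q, and p is
    continuous. *)
Lemma poly_ge0_dense p q : q != 0 -> (forall x, q.[x] != 0 -> 0 <= p.[x]) ->
  forall x, 0 <= p.[x].
Proof.
move=> q_neq0 p_ge0 x.
have [d d_gt0 dP] : exists2 d : R, 0 < d & forall y, x < y < x + d -> q.[y] != 0.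
  exists (next_root q x (x + 1) - x).
    by rewrite subr_gt0 next_root_gt // ltrDl.
  move=> y; rewrite addrC subrK => xy.
  by have /(_ y) := @next_noroot _ q x (x + 1); rewrite in_itv /= xy rootE => ->.
by apply: (poly_ge0_limit d_gt0) => y /dP /p_ge0.
Qed.

(** p is nonnegative on the right of r and nonpositive on its left. *)
Lemma poly_double_root p r : (forall x, 0 <= (('X - r%:P) * p).[x]) -> root p r.
Proof.
move=> h; rewrite rootE eq_le; apply/andP; split; last first.
  apply: (@poly_ge0_limit p r 1) => // x /andP[rx _].
  by have := h x; rewrite hornerM hornerXsubC pmulr_rge0 // subr_gt0.
have : 0 <= ((- p) \Po - 'X).[-r].
  apply: (@poly_ge0_limit _ _ 1) => // x /andP[rx _].
  rewrite horner_comp !hornerE.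
  have := h (- x); rewrite hornerM hornerXsubC nmulr_rge0 ?oppr_ge0 //. lra.
by rewrite horner_comp !hornerE opprK oppr_ge0.
Qed.

Lemma poly_nonneg_root p r : (forall x, 0 <= p.[x]) -> root p r ->
  exists q, p = ('X - r%:P) ^+ 2 * q /\ (forall x, 0 <= q.[x]).
Proof.
move=> p_ge0 /factor_theorem [q pE].
have /factor_theorem[u qE] : root q r.
  by apply: poly_double_root => x; rewrite mulrC -pE.
exists u; have pE2 : p = ('X - r%:P) ^+ 2 * u by rewrite pE qE; ring.
split=> //; apply: (@poly_ge0_off _ r) => x xr.
have := p_ge0 x; rewrite pE2 hornerM horner_exp hornerXsubC pmulr_rge0 //.
by rewrite exprn_even_gt0 //= subr_eq0.
Qed.

Lemma poly_nonneg_lead p : (forall x, 0 <= p.[x]) -> 0 <= lead_coef p.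
Proof.
move=> p_ge0; rewrite leNgt; apply/negP => lc.
have /poly_pinfty_gt_lc[n /(_ n (lexx _))] : 0 < lead_coef (- p).
  by rewrite lead_coefN oppr_gt0.
rewrite lead_coefN hornerN => h; have := p_ge0 n; lra.
Qed.

Lemma size_comp_oppX p : size (p \Po - 'X) = size p.
Proof. by rewrite size_comp_poly2 // size_polyN size_polyX. Qed.

Lemma lead_coef_comp_oppX p :
  lead_coef (p \Po - 'X) = (-1) ^+ (size p).-1 * lead_coef p.
Proof.
by rewrite lead_coef_comp ?size_polyN ?size_polyX // lead_coefN lead_coefX mulrC.
Qed.

Lemma poly_nonneg_odd_size p : p != 0 -> (forall x, 0 <= p.[x]) -> odd (size p).
Proof.
move=> p_neq0 p_ge0; have := poly_nonneg_lead p_ge0.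
rewrite le_eqVlt eq_sym lead_coef_eq0 (negPf p_neq0) /= => lc_gt0.
have : 0 <= lead_coef (p \Po - 'X).
  by apply: poly_nonneg_lead => x; rewrite horner_comp.
rewrite lead_coef_comp_oppX pmulr_lge0 // -signr_odd.
have := size_poly_eq0 p; rewrite (negPf p_neq0); case: (size p) => //= n _.
by case: (odd n) => //=; lra.
Qed.

(** Otherwise q f - p^2 has a negative leading coefficient. *)
Lemma size_sqr_le p q f : (forall x, p.[x] ^+ 2 <= q.[x] * f.[x]) ->
  (2 * size p <= size q + size f)%N.
Proof.
move=> h; rewrite leqNgt; apply/negP => hs.
have p_neq0 : p != 0 by rewrite -size_poly_eq0 -lt0n; lia.
have sp : size (- (p ^+ 2)) = (size p + size p)%N.-1.
  by rewrite size_polyN expr2 size_mul.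
have sqf : (size (q * f)%R < size (- (p ^+ 2))%R)%N.
  rewrite sp; apply: leq_ltn_trans (size_polyMleq _ _) _.
  by have := size_poly_gt0 p; rewrite p_neq0; lia.
have := @poly_nonneg_lead (q * f - p ^+ 2).
rewrite addrC lead_coefDl // lead_coefN lead_coef_exp oppr_ge0 => H.
have : lead_coef p ^+ 2 <= 0.
  by apply: H => x; rewrite !hornerE; have := h x; rewrite expr2; lra.
by rewrite leNgt exprn_even_gt0 //= lead_coef_eq0 p_neq0.
Qed.

(** Each power of X - y0 is divided out in turn; after the division the bound
    persists at y0 by continuity. *)
Lemma dvdp_of_bound f y0 K N :
  (forall y, `|y - y0| <= 1 -> `|f.[y]| <= K * `|y - y0| ^+ N) ->
  ('X - y0%:P) ^+ N %| f.
Proof.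
elim: N f => [|N IH] f h; first by rewrite expr0 dvd1p.
have /factor_theorem[g fE] : root f y0.
  rewrite rootE -normr_eq0 eq_le normr_ge0 andbT.
  have := h y0; rewrite subrr normr0 expr0n /= mulr0; exact.
rewrite exprSr fE dvdp_mul2r ?polyXsubC_eq0 //; apply: IH => y hy.
have off z : z != y0 -> `|z - y0| <= 1 -> `|g.[z]| <= K * `|z - y0| ^+ N.
  move=> zy /h; rewrite fE hornerM hornerXsubC normrM exprSr mulrA.
  by rewrite ler_pM2r // normr_gt0 subr_eq0.
have [->|/off/(_ hy)//] := eqVneq y y0.
have K0 : 0 <= K.
  have := h (y0 + 1); rewrite addrC addKr normr1 lexx expr1n mulr1 => /(_ isT).
  exact: le_trans.
rewrite subrr normr0.
have key (s : R) : (s = 1 \/ s = -1) -> 0 <= (K *: ('X - y0%:P) ^+ N + s *: g).[y0].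
  move=> hs; apply: (@poly_ge0_limit _ y0 1) => // z /andP[z1 z2].
  have zy : `|z - y0| = z - y0 by rewrite gtr0_norm ?subr_gt0.
  have := off z; rewrite gt_eqF // zy => /(_ isT) gz.
  have {}gz : `|g.[z]| <= K * (z - y0) ^+ N by apply: gz; lra.
  move: gz; rewrite ler_norml ?(hornerE, horner_exp) => /andP[g1 g2].
  by case: hs => ->; lra.
have := key 1 (or_introl erefl); have := key (-1) (or_intror erefl).
rewrite ?(hornerE, horner_exp) subrr => k1 k2.
by rewrite ler_norml; apply/andP; split; lra.
Qed.

(** A real root r of f is not a root of q, so it is a double root of f and (X -
    r)^2 can be removed; a monic polynomial without real roots is positive. *)
Lemma coprime_factor_nonneg f q : f \is monic ->
  (forall x, 0 <= (f * q).[x]) -> (forall x, ~~ (root f x && root q x)) ->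
  forall x, 0 <= f.[x].
Proof.
have [n] := ubnP (size f); elim: n f => // n IH f; rewrite ltnS => sf fm fq_ge0 cop x.
have [|/forallNP noroot] := EM (exists r, root f r).
  case=> r fr; have /factor_theorem[u fE] := fr.
  have : root (u * q) r by apply: poly_double_root => z; rewrite mulrA [_ * u]mulrC -fE.
  have := cop r; rewrite fr /= rootM => /negPf -> /[!orbF] /factor_theorem[v uE].
  have fE2 : f = ('X - r%:P) ^+ 2 * v by rewrite fE uE; ring.
  have vm : v \is monic.
    by move: fm; rewrite fE2 monicMl // monic_exp // monicXsubC.
  rewrite fE2 hornerM horner_exp mulr_ge0 // ?sqr_ge0 //.
  apply: IH => //.
  - apply: leq_trans sf; rewrite fE2 size_monicM ?monic_exp ?monicXsubC ?monic_neq0 //.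
    by rewrite size_exp_XsubC; have := size_poly_gt0 v; rewrite monic_neq0 //; lia.
  - apply: (@poly_ge0_off _ r) => z zr; have := fq_ge0 z.
    rewrite fE2 -mulrA hornerM horner_exp hornerXsubC pmulr_rge0 //.
    by rewrite exprn_even_gt0 //= subr_eq0.
  move=> z; have := cop z; rewrite fE2 rootM.
  by case: (root v z); case: (root q z); rewrite ?orbT.
rewrite leNgt; apply/negP => fx.
have [m fm_gt] : exists2 m, x <= m & 0 <= f.[m].
  have /poly_pinfty_gt_lc[m hm] : 0 < lead_coef f by rewrite (eqP fm).
  exists (Num.max x m); first by rewrite le_max lexx.
  have := hm (Num.max x m); rewrite le_max lexx orbT => /(_ isT).
  by rewrite (eqP fm); apply: le_trans.
move=> fm_ge0; have [|z _ rz] := poly_ivt fm_gt (p := f); last by apply: (noroot z).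
by rewrite fm_ge0 ltW.
Qed.

End Univariate.

(** * From local to global domination *)
Section Compactness.
Variable R : realType.

(** The supremum of the points up to which Phi holds is attained, and it cannot
    stop short of b. This plays the part of the extraction of finite subcovers. *)
Lemma cousin (Phi : R -> R -> Prop) (a b : R) : a <= b ->
    (forall x y z, x <= y -> y <= z -> Phi x y -> Phi y z -> Phi x z) ->
    (forall u, a <= u <= b -> exists2 d, 0 < d &
       forall x y, u - d < x -> x <= y -> y < u + d -> Phi x y) ->
  Phi a b.
Proof.
move=> ab glue loc.
pose S : set R := [set c | a <= c <= b /\ Phi a c]%classic.
have Sa : S a.
  split; first by rewrite lexx.
  have [|d d0 dP] := loc a; first by rewrite lexx.
  by apply: dP => //; lra.
have Sub : has_ubound S by exists b => c [/andP[]].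
have hS : has_sup S by split; [exists a|].
have as_ : a <= sup S by exact: ub_le_sup.
have sb : sup S <= b by apply: ge_sup; [exists a|move=> c [/andP[]]].
have [|d d0 dP] := loc (sup S); first by rewrite as_.
have [c [/andP[ac cb] Phic] hc] := sup_adherent d0 hS.
have cs : c <= sup S by apply: ub_le_sup => //; split => //; rewrite ac.
pose y := Num.min b (sup S + d / 2).
have sy : sup S <= y by rewrite le_min sb lerDl divr_ge0 // ltW.
have yd : y < sup S + d by rewrite gt_min; apply/orP; right; lra.
have Sy : S y.
  split; first by rewrite (le_trans as_ sy) ge_min lexx.
  by apply: (glue a c y) => //; [lra|apply: dP => //; lra].
have ys : y <= sup S by exact: ub_le_sup.
have yb : y = b.
  rewrite /y; case: leP => // h; exfalso.
  by move: ys; rewrite /y (min_r (ltW h)); lra.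
by case: Sy; rewrite yb.
Qed.

Definition dominated (T : Type) (A : T -> Prop) (f g : T -> R) :=
  exists2 C, 0 <= C & forall t, A t -> g t <= C * f t.

Lemma dominated_union (T : Type) (A B E : T -> Prop) (f g : T -> R) :
  (forall t, 0 <= f t) -> (forall t, E t -> A t \/ B t) ->
  dominated A f g -> dominated B f g -> dominated E f g.
Proof.
move=> f0 EAB [C C0 hC] [D D0 hD]; exists (C + D); first lra.
move=> t /EAB[/hC|/hD]; have := f0 t; rewrite mulrDl.
  by have := mulr_ge0 D0 (f0 t); lra.
by have := mulr_ge0 C0 (f0 t); lra.
Qed.

Lemma dominated_itv (f g : R -> R) (a b : R) : a <= b -> (forall x, 0 <= f x) ->
  (forall u, a <= u <= b -> exists2 d, 0 < d & dominated (fun x => `|x - u| < d) f g) ->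
  dominated (fun x => a <= x <= b) f g.
Proof.
move=> ab f0 loc.
apply: (@cousin (fun a b => dominated (fun x => a <= x <= b) f g)) => //.
- move=> x y z xy yz; apply: dominated_union => // t /andP[xt tz].
  by have [ty|yt] := leP t y; [left; rewrite xt|right; rewrite (ltW yt)].
- move=> u /loc[d d0 [C C0 hC]]; exists d => // x y ux xy yu.
  exists C => // t /andP[xt ty]; apply: hC; rewrite ltr_norml.
  by apply/andP; split; lra.
Qed.

Definition near2 (x0 y0 d : R) (v : R * R) := `|v.1 - x0| < d /\ `|v.2 - y0| < d.
Definition dominated_near (x0 y0 : R) (f g : R * R -> R) :=
  exists2 d, 0 < d & dominated (near2 x0 y0 d) f g.

Lemma dominated_tube (f g : R * R -> R) (x0 a b : R) : a <= b ->
  (forall v, 0 <= f v) ->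
  (forall u, a <= u <= b -> dominated_near x0 u f g) ->
  exists2 d, 0 < d & dominated (fun v => `|v.1 - x0| < d /\ a <= v.2 <= b) f g.
Proof.
move=> ab f0 loc.
apply: (@cousin (fun a b => exists2 d, 0 < d &
  dominated (fun v => `|v.1 - x0| < d /\ a <= v.2 <= b) f g)) => //.
- move=> x y z xy yz [d1 d10 h1] [d2 d20 h2]; exists (Num.min d1 d2).
    by rewrite lt_min d10.
  apply: dominated_union h1 h2 => // t []; rewrite lt_min => /andP[t1 t2] /andP[xt tz].
  by have [ty|yt] := leP t.2 y; [left|right]; split=> //; rewrite ?xt ?tz ?(ltW yt).
- move=> u /loc[d d0 [C C0 hC]]; exists d => // x y ux xy yu; exists d => //.
  exists C => // t [t1 /andP[xt ty]]; apply: hC; split => //; rewrite ltr_norml.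
  by apply/andP; split; lra.
Qed.

Lemma dominated_box (f g : R * R -> R) (a b : R) : a <= b ->
  (forall v, 0 <= f v) ->
  (forall x y, a <= x <= b -> a <= y <= b -> dominated_near x y f g) ->
  dominated (fun v => a <= v.1 <= b /\ a <= v.2 <= b) f g.
Proof.
move=> ab f0 loc.
apply: (@cousin (fun c d => dominated (fun v => c <= v.1 <= d /\ a <= v.2 <= b) f g)) => //.
- move=> x y z xy yz; apply: dominated_union => // t [/andP[xt tz] h].
  by have [ty|yt] := leP t.1 y; [left|right]; rewrite ?xt ?tz ?(ltW yt).
- move=> u hu; have [|d d0 [C C0 hC]] := @dominated_tube f g u a b ab f0.
    by move=> v; apply: loc.
  exists d => // x y ux xy yu; exists C => // t [/andP[xt ty] tb]; apply: hC.
  by split=> //; rewrite ltr_norml; apply/andP; split; lra.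
Qed.

(** The charts x = 1 and y = 1 near z = 0 control all points (x, y, 1) outside a
    large box, and the box is compact. *)
Lemma dominated_proj (d : nat) (f g : R -> R -> R -> R) : ~~ odd d ->
    (forall l x y z, f (l * x) (l * y) (l * z) = l ^+ d * f x y z) ->
    (forall l x y z, g (l * x) (l * y) (l * z) = l ^+ d * g x y z) ->
    (forall x y z, 0 <= f x y z) ->
    (forall y, dominated_near 0 y (fun v => f 1 v.2 v.1) (fun v => g 1 v.2 v.1)) ->
    (forall x, dominated_near 0 x (fun v => f v.2 1 v.1) (fun v => g v.2 1 v.1)) ->
    (forall x y, dominated_near x y (fun v => f v.1 v.2 1) (fun v => g v.1 v.2 1)) ->
  dominated (fun=> True) (fun v => f v.1 v.2 1) (fun v => g v.1 v.2 1).
Proof.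
move=> even_d hf hg f0 locx locy loc.
have le11 : (-1 : R) <= 1 by lra.
have [|d1 d10 [C1 C10 h1]] := dominated_tube (x0 := 0) le11 _ (fun u _ => locx u).
  by move=> v.
have [|d2 d20 [C2 C20 h2]] := dominated_tube (x0 := 0) le11 _ (fun u _ => locy u).
  by move=> v.
pose rho := 1 + d1^-1 + d2^-1.
have d1i : 0 < d1^-1 by rewrite invr_gt0.
have d2i : 0 < d2^-1 by rewrite invr_gt0.
have small (e x : R) : 0 < e -> e^-1 < `|x| -> `|x^-1 - 0| < e.
  move=> e0 ex; rewrite subr0; rewrite normfV -[e]invrK ltf_pV2 // posrE ?invr_gt0 //.
  by apply: lt_trans ex; rewrite invr_gt0.
have ratio (x y : R) : `|y| <= `|x| -> x != 0 -> -1 <= y / x <= 1.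
  move=> yx x0; rewrite -ler_norml normrM normfV ler_pdivrMr ?normr_gt0 //.
  by rewrite mul1r.
have D1 : dominated (fun v => rho <= `|v.1| /\ `|v.2| <= `|v.1|)
    (fun v => f v.1 v.2 1) (fun v => g v.1 v.2 1).
  exists C1 => // -[x y] /= [rx yx].
  have x0 : x != 0 by rewrite -normr_gt0; rewrite /rho in rx; lra.
  have -> : g x y 1 = g (x * 1) (x * (y / x)) (x * x^-1).
    by rewrite mulr1 divff // mulrC divfK.
  have -> : f x y 1 = f (x * 1) (x * (y / x)) (x * x^-1).
    by rewrite mulr1 divff // mulrC divfK.
  rewrite hf hg mulrCA ler_wpM2l ?exprn_even_ge0 //.
  apply: (h1 (x^-1, y / x)); split; last exact: ratio.
  by apply: small => //; rewrite /rho in rx; lra.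
have D2 : dominated (fun v => rho <= `|v.2| /\ `|v.1| <= `|v.2|)
    (fun v => f v.1 v.2 1) (fun v => g v.1 v.2 1).
  exists C2 => // -[x y] /= [rx yx].
  have x0 : y != 0 by rewrite -normr_gt0; rewrite /rho in rx; lra.
  have -> : g x y 1 = g (y * (x / y)) (y * 1) (y * y^-1).
    by rewrite mulr1 divff // mulrC divfK.
  have -> : f x y 1 = f (y * (x / y)) (y * 1) (y * y^-1).
    by rewrite mulr1 divff // mulrC divfK.
  rewrite hf hg mulrCA ler_wpM2l ?exprn_even_ge0 //.
  apply: (h2 (y^-1, x / y)); split; last exact: ratio.
  by apply: small => //; rewrite /rho in rx; lra.
have rho0 : - rho <= rho by rewrite /rho; lra.
have D3 := dominated_box rho0 (fun v => f0 v.1 v.2 1) (fun x y _ _ => loc x y).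
have D12 := dominated_union (E := fun v => rho <= `|v.1| \/ rho <= `|v.2|) _ _ D1 D2.
apply: (dominated_union _ _ D3 (D12 _ _)) => //.
- move=> [x y] _ /=; rewrite -!ler_norml.
  case: (leP `|x| rho) => hx; last by right; left; exact: ltW.
  by case: (leP `|y| rho) => hy; [left|right; right; exact: ltW].
- move=> [x y] /= h; case: (leP `|y| `|x|) => hyx; [left|right].
    by split => //; case: h => // /le_trans; apply.
  by split; [case: h => // /le_trans; apply; exact: ltW|exact: ltW].
Qed.

(** Leading coefficients decide outside a large interval, compactness inside it. *)
Lemma poly_pos_dominates (a D : {poly R}) : (forall y, 0 < D.[y]) ->
  (size a <= size D)%N -> exists2 C, 0 <= C & forall y, a.[y] <= C * D.[y].
Proof.
move=> D_gt0 saD.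
have D_ge0 y : 0 <= D.[y] by exact: ltW.
have D_neq0 : D != 0.
  by apply/eqP => D0; have := D_gt0 0; rewrite D0 horner0 ltxx.
have lcD : 0 < lead_coef D.
  by rewrite lt_def lead_coef_eq0 D_neq0 poly_nonneg_lead.
have large (b E : {poly R}) : (size b <= size E)%N -> 0 < lead_coef E ->
    (forall y, 0 <= E.[y]) ->
    exists n C, 0 <= C /\ forall y, n <= y -> b.[y] <= C * E.[y].
  move=> sbE lcE E0; pose C := (`|b`_(size E).-1| + 1) / lead_coef E.
  have C0 : 0 <= C by apply: divr_ge0; [rewrite addr_ge0|exact: ltW].
  have E_neq0 : E != 0 by rewrite -lead_coef_eq0 gt_eqF.
  pose P := C *: E - b.
  have Pc : P`_(size E).-1 = `|b`_(size E).-1| + 1 - b`_(size E).-1.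
    rewrite coefB coefZ -/(lead_coef E) /C divfK //; lra.
  have Pc1 : 1 <= P`_(size E).-1 by rewrite Pc; have := ler_norm b`_(size E).-1; lra.
  have szP : size P = size E.
    apply/eqP; rewrite eqn_leq; apply/andP; split.
      apply: leq_trans (size_polyD _ _) _; rewrite geq_max size_polyN sbE andbT.
      exact: size_scale_leq.
    rewrite -(prednK (n := size E)) ?size_poly_gt0 //.
    by rewrite ltnNge; apply/negP => /(nth_default 0) P0; move: Pc1; rewrite P0; lra.
  have lcP : 0 < lead_coef P by rewrite /lead_coef szP; lra.
  have [n hn] := poly_pinfty_gt_lc lcP.
  exists n, C; split=> // y /hn; rewrite !hornerE; lra.
have [n1 [C1 [C10 h1]]] := large a D saD lcD D_ge0.
have [n2 [C2 [C20 h2]]] : exists n C, 0 <= C /\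
    forall y, y <= - n -> a.[y] <= C * D.[y].
  have [|||n [C [C0 h]]] := large (a \Po - 'X) (D \Po - 'X).
  3: by move=> y; rewrite horner_comp.
  - by rewrite !size_comp_oppX.
  - rewrite lt_def lead_coef_eq0 -size_poly_eq0 size_comp_oppX size_poly_eq0 D_neq0.
    by apply: poly_nonneg_lead => y; rewrite horner_comp.
  exists n, C; split=> // y yn; have /h : n <= - y by lra.
  by rewrite !horner_comp !hornerE opprK.
pose n := `|n1| + `|n2|.
have nn : - n <= n by have := normr_ge0 n1; have := normr_ge0 n2; rewrite /n; lra.
have [u _|C3 C30 h3] := @dominated_itv (horner D) (horner a) (- n) n nn D_ge0.
  have Du2 : 0 < D.[u] / 2 by rewrite divr_gt0.
  have [d1 d10 hd1] := poly_cont u D Du2.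
  have [d2 d20 hd2] := poly_cont u a ltr01.
  exists (Num.min d1 d2); first by rewrite lt_min d10.
  exists ((`|a.[u]| + 1) / (D.[u] / 2)); first by apply: divr_ge0; [rewrite addr_ge0|exact: ltW].
  move=> x; rewrite lt_min => /andP[/hd1 + /hd2].
  rewrite !ltr_norml => /andP[D1 _] /andP[_ a2].
  have Dx : D.[u] / 2 <= D.[x] by lra.
  rewrite mulrAC ler_pdivlMr //.
  apply: le_trans (_ : (`|a.[u]| + 1) * (D.[u] / 2) <= _).
    by rewrite ler_wpM2r ?ltW //; have := ler_norm a.[u]; lra.
  by rewrite ler_wpM2l // addr_ge0.
exists (C1 + C2 + C3); first lra.
move=> y; rewrite !mulrDl.
have := D_ge0 y => Dy.
have := mulr_ge0 C10 Dy; have := mulr_ge0 C20 Dy; have := mulr_ge0 C30 Dy.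
have := ler_norm n1; have := ler_norm n2; have := normr_ge0 n1; have := normr_ge0 n2.
have [/h1|y1] := leP n1 y; first lra.
have [/h2|y2] := leP y (- n2); first lra.
move=> ? ? ? ?; have /h3 : - n <= y <= n by rewrite /n; apply/andP; split; lra.
lra.
Qed.

End Compactness.

(** * Binary quadratic forms over R[y] *)
Section BinaryForms.
Variable R : realType.
Implicit Types (a b c g h s : {poly R}).

Lemma odd_exists m : odd m -> exists k, m = (2 * k).+1.
Proof. by move=> om; exists m./2; rewrite mul2n -[LHS]odd_double_half om. Qed.

Definition qform a b c (X Z y : R) :=
  a.[y] * X ^+ 2 + 2 * b.[y] * X * Z + c.[y] * Z ^+ 2.

Lemma quad_disc (a b c : R) :
  (forall X Z, 0 <= a * X ^+ 2 + 2 * b * X * Z + c * Z ^+ 2) ->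
  [/\ 0 <= a, 0 <= c & b ^+ 2 <= a * c].
Proof.
move=> h; have a0 : 0 <= a by have := h 1 0; lra.
have c0 : 0 <= c by have := h 0 1; lra.
split=> //; have [a00|a_neq0] := eqVneq a 0.
  have [->|b0] := eqVneq b 0; first by rewrite a00; lra.
  have := h (- (c + 1) / (2 * b)) 1; rewrite a00.
  have -> : 2 * b * (- (c + 1) / (2 * b)) = - (c + 1) by field.
  lra.
rewrite -subr_ge0; have := h b (- a).
have -> : a * b ^+ 2 + 2 * b * b * - a + c * (- a) ^+ 2 = a * (a * c - b ^+ 2) by ring.
by rewrite pmulr_rge0 // lt_def a_neq0.
Qed.

Lemma qform_disc a b c : (forall X Z y, 0 <= qform a b c X Z y) ->
  forall y, [/\ 0 <= a.[y], 0 <= c.[y] & b.[y] ^+ 2 <= a.[y] * c.[y]].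
Proof. by move=> h y; apply: quad_disc => X Z; have := h X Z y. Qed.

Lemma noroot_has_square c q : c != 0 -> (forall y, 0 <= c.[y]) ->
    (forall y, ~ root c y) ->
  exists h C, [/\ h != 0, (size h <= q.+1)%N, 0 <= C &
    forall y, h.[y] ^+ 2 <= C * c.[y]].
Proof.
move=> c_neq0 c_ge0 noroot.
have c_gt0 y : 0 < c.[y] by rewrite lt_def c_ge0 andbT; apply/negP => /(noroot y).
have [|C C0 hC] := poly_pos_dominates (a := 1) c_gt0.
  by rewrite size_poly1 size_poly_gt0.
exists 1, C; split=> //; rewrite ?oner_neq0 ?size_poly1 // => y.
by have := hC y; rewrite !evalE expr1n.
Qed.

(** Real roots are double, and one half of them goes into h; the remaining
    factor is bounded below by a positive constant. *)
Lemma nonneg_has_square c q : c != 0 -> (forall y, 0 <= c.[y]) ->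
    (size c <= (2 * q).+1)%N ->
  exists h C, [/\ h != 0, (size h <= q.+1)%N, 0 <= C &
    forall y, h.[y] ^+ 2 <= C * c.[y]].
Proof.
elim: q c => [|q IH] c c_neq0 c_ge0 sc.
all: have [[y0 ry]|/forallNP noroot] := EM (exists y0, root c y0).
2,4: exact: noroot_has_square.
  by have := root_size_gt1 c_neq0 ry; lia.
have [c' [cE c'0]] := poly_nonneg_root c_ge0 ry.
have c'_neq0 : c' != 0 by apply: contraNneq c_neq0 => c'00; rewrite cE c'00 mulr0.
have [|h [C [h0 sh C0 hC]]] := IH c' c'_neq0 c'0.
  move: sc; rewrite cE size_monicM ?monic_exp ?monicXsubC // size_exp_XsubC.
  by have := c'_neq0; rewrite -size_poly_eq0; lia.
exists (('X - y0%:P) * h), C; split=> //.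
- by rewrite mulf_neq0 ?polyXsubC_eq0.
- by apply: leq_trans (size_polyMleq _ _) _; rewrite size_XsubC.
- move=> y; rewrite cE.
  have -> : (('X - y0%:P) * h).[y] ^+ 2 = (y - y0) ^+ 2 * h.[y] ^+ 2.
    by rewrite !evalE; ring.
  have -> : C * (('X - y0%:P) ^+ 2 * c').[y] = (y - y0) ^+ 2 * (C * c'.[y]).
    by rewrite !evalE; ring.
  by rewrite ler_wpM2l ?sqr_ge0.
Qed.

Definition dominates_square a b c p q :=
  exists g h C, [/\ (size g <= p.+1)%N, (size h <= q.+1)%N, (g != 0) || (h != 0),
    0 <= C & forall X Z y, (g.[y] * X + h.[y] * Z) ^+ 2 <= C * qform a b c X Z y].

Lemma dominates_square_sym a b c p q :
  dominates_square c b a q p -> dominates_square a b c p q.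
Proof.
case=> g [h [C [sg sh gh C0 hC]]]; exists h, g, C; split=> //.
  by rewrite orbC.
move=> X Z y; have := hC Z X y; rewrite /qform.
by rewrite addrC; congr (_ <= C * _); ring.
Qed.

Lemma qform_shift a b c s X Z y :
  qform a (b + s * a) (c + 2%:P * s * b + s ^+ 2 * a) X Z y =
  qform a b c (X + s.[y] * Z) Z y.
Proof. by rewrite /qform !evalE; ring. Qed.

(** The substitution of X - s Z for X respects the bounds p and q because deg s
    <= q - p. *)
Lemma dominates_square_shift a b c s p q : (size s + p <= q.+1)%N ->
  dominates_square a (b + s * a) (c + 2%:P * s * b + s ^+ 2 * a) p q ->
  dominates_square a b c p q.
Proof.
move=> ss [g [h [C [sg sh gh C0 hC]]]]; exists g, (h - s * g), C; split=> //.
- apply: leq_trans (size_polyD _ _) _; rewrite geq_max sh size_polyN /=.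
  by apply: leq_trans (size_polyMleq _ _) _; lia.
- by case: eqVneq gh => // ->; rewrite mulr0 subr0.
- move=> X Z y; have := hC (X - s.[y] * Z) Z y; rewrite qform_shift subrK.
  by rewrite !evalE; congr (_ <= _); ring.
Qed.

(** At a root y0 of a the inequality b^2 <= a c makes b vanish too, so that X
    can absorb a factor y - y0. *)
Lemma dominates_square_root a b c y0 p q :
    (forall X Z y, 0 <= qform a b c X Z y) -> a != 0 -> root a y0 ->
    (size a <= (2 * p.+1).+1)%N -> (size b <= (p.+1 + q).+1)%N ->
    (forall a' b', a' != 0 -> (size a' <= (2 * p).+1)%N -> (size b' <= (p + q).+1)%N ->
       (forall X Z y, 0 <= qform a' b' c X Z y) -> dominates_square a' b' c p q) ->
  dominates_square a b c p.+1 q.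
Proof.
move=> F0 a_neq0 ra sa sb IH.
have disc := qform_disc F0.
have [a' [aE a'0]] := poly_nonneg_root (fun y => (let: And3 h _ _ := disc y in h)) ra.
have a'_neq0 : a' != 0 by apply: contraNneq a_neq0 => a'00; rewrite aE a'00 mulr0.
have /factor_theorem[b' bE] : root b y0.
  have [_ _] := disc y0; rewrite (eqP ra) mul0r => h.
  by rewrite rootE -sqrf_eq0 eq_le h sqr_ge0.
have qE X Z y : qform a b c X Z y = qform a' b' c ((y - y0) * X) Z y.
  by rewrite /qform aE bE !evalE; ring.
have F'0 X Z y : 0 <= qform a' b' c X Z y.
  have -> : qform a' b' c X Z y = (X ^+ 2 *: a' + (2 * X * Z) *: b' + Z ^+ 2 *: c).[y].
    by rewrite /qform !evalE; ring.
  apply: (@poly_ge0_off _ _ y0) => z zy0.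
  have := F0 (X / (z - y0)) Z z; rewrite qE mulrC divfK ?subr_eq0 //.
  by rewrite /qform !evalE; congr (0 <= _); ring.
have [||g [h [C [sg sh gh C0 hC]]]] := IH a' b' a'_neq0 _ _ F'0.
- move: sa; rewrite aE size_monicM ?monic_exp ?monicXsubC // size_exp_XsubC.
  by have := a'_neq0; rewrite -size_poly_eq0; lia.
- have [->|b'_neq0] := eqVneq b' 0; first by rewrite size_poly0.
  move: sb; rewrite bE mulrC size_monicM ?monicXsubC // size_XsubC.
  by have := b'_neq0; rewrite -size_poly_eq0; lia.
exists (('X - y0%:P) * g), h, C; split=> //.
- by apply: leq_trans (size_polyMleq _ _) _; rewrite size_XsubC.
- by rewrite mulf_eq0 polyXsubC_eq0.
- move=> X Z y; rewrite qE; have := hC ((y - y0) * X) Z y.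
  by rewrite !evalE; congr (_ <= _); ring.
Qed.

(** Induction on p + q. At each real zero of the discriminant a c - b^2, finite
    or at infinity, the form has a kernel; once a substitution X + s Z has moved
    this kernel onto a coordinate axis, a variable absorbs a linear factor. When
    there is no such zero, a c - b^2 dominates a, and the form dominates Z^2. *)
Lemma qform_dominates_square p q a b c :
    (forall X Z y, 0 <= qform a b c X Z y) -> (a != 0) || (c != 0) ->
    (size a <= (2 * p).+1)%N -> (size b <= (p + q).+1)%N -> (size c <= (2 * q).+1)%N ->
  dominates_square a b c p q.
Proof.
have [n] := ubnP (p + q); elim: n p q a b c => // n IH p q a b c.
wlog pq : p q a b c / (p <= q)%N => [wl|].
  have [pq|/ltnW qp] := leqP p q; first exact: wl.
  move=> pqn F0 ac sa sb sc.
  apply: dominates_square_sym; apply: wl => //; rewrite 1?orbC // 1?addnC //.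
  by move=> X Z y; have := F0 Z X y; rewrite /qform; congr (0 <= _); ring.
rewrite ltnS => pqn F0 ac sa sb sc.
have disc := qform_disc F0.
have a_ge0 y : 0 <= a.[y] by case: (disc y).
have c_ge0 y : 0 <= c.[y] by case: (disc y).
have [a0|a_neq0] := eqVneq a 0.
  move: ac; rewrite a0 eqxx /= => c_neq0.
  have b0 y : b.[y] = 0.
    have [_ _] := disc y; rewrite a0 horner0 mul0r => h.
    by apply/eqP; rewrite -sqrf_eq0 eq_le h sqr_ge0.
  have [h [C [h0 sh C0 hC]]] := nonneg_has_square c_neq0 c_ge0 sc.
  exists 0, h, C; split=> //; first by rewrite size_poly0.
    by rewrite h0 orbT.
  move=> X Z y; rewrite /qform b0 !horner0; have := hC y => hy.
  have -> : (0 * X + h.[y] * Z) ^+ 2 = h.[y] ^+ 2 * Z ^+ 2 by ring.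
  have -> : C * (0 * X ^+ 2 + 2 * 0 * X * Z + c.[y] * Z ^+ 2) = (C * c.[y]) * Z ^+ 2 by ring.
  by rewrite ler_wpM2r ?sqr_ge0.
(* completing the square *)
have square X Z y : a.[y] * qform a b c X Z y =
    (a.[y] * X + b.[y] * Z) ^+ 2 + (a * c - b ^+ 2).[y] * Z ^+ 2.
  by rewrite /qform !evalE; ring.
have D_ge0 y : 0 <= (a * c - b ^+ 2).[y].
  by have [_ _] := disc y; rewrite !evalE subr_ge0.
case: p => [|p] in pq pqn sa sb *.
  have aE : a = (a`_0)%:P by apply: size1_polyC; lia.
  exists a, b, a`_0; split=> //; rewrite ?a_neq0 //.
  - by have := a_ge0 0; rewrite aE hornerC coefC.
  - move=> X Z y; have -> : a`_0 = a.[y] by rewrite aE hornerC coefC.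
    by rewrite square lerDl mulr_ge0 // sqr_ge0.
(* a zero of a at infinity lowers the bound on its degree *)
have [sa2|sa2] := leqP (size a) (2 * p.+1)%N.
  have [k sak] : exists k, size a = (2 * k).+1 := odd_exists (poly_nonneg_odd_size a_neq0 a_ge0).
  have sb2 : (2 * size b <= size a + size c)%N := size_sqr_le (fun y => (let: And3 _ _ h := disc y in h)).
  have [g [h [C [sg sh gh C0 hC]]]] : dominates_square a b c p q by apply: IH => //; lia.
  by exists g, h, C; split => //; apply: leq_trans sg _.
have [[y0 ra]|/forallNP noroot] := EM (exists y0, root a y0).
  apply: dominates_square_root F0 a_neq0 ra sa sb _ => a' b' a'0 sa' sb' F'0.
  by apply: IH => //; rewrite a'0.
have a_gt0 y : 0 < a.[y].
  by rewrite lt_def a_ge0 andbT; apply/negP => /(noroot y).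
case: q => [//|q] in pq pqn sb sc *.
have shift_ge0 s X Z y :
    0 <= qform a (b + s * a) (c + 2%:P * s * b + s ^+ 2 * a) X Z y.
  by rewrite qform_shift.
have size_shift s : (size s + p.+1 <= q.+2)%N ->
    (size (b + s * a)%R <= (p.+1 + q.+1).+1)%N /\
    (size (c + 2%:P * s * b + s ^+ 2 * a)%R <= (2 * q.+1).+1)%N.
  move=> ss; have sM (u v : {poly R}) (m k : nat) :
      (size u <= m.+1)%N -> (size v <= k.+1)%N -> (size (u * v)%R <= (m + k).+1)%N.
    by move=> hu hv; apply: leq_trans (size_polyMleq _ _) _; lia.
  have [->|s0] := eqVneq s 0.
    by rewrite mul0r addr0 mulr0 mul0r addr0 expr0n mul0r addr0.
  have := size_poly_gt0 s; rewrite s0 => /prednK sE.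
  have sk : (size s <= (q.+1 - p.+1).+1)%N by lia.
  split; apply: leq_trans (size_polyD _ _) _; rewrite geq_max.
    rewrite sb /=; apply: leq_trans (sM _ _ _ _ sk sa) _; lia.
  apply/andP; split; last first.
    rewrite expr2; apply: leq_trans (sM _ _ _ _ (sM _ _ _ _ sk sk) sa) _; lia.
  apply: leq_trans (size_polyD _ _) _; rewrite geq_max sc /=.
  have s2 : (size (2%:P : {poly R})%R <= 0.+1)%N by exact: size_polyC_leq1.
  apply: leq_trans (sM _ _ _ _ (sM _ _ _ _ s2 sk) sb) _; lia.
have disc_shift s : a * (c + 2%:P * s * b + s ^+ 2 * a) - (b + s * a) ^+ 2 =
    a * c - b ^+ 2 by ring.
(* the kernel of the form at y0 is moved onto the Z axis *)
have [[y0 rD]|/forallNP norootD] := EM (exists y0, root (a * c - b ^+ 2) y0).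
  pose s : {poly R} := (- b.[y0] / a.[y0])%:P.
  have ss : (size s + p.+1 <= q.+2)%N.
    have : (size s <= 1)%N by exact: size_polyC_leq1.
    lia.
  apply: (dominates_square_shift ss).
  have [sb1 sc1] := size_shift s ss.
  move: sb1 sc1 (shift_ge0 s) (disc_shift s).
  have : root (b + s * a) y0.
    by rewrite rootE !evalE divfK ?subrr // gt_eqF.
  move: (b + s * a) (c + _ + _) => b1 c1 rb1 sb1 sc1 F1 discE.
  have [c10|c1_neq0] := eqVneq c1 0.
    have [] : dominates_square a b1 c1 p.+1 q.
      have b10 : (2 * size b1 <= size (0%R : {poly R}) + size (0%R : {poly R}))%N.
        apply: size_sqr_le => y.
        by have [_ _] := qform_disc F1 y; rewrite c10 horner0 !mulr0.
      rewrite size_poly0 in b10.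
      by apply: IH => //; rewrite ?a_neq0 ?c10 ?size_poly0 //; lia.
    move=> g [h [C [sg sh gh C0 hC]]]; exists g, h, C; split=> //.
    exact: leq_trans sh _.
  apply: dominates_square_sym.
  apply: (@dominates_square_root _ _ _ y0) => //.
  - by move=> X Z y; have := F1 Z X y; rewrite /qform; congr (0 <= _); ring.
  - move: rD; rewrite -discE !rootE !evalE (eqP rb1) expr0n subr0 mulf_eq0.
    by rewrite gt_eqF.
  - by rewrite addnC.
  - move=> c' b' c'0 sc' sb' F'; apply: dominates_square_sym; apply: IH => //.
    + lia.
    + by move=> X Z y; have := F' Z X y; rewrite /qform; congr (0 <= _); ring.
    + by rewrite a_neq0.
    + by rewrite addnC.
have D_gt0 y : 0 < (a * c - b ^+ 2).[y].
  by rewrite lt_def D_ge0 andbT; apply/negP => /(norootD y).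
(* the same at infinity: s cancels the coefficient of highest degree of b *)
have [sD|sD] := leqP (size (a * c - b ^+ 2)%R) (2 * p.+1 + 2 * q.+1)%N.
  pose k := - b`_(p.+1 + q.+1) / a`_(2 * p.+1).
  pose s : {poly R} := k%:P * 'X^(q - p).
  have ss : (size s + p.+1 <= q.+2)%N.
    have k1 : (size k%:P <= 1)%N by exact: size_polyC_leq1.
    have : (size s <= (size k%:P + (q - p).+1).-1)%N.
      by rewrite -[(q - p).+1](size_polyXn R); exact: size_polyMleq.
    lia.
  apply: (dominates_square_shift ss).
  have [sb1 sc1] := size_shift s ss.
  move: sb1 sc1 (shift_ge0 s) (disc_shift s).
  have a2p : a`_(2 * p.+1) != 0.
    have -> : (2 * p.+1)%N = (size a).-1 by lia.
    by rewrite -/(lead_coef a) lead_coef_eq0.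
  have : (b + s * a)`_(p.+1 + q.+1) = 0.
    rewrite coefD /s -mulrA coefCM coefXnM ltnNge.
    have -> : (q - p <= p.+1 + q.+1)%N by lia.
    have -> : (p.+1 + q.+1 - (q - p) = 2 * p.+1)%N by lia.
    by rewrite /k /= divfK // subrr.
  move: (b + s * a) (c + _ + _) => b1 c1 b1top sb1 sc1 F1 discE.
  have {}sb1 : (size b1 <= p.+1 + q.+1)%N.
    apply/leq_sizeP => j; rewrite leq_eqVlt => /predU1P[<-//|hj].
    by apply: nth_default; apply: leq_trans hj.
  have [] : dominates_square a b1 c1 p.+1 q.
    have [c10|c1_neq0] := eqVneq c1 0.
      by apply: IH => //; rewrite ?a_neq0 ?c10 ?size_poly0 //; lia.
    have [k1 sck] : exists k, size c1 = (2 * k).+1 := odd_exists (poly_nonneg_odd_size c1_neq0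
      (fun y => (let: And3 _ h _ := qform_disc F1 y in h))).
    have sac : (size (a * c1)%R <= 2 * p.+1 + 2 * q.+1)%N.
      have -> : a * c1 = (a * c - b ^+ 2) + b1 ^+ 2 by rewrite -discE subrK.
      apply: leq_trans (size_polyD _ _) _; rewrite geq_max sD /=.
      by rewrite expr2; apply: leq_trans (size_polyMleq _ _) _; lia.
    apply: IH => //; rewrite ?a_neq0 //; try lia.
    have sz : size (a * c1)%R = (size a + size c1).-1 by rewrite size_mul.
    by rewrite sz in sac; lia.
  move=> g [h [C [sg sh gh C0 hC]]]; exists g, h, C; split=> //.
  exact: leq_trans sh _.
have [|C C0 hC] := poly_pos_dominates (a := a) D_gt0; first by lia.
exists 0, 1, C; split=> //.
- by rewrite size_poly0.
- by rewrite size_poly1.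
- by rewrite oner_neq0 orbT.
move=> X Z y; rewrite -(ler_pM2l (a_gt0 y)) [X in _ <= X]mulrCA square.
rewrite mulrDr !evalE.
have h1 : 0 <= C * (a.[y] * X + b.[y] * Z) ^+ 2 by rewrite mulr_ge0 ?sqr_ge0.
have h2 : a.[y] * Z ^+ 2 <= C * ((a * c - b ^+ 2).[y] * Z ^+ 2).
  rewrite [X in _ <= X]mulrA; apply: ler_wpM2r; [exact: sqr_ge0|exact: hC].
move: h2; rewrite !evalE; lra.
Qed.

End BinaryForms.

(** * Bivariate polynomials and total degree *)
Section Bivariate.
Variable R : realType.
Implicit Types (F G : {poly {poly R}}).

(** The outer variable is x and the inner one is y. *)
Definition ev F (x y : R) := F.[x%:P].[y].
Definition fiber (y : R) F : {poly R} := map_poly (horner_eval y) F.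

Lemma fiberE F x y : (fiber y F).[x] = ev F x y.
Proof.
rewrite /fiber /ev -[(F.[_]).[y]]/(horner_eval y F.[x%:P]) -horner_map /=.
by rewrite /horner_eval hornerC.
Qed.

Lemma fiberM F G y : fiber y (F * G) = fiber y F * fiber y G.
Proof. exact: rmorphM. Qed.

Lemma fiber_monic F y : F \is monic -> fiber y F \is monic.
Proof. exact: monic_map. Qed.

Lemma evM F G x y : ev (F * G) x y = ev F x y * ev G x y.
Proof. by rewrite /ev !hornerM. Qed.
Lemma evD F G x y : ev (F + G) x y = ev F x y + ev G x y.
Proof. by rewrite /ev !hornerD. Qed.
Lemma evX F n x y : ev (F ^+ n) x y = ev F x y ^+ n.
Proof. by rewrite /ev !horner_exp. Qed.
Lemma evC f x y : ev f%:P x y = f.[y].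
Proof. by rewrite /ev hornerC. Qed.
Lemma ev1 x y : ev 1 x y = 1.
Proof. by rewrite evC hornerC. Qed.
Lemma ev_sum (I : Type) (r : seq I) (Q : pred I) (F : I -> {poly {poly R}}) x y :
  ev (\sum_(i <- r | Q i) F i) x y = \sum_(i <- r | Q i) ev (F i) x y.
Proof. by rewrite /ev !horner_sum. Qed.
Lemma ev_coef F x y : ev F x y = \sum_(i < size F) (F`_i).[y] * x ^+ i.
Proof.
by rewrite /ev [F.[_]]horner_coef horner_sum; apply: eq_bigr => i _; rewrite !evalE.
Qed.

Lemma poly_values_eq0 (f : {poly R}) : (forall x, f.[x] = 0) -> f = 0.
Proof.
move=> f0; apply/eqP/negP => /negP f_neq0.
have := ge_cauchy_bound f_neq0 (x := cauchy_bound f).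
by rewrite in_itv /= lexx rootE f0 eqxx => /(_ isT).
Qed.

Lemma ev_eq0 F : (forall x y, ev F x y = 0) -> F = 0.
Proof.
move=> F0; apply/polyP => i; rewrite coef0; apply: poly_values_eq0 => y.
have /polyP/(_ i) : fiber y F = 0 by apply: poly_values_eq0 => x; rewrite fiberE.
by rewrite coef0 coef_map.
Qed.

(** The substitution x := T, y := y T, a ring morphism whose degree in T is the
    total degree. The powers of y keep apart the monomials of equal total
    degree, so no cancellation occurs. *)
Definition grade_coef : {poly R} -> {poly {poly R}} :=
  horner_eval ('X%:P * 'X) \o map_poly (polyC \o polyC).
HB.instance Definition _ := GRing.RMorphism.copy grade_coef
  (horner_eval ('X%:P * 'X) \o map_poly (polyC \o polyC)).
Definition grade : {poly {poly R}} -> {poly {poly R}} :=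
  horner_eval 'X \o map_poly grade_coef.
HB.instance Definition _ := GRing.RMorphism.copy grade
  (horner_eval 'X \o map_poly grade_coef).

Lemma gradeM F G : grade (F * G) = grade F * grade G.
Proof. exact: rmorphM. Qed.
Lemma gradeD F G : grade (F + G) = grade F + grade G.
Proof. exact: rmorphD. Qed.

Definition tdeg (d : nat) F := (size (grade F) <= d.+1)%N.

Lemma coef_grade_coef (f : {poly R}) w : (grade_coef f)`_w = f`_w *: 'X^w.
Proof.
rewrite /grade_coef /= /horner_eval -[in LHS](coefK f) poly_def rmorph_sum /=.
rewrite horner_sum coef_sum.
rewrite (eq_bigr (fun i : 'I_(size f) => (f`_i *: 'X^i) *+ (w == i))) => [|i _].
  have [ws|sw] := ltnP w (size f).
    rewrite (bigD1 (Ordinal ws)) //= eqxx big1 ?addr0 // => i; rewrite -val_eqE /=.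
    by rewrite eq_sym => /negPf ->.
  rewrite nth_default // scale0r big1 // => i _.
  by rewrite gtn_eqF // (leq_trans (ltn_ord i)).
rewrite -mul_polyC rmorphM /= map_polyC /= map_polyXn /= hornerM hornerC horner_exp hornerX.
rewrite exprMn -polyC_exp mulrA -polyCM coefCM coefXn mul_polyC.
by rewrite mulr_natr.
Qed.

Lemma coef_grade F w j : (grade F)`_w`_j = if (j <= w)%N then F`_(w - j)`_j else 0.
Proof.
rewrite /grade /= /horner_eval -[in LHS](coefK F) poly_def rmorph_sum /=.
rewrite horner_sum !coef_sum.
rewrite (eq_bigr (fun i : 'I_(size F) => (F`_i`_j) *+ ((i + j)%N == w))) => [|i _].
  case: leqP => [jw|wj]; last first.
    by rewrite big1 // => i _; rewrite gtn_eqF // ltn_addl.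
  have [ws|sw] := ltnP (w - j) (size F).
    rewrite (bigD1 (Ordinal ws)) //= subnK // eqxx big1 ?addr0 // => i.
    rewrite -val_eqE /= => iwj; case: eqP => // ijw.
    by rewrite -ijw addnK eqxx in iwj.
  rewrite [F`_(w - j)]nth_default // coef0 big1 // => i _; case: eqP => // ijw.
  by have := ltn_ord i; move: sw; rewrite -ijw addnK leqNgt => /negPf ->.
rewrite -mul_polyC rmorphM /= map_polyC /= map_polyXn /= hornerM hornerC horner_exp hornerX.
rewrite coefMXn; case: ltnP => [wi|iw].
  by rewrite coef0 gtn_eqF // (leq_trans wi) // leq_addr.
rewrite coef_grade_coef coefZ coefXn.
have [->|jwi] := eqVneq j (w - i)%N; first by rewrite subnKC // eqxx mulr1.
rewrite mulr0; case: eqP => // ijw.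
by rewrite -ijw addKn eqxx in jwi.
Qed.

Lemma tdegP d F : reflect (forall i, (size (F`_i)%R <= d.+1 - i)%N) (tdeg d F).
Proof.
apply: (iffP idP) => [/leq_sizeP h i|h].
  apply/leq_sizeP => j ij; have /h : (d < i + j)%N by lia.
  by move/polyP/(_ j); rewrite coef_grade leq_addl addnK coef0.
apply/leq_sizeP => w dw; apply/polyP => j; rewrite coef_grade coef0.
case: leqP => // jw; apply: nth_default; apply: leq_trans (h _) _; lia.
Qed.

Lemma tdegM m n F G : tdeg m F -> tdeg n G -> tdeg (m + n) (F * G).
Proof.
rewrite /tdeg gradeM => hF hG; apply: leq_trans (size_polyMleq _ _) _; lia.
Qed.

Lemma tdegD d F G : tdeg d F -> tdeg d G -> tdeg d (F + G).
Proof.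
rewrite /tdeg gradeD => hF hG.
by apply: leq_trans (size_polyD _ _) _; rewrite geq_max hF.
Qed.

Lemma tdeg0 d : tdeg d 0.
Proof. by rewrite /tdeg rmorph0 size_poly0. Qed.

Lemma tdeg_sum d (I : Type) (r : seq I) (Q : pred I) (F : I -> {poly {poly R}}) :
  (forall i, Q i -> tdeg d (F i)) -> tdeg d (\sum_(i <- r | Q i) F i).
Proof. by move=> h; elim/big_rec: _ => [|i G /h]; [exact: tdeg0|exact: tdegD]. Qed.

Lemma tdegW m n F : (m <= n)%N -> tdeg m F -> tdeg n F.
Proof. by rewrite /tdeg => mn /leq_trans; apply. Qed.

Lemma tdegX k d F : tdeg d F -> tdeg (d * k) (F ^+ k).
Proof.
move=> hF; elim: k => [|k IH]; first by rewrite muln0 expr0 /tdeg rmorph1 size_poly1.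
by rewrite mulnS exprS; exact: tdegM.
Qed.

Lemma tdegC d (f : {poly R}) : (size f <= d.+1)%N -> tdeg d f%:P.
Proof. by move=> sf; apply/tdegP => -[|i]; rewrite coefC ?subn0 //= size_poly0. Qed.

Lemma tdeg_x : tdeg 1 'X.
Proof.
by apply/tdegP => -[|[|i]]; rewrite coefX ?size_poly1 ?size_poly0.
Qed.

Lemma tdeg_size d F : tdeg d F -> (size F <= d.+1)%N.
Proof.
move=> /tdegP h; apply/leq_sizeP => i di; apply/eqP; rewrite -size_poly_leq0.
by apply: leq_trans (h i) _; lia.
Qed.

Lemma monic_grade_gt F m : F \is monic -> size F = m.+1 -> (m < size (grade F))%N.
Proof.
move=> /monicP; rewrite lead_coefE => lF sF; rewrite sF /= in lF.
rewrite ltnNge; apply/negP => /leq_sizeP/(_ m (leqnn m))/polyP/(_ 0%N).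
by rewrite coef_grade leq0n subn0 lF coef0 coef1 => /eqP; rewrite oner_eq0.
Qed.

(** Total degrees add up, and that of F is at least its degree m in x. *)
Lemma tdeg_cancel F G m n : F \is monic -> size F = m.+1 ->
  tdeg (m + n) (F * G) -> tdeg n G.
Proof.
move=> Fm sF; have gF := monic_grade_gt Fm sF.
have [G0|G_neq0] := eqVneq (grade G) 0; first by rewrite /tdeg G0 size_poly0.
have sz : size (grade F * grade G) = (size (grade F) + size (grade G)).-1.
  by rewrite size_mul // -size_poly_gt0 (leq_ltn_trans _ gF).
rewrite /tdeg gradeM sz; lia.
Qed.

End Bivariate.

(** * Gauss's lemma and common factors *)
Section Gauss.
Variable K : fieldType.
Implicit Types (c d : {poly K}) (F G D H : {poly {poly K}}).

Lemma irreducible_factor c : (1 < size c)%N ->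
  exists2 d, irreducible_poly d & d %| c.
Proof.
have [n] := ubnP (size c); elim: n c => // n IH c; rewrite ltnS => sc c1.
have [irr|/existsNP notirr] := EM (forall q : {poly K}, size q != 1 -> q %| c -> q %= c).
  by exists c; rewrite ?dvdpp.
case: notirr => q /not_implyP[q1 /not_implyP[qc /negP neq]].
have c0 : c != 0 by rewrite -size_poly_gt0 ltnW.
have q0 : q != 0 by apply: contraNneq c0 => q0; rewrite q0 dvd0p in qc.
have [||d dirr dq] := IH q.
- apply: leq_trans sc; rewrite ltn_neqAle dvdp_leq // andbT.
  by rewrite (dvdp_size_eqp qc).
- by rewrite ltn_neqAle eq_sym q1 size_poly_gt0.
- by exists d => //; exact: dvdp_trans qc.
Qed.

Definition divides_coefs d F := forall i, d %| F`_i.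

Lemma divides_coefsP d F : divides_coefs d F -> exists F', F = d *: F'.
Proof.
move=> h; exists (\poly_(i < size F) (F`_i %/ d)).
apply/polyP => i; rewrite coefZ coef_poly mulrC; case: ltnP => [_|si].
  by rewrite divpK.
by rewrite mul0r nth_default.
Qed.

(** Take the first coefficients of F and of G that d does not divide, of indices
    i and j: in the coefficient of index i + j of the product, d divides all
    terms but theirs. *)
Lemma irreducible_divides_coefsM d F G : irreducible_poly d ->
  divides_coefs d (F * G) -> divides_coefs d F \/ divides_coefs d G.
Proof.
move=> dirr hFG; apply: contrapT => /not_orP[/existsNP[i hi] /existsNP[j hj]].
have exi : exists i, ~~ (d %| F`_i) by exists i; apply/negP.
have exj : exists j, ~~ (d %| G`_j) by exists j; apply/negP.
case: (ex_minnP exi) => {exi hi}i hi mini.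
case: (ex_minnP exj) => {exj hj}j hj minj.
have := hFG (i + j)%N; rewrite coefM.
have ilt : (i < (i + j).+1)%N by rewrite ltnS leq_addr.
rewrite (bigD1 (Ordinal ilt)) //= addKn dvdp_addl; last first.
  apply: (big_ind (fun s => d %| s)) => [|p q|k kni]; [exact: dvdp0|by move=> dp dq; exact: dvdp_add|].
  have [ki|ik] := ltnP k i.
    by apply: dvdp_mulr; case: (boolP (d %| F`_k)) => // /mini; rewrite leqNgt ki.
  apply: dvdp_mull; case: (boolP (d %| G`_(i + j - k))) => // /minj.
  have : (k != i :> nat) by rewrite -val_eqE in kni.
  by have := ltn_ord k; lia.
have cop c : ~~ (d %| c) -> coprimep d c.
  move=> dc; rewrite coprimep_def; apply/negP => /negP h.
  have := dirr.2 _ h (dvdp_gcdl d c) => /eqp_dvdl eg.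
  by rewrite -eg dvdp_gcdr in dc.
by rewrite Gauss_dvdpr ?cop // (negPf hj).
Qed.

(** The irreducible factors of c are moved one at a time into F or G; the
    constant e collects those that F gives up. *)
Lemma gauss_factor c D F G : c != 0 -> c *: D = F * G ->
  exists e F' G', [/\ F = e *: F', D = F' * G' & e != 0].
Proof.
have [n] := ubnP (size c); elim: n c F G => // n IH c F G; rewrite ltnS => sc c0 E.
have [c1|c1] := leqP (size c) 1.
  have /size_poly1P[k k0 cE] : size c == 1.
    by rewrite eqn_leq c1 size_poly_gt0.
  exists 1, F, ((k^-1)%:P *: G); split; rewrite ?scale1r ?oner_neq0 //.
  by rewrite -scalerAr -E cE scalerA -polyCM mulVf // scale1r.
have [d dirr /dvdpP[c' cE]] := irreducible_factor c1.
have d0 := irredp_neq0 dirr.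
have c'0 : c' != 0 by apply: contraNneq c0 => c'0; rewrite cE c'0 mul0r.
have sc' : (size c' < n)%N.
  have sz : size (c' * d) = (size c' + size d).-1 by rewrite size_mul.
  have d1 : (1 < size d)%N by exact: dirr.1.
  have c'1 : (0 < size c')%N by rewrite size_poly_gt0.
  by apply: leq_trans sc; rewrite cE sz; lia.
have canc (A B : {poly {poly K}}) : d *: A = d *: B -> A = B.
  by rewrite -!mul_polyC; apply: mulfI; rewrite polyC_eq0.
have dFG : divides_coefs d (F * G).
  by move=> i; rewrite -E coefZ cE -mulrA mulrCA dvdp_mulr.
have [/divides_coefsP[F' FE]|/divides_coefsP[G' GE]] :=
    irreducible_divides_coefsM dirr dFG.
- have [|e [F'' [G'' [E1 E2 E3]]]] := IH c' F' G sc' c'0.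
    by apply: canc; rewrite scalerA mulrC -cE E FE scalerAl.
  by exists (d * e), F'', G''; split; rewrite ?mulf_neq0 // FE E1 scalerA.
- apply: (IH c' F G' sc' c'0).
  by apply: canc; rewrite scalerA mulrC -cE E GE scalerAr.
Qed.

(** The gcd over the fraction field divides D over R[y] up to a constant, by
    Gauss's lemma. As a factor of a monic polynomial it is monic up to a unit,
    and Euclidean division shows that it divides H as well. *)
Lemma monic_common_factor D H : D \is monic -> resultant D H = 0 ->
  exists g q w, [/\ g \is monic, (1 < size g)%N, D = g * q & H = g * w].
Proof.
move=> Dm /eqP; rewrite resultant_eq0 => sg.
set g := gcdp D H in sg *.
have /Pdiv.Idomain.dvdpP[[c q] /= c0 cE] : g %| D := dvdp_gcdl D H.
rewrite mulrC in cE.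
have [e [g0 [q0 [gE DE e0]]]] := gauss_factor c0 cE.
have lcE : lead_coef g0 * lead_coef q0 = 1 by rewrite -lead_coefM -DE (monicP Dm).
pose u := lead_coef q0; pose v := lead_coef g0.
have uv : u * v = 1 by rewrite mulrC.
have u0 : u != 0 by apply: contra_eq_neq uv => ->; rewrite mul0r eq_sym oner_neq0.
have g1m : u *: g0 \is monic by apply/monicP; rewrite lead_coefZ uv.
have sg1 : size (u *: g0) = size g by rewrite gE !size_scale.
have /Pdiv.Idomain.dvdpP[[c' w] /= c'0 c'E] : g %| H := dvdp_gcdr D H.
have gE1 : g = (e * v) *: (u *: g0).
  by rewrite gE scalerA -mulrA [v * u]mulrC uv mulr1.
exists (u *: g0), (v *: q0), (H %/ (u *: g0)); split=> //.
- by rewrite sg1.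
- by rewrite -scalerAl -scalerAr scalerA uv scale1r.
have HE := Pdiv.IdomainMonic.divp_eq g1m H.
rewrite {1}HE mulrC; suff -> : H %% (u *: g0) = 0 by rewrite addr0.
set r := _ %% _ in HE *; apply/eqP/negP => /negP r0.
have sr : (size r < size (u *: g0))%N by rewrite ltn_modpN0 // monic_neq0.
set Q := H %/ (u *: g0) in HE *.
have : c' *: r = (u *: g0) * ((e * v) *: w - c' *: Q).
  have rE : r = H - Q * (u *: g0) by rewrite {1}HE addrC addKr.
  rewrite {1}rE scalerBr c'E {1}gE1 -!mul_polyC; ring.
move/(congr1 (fun p => size (polyseq p))); rewrite size_scale //.
have [->|z0] := eqVneq ((e * v) *: w - c' *: Q) 0.
  by rewrite mulr0 size_poly0 => /eqP; rewrite size_poly_eq0 (negPf r0).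
rewrite size_monicM // => szr; move: sr; rewrite szr.
move: z0; rewrite -size_poly_gt0; case: (size (polyseq (_ - _))) => // m _.
by rewrite addnS /= ltnNge leq_addr.
Qed.

End Gauss.

(** * Ternary forms and affine charts *)
Section Forms.
Variable R : realType.
Implicit Types (P Q H : {mpoly R[3]}) (F G : {poly {poly R}}).

Definition triple (T : Type) (x y z : T) (i : 'I_3) : T :=
  match val i with 0 => x | 1 => y | _ => z end.

Definition pev P x y z := P.@[triple x y z].

Lemma triple_eta (T : Type) (v : 'I_3 -> T) :
  v =1 triple (v ord0) (v (inord 1)) (v (inord 2)).
Proof.
move=> i; rewrite /triple; case: i => -[|[|[|//]]] hi /=; congr v; apply: val_inj => //=.
  by rewrite inordK.
by rewrite inordK.
Qed.

Lemma meval_pev P v : P.@[v] = pev P (v ord0) (v (inord 1)) (v (inord 2)).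
Proof. by apply: meval_eq; exact: triple_eta. Qed.

Lemma pevB P Q x y z : pev (P - Q) x y z = pev P x y z - pev Q x y z.
Proof. exact: mevalB. Qed.
Lemma pevZ c P x y z : pev (c *: P) x y z = c * pev P x y z.
Proof. exact: mevalZ. Qed.
Lemma pev_exp P k x y z : pev (P ^+ k) x y z = pev P x y z ^+ k.
Proof. by rewrite /pev rmorphXn. Qed.

Lemma pev_homog P d l x y z : P \is d.-homog ->
  pev P (l * x) (l * y) (l * z) = l ^+ d * pev P x y z.
Proof.
move=> /dhomogP hP; rewrite /pev !mevalE mulr_sumr; apply: eq_big_seq => m /hP /= dm.
rewrite mulrCA; congr (_ * _).
rewrite -dm mdegE -prodrXr -big_split /=; apply: eq_bigr => i _.
by rewrite -exprMn; congr (_ ^+ _); rewrite /triple; case: (val i) => [|[|]].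
Qed.

(** Restriction to a line: it turns limits of forms into limits of univariate
    polynomials. *)
Definition line (a b : 'I_3 -> R) P : {poly R} :=
  mmap polyC (fun i => (a i)%:P + (b i)%:P * 'X) P.

Lemma lineE a b P t : (line a b P).[t] = P.@[fun i => a i + b i * t].
Proof.
rewrite /line /mmap horner_sum mevalE; apply: eq_bigr => m _.
rewrite hornerM hornerC /mmap1 horner_prod; congr (_ * _).
by apply: eq_bigr => i _; rewrite !evalE.
Qed.

Lemma pev_ge0_dense P : (forall x y z, z != 0 -> 0 <= pev P x y z) ->
  forall x y z, 0 <= pev P x y z.
Proof.
move=> h x y z.
have pE t : (line (triple x y 0) (triple 0 0 1) P).[t] = pev P x y t.
  rewrite lineE; apply: meval_eq => i; rewrite /triple.
  by case: i => -[|[|[|//]]] hi /=; ring.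
by rewrite -pE; apply: (@poly_ge0_off _ _ 0) => t t0; rewrite pE h.
Qed.

(** Dehomogenization at z = 1. *)
Definition aff P : {poly {poly R}} :=
  mmap (polyC \o polyC) (triple 'X 'X%:P 1) P.

Lemma ev_aff P x y : ev (aff P) x y = pev P x y 1.
Proof.
rewrite /aff /mmap ev_sum /pev mevalE; apply: eq_bigr => m _.
rewrite evM /= evC hornerC; congr (_ * _).
rewrite /mmap1 /ev !horner_prod; apply: eq_bigr => i _.
rewrite !horner_exp /triple; congr (_ ^+ _).
by case: (val i) => [|[|_]]; rewrite ?hornerX ?hornerC ?hornerX ?hornerC.
Qed.

(** In a form of degree d the exponents of x and y determine that of z. *)
Lemma aff_coef P d m : P \is d.-homog -> m \in msupp P ->
  (aff P)`_(m ord0)`_(m (inord 1)) = P@_m.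
Proof.
move=> /dhomogP hP mP; rewrite /aff /mmap !coef_sum.
have coefm n : (polyC \o polyC) P@_n * mmap1 (triple 'X 'X%:P 1) n =
    ((P@_n *: 'X^(n (inord 1)))%:P * 'X^(n ord0)) :> {poly {poly R}}.
  rewrite /mmap1 !big_ord_recl big_ord0 /= /triple /= expr1n !mulr1.
  have -> : lift ord0 (ord0 : 'I_2) = inord 1 by apply: val_inj; rewrite /= inordK.
  rewrite -[in RHS]mul_polyC polyCM polyC_exp; ring.
rewrite (bigD1_seq m) ?msupp_uniq //= coefm coefMXn ltnn subnn coefC eqxx coefZ coefXn eqxx mulr1.
rewrite big_seq_cond big1 ?addr0 // => n /andP[nP nm]; rewrite coefm.
rewrite coefMXn; case: ltnP => [_|h0]; first by rewrite coef0.
rewrite coefC; case: eqP => [e0|_]; last by rewrite coef0.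
rewrite coefZ coefXn; case: eqP => [e1|_]; last by rewrite mulr0.
case/eqP: nm; apply/mnmP => i.
have e0' : n ord0 = m ord0 by apply/eqP; rewrite eqn_leq h0 -subn_eq0 e0 eqxx.
have := hP n nP; have := hP m mP; rewrite /= !mdegE !big_ord_recl !big_ord0 /= => s1 s2.
have l1 : lift ord0 (ord0 : 'I_2) = inord 1 :> 'I_3 by apply: val_inj; rewrite /= inordK.
have l2 : lift ord0 (lift ord0 (ord0 : 'I_1)) = inord 2 :> 'I_3 by apply: val_inj; rewrite /= inordK.
rewrite l1 l2 in s1 s2.
have := triple_eta n i; have := triple_eta m i => -> ->.
by rewrite /triple; case: (val i) => [|[|_]] //; lia.
Qed.

Lemma aff_eq0 P d : P \is d.-homog -> aff P = 0 -> P = 0.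
Proof.
move=> hP aP; apply/eqP; rewrite -msupp_eq0; case E: (msupp P) => [//|m s].
have mP : m \in msupp P by rewrite E mem_head.
by have := aff_coef hP mP; rewrite aP !coef0 => /esym/eqP; rewrite mcoeff_eq0 mP.
Qed.

Lemma form_eq0 P d : P \is d.-homog -> (forall x y z, pev P x y z = 0) -> P = 0.
Proof.
by move=> hP P0; apply: (aff_eq0 hP); apply: ev_eq0 => x y; rewrite ev_aff.
Qed.

Lemma tdeg_aff P d : P \is d.-homog -> tdeg d (aff P).
Proof.
move=> /dhomogP hP; rewrite /aff /mmap big_seq; apply: tdeg_sum => m /hP /= dm.
rewrite -[d]add0n; apply: tdegM.
  by apply: tdegC; exact: size_polyC_leq1.
rewrite -dm /mmap1 mdegE; elim/big_ind2: _ => [|F m1 G m2|i _].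
- by apply: tdegC; rewrite size_poly1.
- exact: tdegM.
rewrite -[X in tdeg X]mul1n; apply: tdegX; rewrite /triple.
case: (val i) => [|[|_]]; first exact: tdeg_x.
  by apply: tdegC; rewrite size_polyX.
by apply: tdegC; rewrite size_poly1.
Qed.

Definition homogenize d F : {mpoly R[3]} :=
  \sum_(i < d.+1) \sum_(j < d.+1)
    F`_i`_j *: ('X_ord0 ^+ i * 'X_(inord 1) ^+ j * 'X_(inord 2) ^+ (d - i - j)).

Lemma homogenize_homog d F : tdeg d F -> homogenize d F \is d.-homog.
Proof.
move=> /tdegP hF; apply: rpred_sum => i _; apply: rpred_sum => j _.
have [ij|ij] := leqP (i + j) d.
  apply: dhomogZ.
  have X1 k n : ('X_k ^+ n : {mpoly R[3]}) \is n.-homog.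
    by rewrite -[X in X.-homog]mul1n; apply: dhomogMn; rewrite dhomogX /= mdeg1.
  have E : (i + j + (d - i - j) = d)%N by lia.
  rewrite -[X in X.-homog]E.
  by apply: dhomogM; [apply: dhomogM|]; exact: X1.
rewrite (nth_default 0 (s := F`_i)) ?scale0r ?dhomog0 //.
by apply: leq_trans (hF i) _; lia.
Qed.

Lemma pev_homogenize d F x y z : tdeg d F -> z != 0 ->
  pev (homogenize d F) x y z = z ^+ d * ev F (x / z) (y / z).
Proof.
move=> hF z0; rewrite /pev raddf_sum /=.
have -> : ev F (x / z) (y / z) =
    \sum_(i < d.+1) \sum_(j < d.+1) F`_i`_j * (y / z) ^+ j * (x / z) ^+ i.
  rewrite /ev (horner_coef_wide _ (tdeg_size hF)) horner_sum; apply: eq_bigr => i _.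
  rewrite -polyC_exp hornerM hornerC (@horner_coef_wide _ d.+1) ?mulr_suml //.
  by move/tdegP: hF => /(_ i) /leq_trans; apply; rewrite leq_subr.
rewrite mulr_sumr; apply: eq_bigr => i _; rewrite raddf_sum mulr_sumr /=.
apply: eq_bigr => j _; rewrite /= mevalZ !mevalM !rmorphXn /= !mevalXU.
rewrite /triple /= !inordK //=.
have [ij|ij] := leqP (i + j) d.
  have E : (i + j + (d - i - j) = d)%N by lia.
  by rewrite -[X in z ^+ X * _]E !exprD !expr_div_n; field; rewrite ?expf_neq0.
rewrite (nth_default 0 (s := F`_i)) ?mul0r ?mulr0 //.
by move/tdegP: hF => /(_ i) /leq_trans; apply; lia.
Qed.

Lemma pev_homogenize1 d F x y : tdeg d F -> pev (homogenize d F) x y 1 = ev F x y.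
Proof. by move=> hF; rewrite pev_homogenize ?oner_neq0 // expr1n mul1r !divr1. Qed.

(** Change of coordinates v |-> v *m g on row vectors. *)
Definition lin (g : 'M[R]_3) P : {mpoly R[3]} :=
  P \mPo [tuple \sum_(j < 3) g j i *: 'X_j | i < 3].

Lemma meval_lin g P v : (lin g P).@[v] = P.@[fun i => \sum_(j < 3) v j * g j i].
Proof.
rewrite /lin comp_mpoly_meval; apply: meval_eq => i; rewrite tnth_mktuple raddf_sum /=.
by apply: eq_bigr => j _; rewrite mevalZ mevalXU mulrC.
Qed.

Lemma lin_homog g P d : P \is d.-homog -> lin g P \is d.-homog.
Proof.
move=> /dhomogP hP; rewrite /lin comp_mpolyE big_seq; apply: rpred_sum => m /hP /= dm.
apply: dhomogZ; rewrite -dm mdegE.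
apply: (big_ind2 (fun (p : {mpoly R[3]}) n => p \is n.-homog)).
- exact: dhomog1.
- by move=> p m1 q m2; exact: dhomogM.
move=> i _; rewrite -[X in X.-homog]mul1n; apply: dhomogMn; rewrite tnth_mktuple.
by apply: rpred_sum => j _; apply: dhomogZ; rewrite dhomogX /= mdeg1.
Qed.

Lemma meval_linK g P v : g \in unitmx -> (lin (invmx g) (lin g P)).@[v] = P.@[v].
Proof.
move=> gu; rewrite !meval_lin; apply: meval_eq => i.
have := congr1 (fun A : 'rV[R]_3 => A 0 i) (mulmxKV gu (\row_j v j)).
rewrite !mxE => <-; apply: eq_bigr => j _; congr (_ * _).
by rewrite mxE; apply: eq_bigr => k _; rewrite mxE.
Qed.

End Forms.

(** * Forms with no square of a form below them *)
Section NoSquareBelow.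
Variable R : realType.
Implicit Types (P Q H : {mpoly R[3]}) (F G : {poly {poly R}}).

Definition pnonneg P := forall x y z, 0 <= pev P x y z.

(** All that is kept of the hypotheses on P: a square of a cubic below a
    multiple of P would contradict that P is extremal and not a sum of squares.
    Every linear change of coordinates preserves this property. *)
Definition no_square_below P := [/\ P \is 6.-homog, pnonneg P, P != 0 &
  forall (G : {mpoly R[3]}) C, G \is 3.-homog ->
    (forall x y z, pev G x y z ^+ 2 <= C * pev P x y z) -> G = 0].

(** Homogeneity covers z <> 0, and continuity the line z = 0. *)
Lemma homogenize_square_le P e F C : P \is (2 * e).-homog -> tdeg e F ->
    (forall x y, ev F x y ^+ 2 <= C * ev (aff P) x y) ->
  forall x y z, pev (homogenize e F) x y z ^+ 2 <= C * pev P x y z.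
Proof.
move=> hP hF h x y z; rewrite -subr_ge0 -pevZ -pev_exp -pevB.
apply: pev_ge0_dense => {}x {}y {}z z0.
rewrite pevB pevZ pev_exp pev_homogenize // subr_ge0.
have -> : pev P x y z = pev P (z * (x / z)) (z * (y / z)) (z * 1).
  by rewrite mulr1 ![z * _]mulrC !divfK.
rewrite (pev_homog _ _ _ _ hP) exprMn -exprM [(e * 2)%N]mulnC.
rewrite [X in _ <= X]mulrCA -ev_aff; apply: ler_wpM2l; last exact: h.
by rewrite exprn_even_ge0 // mul2n odd_double.
Qed.

Lemma homogenize_neq0 e F : tdeg e F -> F != 0 -> homogenize e F != 0.
Proof.
move=> hF; apply: contraNneq => h0; apply/eqP; apply: ev_eq0 => x y.
by rewrite -(pev_homogenize1 _ _ hF) h0 /pev meval0.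
Qed.

Lemma no_square_below_aff_eq0 P F C : no_square_below P -> tdeg 3 F ->
  (forall x y, ev F x y ^+ 2 <= C * ev (aff P) x y) -> F = 0.
Proof.
move=> [hP _ _ S] hF h; apply/eqP/negP => /negP /(homogenize_neq0 hF) /eqP; apply.
by apply: (S _ C); [exact: homogenize_homog|exact: (@homogenize_square_le P 3)].
Qed.

Lemma aff_nonneg P : pnonneg P -> forall x y, 0 <= ev (aff P) x y.
Proof. by move=> h x y; rewrite ev_aff. Qed.

Lemma pev_lin g P x y z : pev (lin g P) x y z =
  P.@[fun i => x * g 0 i + y * g (inord 1) i + z * g (inord 2) i].
Proof.
rewrite /pev meval_lin; apply: meval_eq => i.
rewrite !big_ord_recl big_ord0 /= addr0 /triple /= addrA.
by congr (_ + _ * g _ _ + _ * g _ _); apply: val_inj; rewrite /= inordK.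
Qed.

Lemma pnonneg_lin g P : pnonneg P -> pnonneg (lin g P).
Proof. by move=> h x y z; rewrite pev_lin meval_pev. Qed.

Lemma linK g P d : g \in unitmx -> P \is d.-homog -> lin (invmx g) (lin g P) = P.
Proof.
move=> gu hP; apply/eqP; rewrite -subr_eq0; apply/eqP/(@form_eq0 _ _ d).
  by rewrite rpredB // !lin_homog.
by move=> x y z; rewrite pevB /pev meval_linK // subrr.
Qed.

Lemma lin_neq0 g P d : g \in unitmx -> P \is d.-homog -> P != 0 -> lin g P != 0.
Proof.
move=> gu hP; apply: contraNneq => l0; rewrite -(linK gu hP) l0.
by rewrite /lin comp_mpoly0.
Qed.

Lemma no_square_below_lin g P : g \in unitmx -> no_square_below P -> no_square_below (lin g P).
Proof.
move=> gu [hP P0 Pn S]; split.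
- exact: lin_homog.
- exact: pnonneg_lin.
- exact: lin_neq0 hP Pn.
move=> G C hG hGC; apply/eqP; apply: contraT => Gn.
have gu' : invmx g \in unitmx by rewrite unitmx_inv.
have /eqP := lin_neq0 gu' hG Gn; case; apply: (S _ C); first exact: lin_homog.
move=> x y z; rewrite -[pev P x y z](meval_linK P _ gu) /pev.
rewrite (meval_lin _ G) (meval_lin _ (lin g P)) !meval_pev; exact: hGC.
Qed.

Lemma homogenize_aff P d : P \is d.-homog -> homogenize d (aff P) = P.
Proof.
move=> hP; have hF := tdeg_aff hP.
apply/eqP; rewrite -subr_eq0; apply/eqP/(@form_eq0 _ _ d).
  by rewrite rpredB // homogenize_homog.
have off x y z : z != 0 -> pev (homogenize d (aff P)) x y z = pev P x y z.
  move=> z0; rewrite pev_homogenize // ev_aff -(pev_homog _ _ _ _ hP) mulr1.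
  by rewrite ![z * _]mulrC !divfK.
move=> x y z; apply/eqP; rewrite eq_le; apply/andP; split.
  rewrite -oppr_ge0 -(mevalN (triple x y z)); apply: pev_ge0_dense => {}x {}y {}z z0.
  by rewrite opprB pevB off // subrr.
by apply: pev_ge0_dense => {}x {}y {}z z0; rewrite pevB off // subrr.
Qed.

Lemma aff_top P d : P \is d.-homog -> (aff P)`_d = (pev P 1 0 0)%:P.
Proof.
move=> hP; have /tdegP/(_ d) := tdeg_aff hP; rewrite subSnn => /size1_polyC ->.
congr (_%:P); rewrite -[in RHS](homogenize_aff hP) /pev raddf_sum /=.
rewrite (bigD1 ord_max) //= [X in _ + X]big1 ?addr0 => [|i ni].
  rewrite raddf_sum (bigD1 ord0) //= [X in _ + X]big1 ?addr0 => [|j nj].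
    rewrite mevalZ !mevalM !rmorphXn /= !mevalXU /triple /= !inordK //=.
    by rewrite subnn sub0n !expr0 expr1n !mulr1.
  rewrite mevalZ !mevalM !rmorphXn /= !mevalXU /triple /= !inordK //=.
  have j0 : (0 < j)%N by rewrite lt0n; rewrite -val_eqE in nj.
  by rewrite [0 ^+ j]expr0n eqn0Ngt j0 mulr0 mul0r mulr0.
rewrite raddf_sum big1 // => j _.
rewrite /= mevalZ !mevalM !rmorphXn /= !mevalXU /triple /= !inordK //=.
have id : (i < d)%N by have := ltn_ord i; rewrite -val_eqE /= in ni; lia.
have [->|j0] := posnP j.
  by rewrite subn0 expr0 [0 ^+ (d - i)]expr0n eqn0Ngt subn_gt0 id !mulr0.
by rewrite [0 ^+ j]expr0n eqn0Ngt j0 mulr0 mul0r mulr0.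
Qed.

Lemma aff_neq0 P d : P \is d.-homog -> P != 0 -> aff P != 0.
Proof. by move=> hP; apply: contraNneq => /(aff_eq0 hP) ->. Qed.

(** Such a P is a binary quadratic form in x and 1 over R[y], to which
    [qform_dominates_square] applies. *)
Lemma quadratic_dominates_square P e : (0 < e)%N -> P \is (2 * e).-homog ->
    P != 0 -> pnonneg P -> (size (aff P) <= 3)%N ->
  exists G C, [/\ tdeg e G, G != 0 & forall x y, ev G x y ^+ 2 <= C * ev (aff P) x y].
Proof.
case: e => // e _ hP Pn P0 sP; have /tdegP hF := tdeg_aff hP.
have Fn := aff_neq0 hP Pn; have F0 := aff_nonneg P0.
set F := aff P in sP hF Fn F0 *.
pose b := 2^-1 *: F`_1.
have evF x y : ev F x y = qform F`_2 b F`_0 x 1 y.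
  rewrite /ev (horner_coef_wide _ sP) !big_ord_recl big_ord0 /qform /b !evalE /=.
  by field.
have qF0 X Z y : 0 <= qform F`_2 b F`_0 X Z y.
  have -> : qform F`_2 b F`_0 X Z y =
      ((F`_2).[y] * X ^+ 2)%:P.[Z] + (2 * b.[y] * X) * Z + (F`_0).[y] * Z ^+ 2.
    by rewrite /qform hornerC.
  have -> : (((F`_2).[y] * X ^+ 2)%:P).[Z] + 2 * b.[y] * X * Z + (F`_0).[y] * Z ^+ 2 =
     (((F`_2).[y] * X ^+ 2)%:P + (2 * b.[y] * X) *: 'X + (F`_0).[y] *: 'X ^+ 2).[Z].
    by rewrite !evalE.
  apply: (@poly_ge0_off _ _ 0) => z z0; have := F0 (X / z) y; rewrite evF /qform.
  rewrite -(pmulr_rge0 _ (x := z ^+ 2)) ?exprn_even_gt0 //.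
  by rewrite !evalE; congr (0 <= _); field.
have [|||| g [h [C [sg sh gh C0 hC]]]] :=
    @qform_dominates_square R e e.+1 (F`_2) b (F`_0) qF0.
- apply: contraT => /norP[]; rewrite !negbK => /eqP F20 /eqP F00.
  have b0 y : b.[y] = 0.
    have [_ _] := qform_disc qF0 y; rewrite F20 horner0 mul0r => hb.
    by apply/eqP; rewrite -sqrf_eq0 eq_le hb sqr_ge0.
  by case/eqP: Fn; apply: ev_eq0 => x y; rewrite evF /qform b0 F20 F00 !horner0; ring.
- by apply: leq_trans (hF 2) _; lia.
- rewrite /b; apply: leq_trans (size_scale_leq _ _) _.
  by apply: leq_trans (hF 1%N) _; lia.
- by apply: leq_trans (hF 0%N) _; lia.
have evG x y : ev (g%:P * 'X + h%:P) x y = g.[y] * x + h.[y] * 1.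
  by rewrite evD evM !evC /ev hornerX hornerC mulr1.
exists (g%:P * 'X + h%:P), C; split.
- apply: tdegD; last exact: tdegC.
  by rewrite -addn1; apply: tdegM; [exact: tdegC|exact: tdeg_x].
- apply: contraTneq gh => G0; rewrite negb_or !negbK.
  have := congr1 (fun p : {poly {poly R}} => p`_1) G0.
  have := congr1 (fun p : {poly {poly R}} => p`_0) G0.
  rewrite /= !(coefD, coefMX, coefC, coef0) /= add0r addr0 => -> ->.
  by rewrite eqxx.
- by move=> x y; rewrite evG evF; exact: hC.
Qed.

(** [row_ebase] completes the row v to a basis, up to a scalar. *)
Lemma move_to_e1 (v : 'I_3 -> R) : (exists i, v i != 0) ->
  exists2 g : 'M[R]_3, g \in unitmx & forall i, g 0 i = v i.
Proof.
move=> [i0 vi0]; pose w : 'rV[R]_3 := \row_i v i.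
have w0 : w != 0 by apply: contraNneq vi0 => /rowP/(_ i0); rewrite !mxE => ->.
have rw : \rank w = 1%N.
  by apply/eqP; rewrite eqn_leq rank_leq_row lt0n mxrank_eq0.
have wE := mulmx_ebase w; rewrite rw in wE.
pose c := col_ebase w 0 0.
have wE2 : w = c *: row 0 (row_ebase w).
  apply/rowP => i; rewrite -[in LHS]wE !mxE (bigD1 0) //= big1 ?addr0.
    by rewrite !mxE big_ord1 !mxE /= mulr1.
  move=> j j0; rewrite !mxE big_ord1 !mxE /=.
  by rewrite -val_eqE /= in j0; rewrite eq_sym (negPf j0) mulr0 mul0r.
exists (c *: row_ebase w).
  rewrite unitmxZ ?row_ebase_unit // unitfE.
  by apply: contraNneq w0 => c0; rewrite wE2 c0 scale0r.
by move=> i; have /rowP/(_ i) := wE2; rewrite !mxE.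
Qed.

End NoSquareBelow.

(** * Forms of degree at most 4 dominate a square *)
Section Continuity.
Variables (R : realType) (n : nat) (u : 'I_n -> R).
Implicit Types (f g : ('I_n -> R) -> R).

Definition within d (v : 'I_n -> R) := forall i, `|v i - u i| < d.
Definition cont f := forall e, 0 < e ->
  exists2 d, 0 < d & forall v, within d v -> `|f v - f u| < e.

Lemma cont_add f g : cont f -> cont g -> cont (fun v => f v + g v).
Proof.
move=> cf cg e e0; have e2 : 0 < e / 2 by rewrite divr_gt0.
have [d1 d10 h1] := cf _ e2; have [d2 d20 h2] := cg _ e2.
exists (Num.min d1 d2); first by rewrite lt_min d10.
move=> v hv; have /h1 : within d1 v by move=> i; have := hv i; rewrite lt_min => /andP[].
have /h2 : within d2 v by move=> i; have := hv i; rewrite lt_min => /andP[].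
by rewrite !ltr_norml => /andP[? ?] /andP[? ?]; apply/andP; split; lra.
Qed.

Lemma cont_mul f g : cont f -> cont g -> cont (fun v => f v * g v).
Proof.
move=> cf cg e e0; pose K := `|f u| + `|g u| + 1.
have K0 : 0 < K by rewrite /K; have := normr_ge0 (f u); have := normr_ge0 (g u); lra.
pose e1 := Num.min 1 (e / (2 * K)).
have e10 : 0 < e1 by rewrite lt_min ltr01 divr_gt0 // mulr_gt0.
have [d1 d10 h1] := cf _ e10; have [d2 d20 h2] := cg _ e10.
exists (Num.min d1 d2); first by rewrite lt_min d10.
move=> v hv; have /h1 : within d1 v by move=> i; have := hv i; rewrite lt_min => /andP[].
have /h2 : within d2 v by move=> i; have := hv i; rewrite lt_min => /andP[].
set a := g v - g u; set b := f v - f u => ha hb.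
have -> : f v * g v - f u * g u = b * g u + f u * a + b * a by rewrite /a /b; ring.
have e11 : e1 <= 1 by rewrite ge_min lexx.
have e1K : e1 * (2 * K) <= e by rewrite -ler_pdivlMr ?mulr_gt0 // ge_min lexx orbT.
apply: le_lt_trans (ler_normD _ _) _.
have := ler_normD (b * g u) (f u * a); rewrite !normrM.
have : `|b| * `|a| <= e1 * 1 by apply: ler_pM => //; [exact: ltW|apply: ltW; lra].
have : `|b| * `|g u| <= e1 * `|g u| by apply: ler_wpM2r => //; exact: ltW.
have : `|f u| * `|a| <= `|f u| * e1 by apply: ler_wpM2l => //; exact: ltW.
have eK : e1 * K < e by have : 0 < e1 * K by [exact: mulr_gt0]; lra.
move: eK; rewrite /K !mulrDr; lra.
Qed.

Lemma cont_const c : cont (fun=> c).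
Proof. by move=> e e0; exists 1 => // v _; rewrite subrr normr0. Qed.

Lemma cont_var i : cont (fun v => v i).
Proof. by move=> e e0; exists e => // v; apply. Qed.

Lemma cont_meval (P : {mpoly R[n]}) : cont (fun v => P.@[v]).
Proof.
have ext f g : f =1 g -> cont f -> cont g.
  by move=> fg cf e /cf[d d0 h]; exists d => // v /h; rewrite !fg.
apply: (ext (fun v => \sum_(m <- msupp P) P@_m * \prod_(i < n) v i ^+ m i)).
  by move=> v; rewrite mevalE.
elim: (msupp P) => [|m s IH].
  by apply: ext (cont_const 0) => v; rewrite big_nil.
apply: (ext (fun v => P@_m * \prod_(i < n) v i ^+ m i +
   \sum_(m <- s) P@_m * \prod_(i < n) v i ^+ m i)).
  by move=> v; rewrite big_cons.
apply: cont_add => //; apply: cont_mul; first exact: cont_const.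
elim: (index_enum 'I_n) => [|i t IHt].
  by apply: ext (cont_const 1) => v; rewrite big_nil.
apply: (ext (fun v => v i ^+ m i * \prod_(i <- t) v i ^+ m i)).
  by move=> v; rewrite big_cons.
apply: cont_mul => //; elim: (m i) => [|k IHk].
  by apply: ext (cont_const 1) => v; rewrite expr0.
apply: (ext (fun v => v i * v i ^+ k)); first by move=> v; rewrite exprS.
by apply: cont_mul => //; exact: cont_var.
Qed.

Lemma pos_dominated (P Q : {mpoly R[n]}) : 0 < P.@[u] ->
  exists d C, [/\ 0 < d, 0 <= C & forall v, within d v -> Q.@[v] <= C * P.@[v]].
Proof.
move=> Pu; have P2 : 0 < P.@[u] / 2 by rewrite divr_gt0.
have [d1 d10 h1] := cont_meval P P2; have [d2 d20 h2] := cont_meval Q ltr01.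
exists (Num.min d1 d2), ((`|Q.@[u]| + 1) / (P.@[u] / 2)); split.
- by rewrite lt_min d10.
- by apply: divr_ge0; [rewrite addr_ge0|exact: ltW].
move=> v hv; have /h1 : within d1 v by move=> i; have := hv i; rewrite lt_min => /andP[].
have /h2 : within d2 v by move=> i; have := hv i; rewrite lt_min => /andP[].
rewrite !ltr_norml => /andP[_ q2] /andP[p1 _].
have Px : P.@[u] / 2 <= P.@[v] by lra.
rewrite mulrAC ler_pdivlMr //.
apply: le_trans (_ : (`|Q.@[u]| + 1) * (P.@[u] / 2) <= _).
  by rewrite ler_wpM2r ?ltW //; have := ler_norm Q.@[u]; lra.
by rewrite ler_wpM2l // addr_ge0.
Qed.

End Continuity.

Section LowDegree.
Variable R : realType.
Implicit Types (P Q H : {mpoly R[3]}) (F G : {poly {poly R}}).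

Lemma proj_dominated P Q e : P \is (2 * e).-homog -> Q \is (2 * e).-homog ->
    pnonneg P -> (forall x y, (x != 0) || (y != 0) -> 0 < pev P x y 0) ->
    (forall x y, dominated_near x y (fun v => pev P v.1 v.2 1) (fun v => pev Q v.1 v.2 1)) ->
  exists2 C, 0 <= C & forall x y, pev Q x y 1 <= C * pev P x y 1.
Proof.
move=> hP hQ P0 Pinf loc.
have [|||||||C C0 h] := @dominated_proj R (2 * e) (pev P) (pev Q).
- by rewrite mul2n odd_double.
- by move=> l x y z; rewrite (pev_homog _ _ _ _ hP).
- by move=> l x y z; rewrite (pev_homog _ _ _ _ hQ).
- exact: P0.
- move=> y; have [|d [C [d0 C0 h]]] := @pos_dominated R 3 (triple 1 y 0) P Q.
    by apply: Pinf; rewrite oner_neq0.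
  exists d => //; exists C => // -[z t] [/= h1 h2]; apply: h => -[[|[|[|//]]] i] //=.
    by rewrite /triple /= subrr normr0.
- move=> x; have [|d [C [d0 C0 h]]] := @pos_dominated R 3 (triple x 1 0) P Q.
    by apply: Pinf; rewrite oner_neq0 orbT.
  exists d => //; exists C => // -[z t] [/= h1 h2]; apply: h => -[[|[|[|//]]] i] //=.
    by rewrite /triple /= subrr normr0.
- exact: loc.
by exists C => // x y; exact: (h (x, y)).
Qed.

Lemma dominated_near_pos P Q x y : 0 < pev P x y 1 ->
  dominated_near x y (fun v => pev P v.1 v.2 1) (fun v => pev Q v.1 v.2 1).
Proof.
move=> /pos_dominated - /(_ Q)[d [C [d0 C0 h]]].
exists d => //; exists C => // -[z t] [/= h1 h2]; apply: h => -[[|[|[|//]]] i] //=.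
by rewrite /triple /= subrr normr0.
Qed.

(** Without real zeros, P is bounded below by a multiple of z^(2e), by
    compactness. A zero is moved to (1, 0, 0); then P has degree at most 2 in x,
    because for e = 2 the coefficient of x^4 is 0 and that of x^3, an odd power,
    must then be 0 as well. *)
Lemma low_degree_dominates_square P e : (0 < e <= 2)%N -> P \is (2 * e).-homog ->
    P != 0 -> pnonneg P ->
  exists (G : {mpoly R[3]}) C, [/\ G \is e.-homog, G != 0 &
    forall x y z, pev G x y z ^+ 2 <= C * pev P x y z].
Proof.
move=> /andP[e0 e2] hP Pn P0.
have viaaff P' : P' \is (2 * e).-homog -> P' != 0 -> pnonneg P' ->
    (size (aff P') <= 3)%N -> exists (G : {mpoly R[3]}) C, [/\ G \is e.-homog, G != 0 &
    forall x y z, pev G x y z ^+ 2 <= C * pev P' x y z].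
  move=> hP' P'n P'0 sP'.
  have [G [C [tG Gn hG]]] := quadratic_dominates_square e0 hP' P'n P'0 sP'.
  exists (homogenize e G), C; split; [exact: homogenize_homog|exact: homogenize_neq0|].
  exact: homogenize_square_le.
have [[v [vn Pv]]|noz] := EM (exists v, (exists i, v i != 0) /\ P.@[v] = 0); last first.
  have Ppos x y z : [|| x != 0, y != 0 | z != 0] -> 0 < pev P x y z.
    move=> xyz; rewrite lt_def P0 andbT; apply/eqP => Pxyz; apply: noz.
    exists (triple x y z); split => //; case/or3P: xyz => h.
    - by exists ord0.
    - by exists (inord 1); rewrite /triple /= inordK.
    - by exists (inord 2); rewrite /triple /= inordK.
  have hZ : 'X_(inord 2) ^+ (2 * e) \is [in R[3], (2 * e).-homog].
    by rewrite -[X in X.-homog]mul1n; apply: dhomogMn; rewrite dhomogX /= mdeg1.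
  have [||C C0 h] := proj_dominated hP hZ P0.
  - by move=> x y xy; apply: Ppos; rewrite orbA xy.
  - by move=> x y; apply: dominated_near_pos; apply: Ppos; rewrite oner_neq0 !orbT.
  have t1 : @tdeg R e 1 by apply: (@tdegC _ _ 1); rewrite size_poly1.
  exists (homogenize e 1), C; split; first exact: homogenize_homog.
    by apply: homogenize_neq0 => //; exact: oner_neq0.
  apply: homogenize_square_le => // x y; rewrite ev1 expr1n ev_aff.
  have := h x y; rewrite pev_exp /pev mevalXU /triple /= inordK //= expr1n //.
have [g gu gv] := move_to_e1 vn.
have hg := lin_homog g hP; have gn := lin_neq0 gu hP Pn.
have g0 := pnonneg_lin g P0.
have [|G [C [hG Gn hGC]]] := viaaff _ hg gn g0.
  have tl := tdeg_aff hg.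
  have stop : (size (aff (lin g P)) <= 2 * e)%N.
    apply/leq_sizeP => j; rewrite leq_eqVlt => /predU1P[<-|jl].
      rewrite aff_top // pev_lin; set w := meval _ _.
      suff -> : w = 0 by [].
      by rewrite /w -[RHS]Pv; apply: meval_eq => i; rewrite gv; ring.
    by apply: nth_default; apply: leq_trans (tdeg_size tl) _.
  case: e {e0 viaaff} => [|[|[|//]]] in e2 hP hg tl stop *.
  - by apply: leq_trans stop _.
  - by apply: leq_trans stop _.
  apply/leq_sizeP => j; rewrite leq_eqVlt => /predU1P[<-|jl]; last first.
    by apply: nth_default; apply: leq_trans stop _.
  apply: poly_values_eq0 => y.
  have /polyP/(_ 3) := erefl (fiber y (aff (lin g P))).
  rewrite {1}coef_map /= => E; rewrite -[LHS]/(horner_eval y _) -coef_map -/(fiber y _).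
  have f0 x : 0 <= (fiber y (aff (lin g P))).[x] by rewrite fiberE aff_nonneg.
  have sf : (size (fiber y (aff (lin g P))) <= 4)%N.
    by apply: leq_trans stop; exact: size_poly.
  apply: nth_default; have [->|fn] := eqVneq (fiber y (aff (lin g P))) 0.
    by rewrite size_poly0.
  have := poly_nonneg_odd_size fn f0; move: sf.
  by case: (size _) => [|[|[|[|[|//]]]]].
exists (lin (invmx g) G), C; split; first exact: lin_homog.
  by apply: lin_neq0 hG Gn; rewrite unitmx_inv.
move=> x y z; rewrite -[pev P x y z](meval_linK P _ gu) /pev.
by rewrite (meval_lin _ G) (meval_lin _ (lin g P)) !meval_pev; exact: hGC.
Qed.

Lemma low_degree_dominates_square_aff F e : (e <= 2)%N -> tdeg (2 * e) F -> F != 0 ->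
    (forall x y, 0 <= ev F x y) ->
  exists G C, [/\ tdeg e G, G != 0 & forall x y, ev G x y ^+ 2 <= C * ev F x y].
Proof.
move=> e2 tF Fn F0; case: e => [|e] in e2 tF *.
  have sF := tdeg_size tF.
  have FE : F = ((F`_0)`_0)%:P%:P.
    have -> : F = (F`_0)%:P by apply: size1_polyC.
    rewrite coefC /=; congr (_%:P); apply: size1_polyC.
    by move/tdegP: tF => /(_ 0%N).
  move: (F`_0`_0) FE => c FE; exists 1, c^-1; split; rewrite ?oner_neq0 //.
    by apply: (@tdegC _ _ 1); rewrite size_poly1.
  move=> x y; rewrite ev1 expr1n FE evC hornerC mulVf //.
  by apply: contraNneq Fn; rewrite FE => ->.
have hH := homogenize_homog tF.
have [|||G [C [hG Gn hC]]] := low_degree_dominates_square (e := e.+1) _ hH.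
- by rewrite e2.
- exact: homogenize_neq0.
- apply: pev_ge0_dense => x y z z0; rewrite pev_homogenize // mulr_ge0 //.
  by rewrite exprn_even_ge0 // mul2n odd_double.
exists (aff G), C; split; [exact: tdeg_aff|exact: aff_neq0 hG Gn|].
by move=> x y; rewrite ev_aff -(pev_homogenize1 _ _ tF); exact: hC.
Qed.

End LowDegree.

(** * Irreducibility and second-order terms *)
Section Irreducible.
Variable R : realType.
Implicit Types (P Q H : {mpoly R[3]}) (F G D B : {poly {poly R}}).

(** Where the resultant does not vanish the fibers have no common root, so the
    univariate case applies; the other values of y are limits of these. *)
Lemma coprime_monic_nonneg D B : D \is monic -> (1 < size D)%N -> (1 < size B)%N ->
    (forall x y, 0 <= ev (D * B) x y) -> resultant D B != 0 ->
  forall x y, 0 <= ev D x y.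
Proof.
move=> Dm sD sB DB0 res0 x y; rewrite /ev.
apply: (poly_ge0_dense res0) => {}y resy; rewrite -/(ev D x y) -fiberE.
apply: (@coprime_factor_nonneg _ _ (fiber y B)); first exact: fiber_monic.
  by move=> z; rewrite -fiberM fiberE.
move=> z; apply/negP; rewrite !rootE !fiberE => /andP[/eqP Dz /eqP Bz].
have [[u v] /= _ E] := resultant_in_ideal sD sB.
have := congr1 (fun F => ev F z y) E.
rewrite /= evC evD !evM Dz Bz !mulr0 addr0 => r0.
by rewrite r0 eqxx in resy.
Qed.

Lemma monic_nonneg_even D a : D \is monic -> size D = a.+1 ->
  (forall x y, 0 <= ev D x y) -> ~~ odd a.
Proof.
move=> Dm sD D0.
have f0 x : 0 <= (fiber 0 D).[x] by rewrite fiberE.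
have := poly_nonneg_odd_size (monic_neq0 (fiber_monic 0 Dm)) f0.
by rewrite size_map_poly_id0 ?sD // (monicP Dm) rmorph1 oner_neq0.
Qed.

Lemma aff_monic P : P \is 6.-homog -> pev P 1 0 0 = 1 ->
  aff P \is monic /\ size (aff P) = 7.
Proof.
move=> hP P1; have c6 := aff_top hP; rewrite P1 in c6.
have s7 : size (aff P) = 7.
  apply/eqP; rewrite eqn_leq (tdeg_size (tdeg_aff hP)) ltnNge.
  apply/negP => /(nth_default 0); rewrite c6 => /eqP.
  by rewrite polyC_eq0 oner_eq0.
by rewrite monicE lead_coefE s7 c6.
Qed.

Lemma monic_size F : F \is monic -> exists n, size F = n.+1.
Proof.
by move=> /monic_neq0; rewrite -size_poly_gt0; case: (size F) => // n _; exists n.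
Qed.

Lemma size_monicM_succ F G m n : F \is monic -> size F = m.+1 -> size G = n.+1 ->
  size (F * G) = (m + n).+1.
Proof.
move=> Fm sF sG; rewrite size_monicM // ?sF ?sG ?addSn ?addnS //.
by rewrite -size_poly_gt0 sG.
Qed.

(** If P = g^2 r with g not constant, then r is nonnegative of degree at most 4,
    so it dominates a square G^2, and P dominates (g G)^2. *)
Lemma no_square_below_squarefree P g r : no_square_below P -> pev P 1 0 0 = 1 -> g \is monic ->
  r \is monic -> aff P = g ^+ 2 * r -> (size g <= 1)%N.
Proof.
move=> gP P1 gm rm pE; have [hP P0 _ _] := gP.
have [_ s7] := aff_monic hP P1; have tP := tdeg_aff hP; have p0 := aff_nonneg P0.
have [c sgc] := monic_size gm; have [d srd] := monic_size rm.
have g2m : g ^+ 2 \is monic by exact: monic_exp.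
have sg2 : size (g ^+ 2) = (c + c).+1 by rewrite expr2 (size_monicM_succ gm sgc sgc).
have ccd : (c + c + d = 6)%N.
  by apply/eqP; rewrite -eqSS -(size_monicM_succ g2m sg2 srd) -pE s7.
have tr : tdeg d r by apply: (tdeg_cancel g2m sg2); rewrite -pE ccd.
have tg : tdeg c g.
  have gr_m : g * r \is monic by rewrite monicMl.
  apply: (tdeg_cancel gr_m (size_monicM_succ gm sgc srd)).
  by rewrite addnAC ccd mulrAC -expr2 -pE.
have r0 x y : 0 <= ev r x y.
  rewrite -fiberE; apply: (@poly_ge0_dense _ _ (fiber y g)).
    by rewrite monic_neq0 // fiber_monic.
  move=> z; rewrite !fiberE => gz; have := p0 z y; rewrite pE evM evX.
  by rewrite pmulr_rge0 // exprn_even_gt0.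
rewrite sgc; case: c => [//|c] in ccd sgc tg sg2 *.
have [e [dE ce e2]] : exists e, [/\ d = (2 * e)%N, (c.+1 + e = 3)%N & (e <= 2)%N].
  exists (2 - c)%N; move: ccd; clear.
  by move=> h; split; lia.
rewrite dE in tr.
have [G [C [tG Gn hG]]] := low_degree_dominates_square_aff e2 tr (monic_neq0 rm) r0.
have /eqP : g * G = 0.
  apply: (no_square_below_aff_eq0 (C := C) gP); first by rewrite -ce; exact: tdegM.
  move=> x y; rewrite pE !(evX, evM) exprMn [X in _ <= X]mulrCA.
  by apply: ler_wpM2l; [exact: sqr_ge0|exact: hG].
by rewrite mulf_eq0 (negPf (monic_neq0 gm)) (negPf Gn).
Qed.

(** Coprime factors are both nonnegative, hence of degrees 2 and 4; each
    dominates a square, and P dominates the product. *)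
Lemma no_square_below_coprime_factors P D B : no_square_below P -> pev P 1 0 0 = 1 ->
    D \is monic -> B \is monic -> aff P = D * B -> resultant D B != 0 ->
  (size D <= 1)%N \/ (size B <= 1)%N.
Proof.
move=> gP P1 Dm Bm pE res0; have [hP P0 _ _] := gP.
have [sD|sD] := leqP (size D) 1; first by left.
have [sB|sB] := leqP (size B) 1; first by right.
exfalso.
have [_ s7] := aff_monic hP P1; have tP := tdeg_aff hP; have p0 := aff_nonneg P0.
have D0 : forall x y, 0 <= ev D x y.
  by apply: (@coprime_monic_nonneg D B) => // x y; rewrite -pE.
have B0 x y : 0 <= ev B x y.
  rewrite -fiberE; apply: (@poly_ge0_dense _ _ (fiber y D)).
    by rewrite monic_neq0 // fiber_monic.
  move=> z; rewrite !fiberE => Dz; have := p0 z y; rewrite pE evM.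
  by rewrite pmulr_rge0 // lt_def Dz D0.
have [a sDa] := monic_size Dm; have [b sBb] := monic_size Bm.
have ab : (a + b = 6)%N.
  by apply/eqP; rewrite -eqSS -(size_monicM_succ Dm sDa sBb) -pE s7.
have tB : tdeg b B by apply: (tdeg_cancel Dm sDa); rewrite ab -pE.
have tD : tdeg a D by apply: (tdeg_cancel Bm sBb); rewrite addnC ab mulrC -pE.
have ae := monic_nonneg_even Dm sDa D0.
have be := monic_nonneg_even Bm sBb B0.
have aE : a = (2 * a./2)%N by rewrite mul2n -[LHS]odd_double_half (negPf ae).
have bE : b = (2 * b./2)%N by rewrite mul2n -[LHS]odd_double_half (negPf be).
rewrite sDa ltnS in sD; rewrite sBb ltnS in sB.
rewrite aE in tD; rewrite bE in tB.
have [ab3 a2 b2] : [/\ (a./2 + b./2 = 3)%N, (a./2 <= 2)%N & (b./2 <= 2)%N].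
  move: aE bE ab sD sB; move: a./2 b./2 => i j; clear => -> -> h ia jb.
  by split; lia.
have [G1 [C1 [t1 n1 h1]]] := low_degree_dominates_square_aff a2 tD (monic_neq0 Dm) D0.
have [G2 [C2 [t2 n2 h2]]] := low_degree_dominates_square_aff b2 tB (monic_neq0 Bm) B0.
have /eqP : G1 * G2 = 0.
  apply: (no_square_below_aff_eq0 (C := C1 * C2) gP); first by rewrite -ab3; exact: tdegM.
  move=> x y; rewrite pE !evM exprMn [X in _ <= X]mulrACA.
  by apply: ler_pM => //; exact: sqr_ge0.
by rewrite mulf_eq0 (negPf n1) (negPf n2).
Qed.

Lemma no_square_below_irreducible P D B : no_square_below P -> pev P 1 0 0 = 1 ->
    D \is monic -> B \is monic -> aff P = D * B ->
  (size D <= 1)%N \/ (size B <= 1)%N.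
Proof.
move=> gP P1 Dm Bm pE.
have [/eqP res0|] := boolP (resultant D B == 0); last by move=> res0; exact: (no_square_below_coprime_factors gP P1 Dm Bm pE res0).
have [g [q [w [gm sg DE BE]]]] := monic_common_factor Dm res0.
have qm : q \is monic by move: Dm; rewrite DE monicMl.
have wm : w \is monic by move: Bm; rewrite BE monicMl.
have rm : q * w \is monic by rewrite monicMl.
have pE2 : aff P = g ^+ 2 * (q * w) by rewrite pE DE BE mulrACA expr2.
by have := no_square_below_squarefree gP P1 gm rm pE2; rewrite leqNgt sg.
Qed.

Lemma no_square_below_resultant P (H : {poly {poly R}}) : no_square_below P -> pev P 1 0 0 = 1 ->
  resultant (aff P) H = 0 -> exists w, H = aff P * w.
Proof.
move=> gP P1 res0; have [hP _ _ _] := gP; have [pm _] := aff_monic hP P1.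
have [g [q [w [gm sg pE HE]]]] := monic_common_factor pm res0.
have qm : q \is monic by move: pm; rewrite pE monicMl.
have [|sq] := no_square_below_irreducible gP P1 gm qm pE; first by rewrite leqNgt sg.
have q1 : q = 1.
  have qE := size1_polyC sq.
  have /eqP c1 : q`_0 == 1 by move: qm; rewrite {1}qE monicE lead_coefC.
  by rewrite qE c1.
by exists w; rewrite pE q1 mulr1.
Qed.

Definition mx3 (r0 r1 r2 : 'I_3 -> R) : 'M[R]_3 := \matrix_(i, j) triple r0 r1 r2 i j.

Lemma mx3_unit (r0 r1 r2 s0 s1 s2 : 'I_3 -> R) :
  mx3 r0 r1 r2 *m mx3 s0 s1 s2 = 1%:M -> mx3 r0 r1 r2 \in unitmx.
Proof. by case/mulmx1_unit. Qed.

Lemma pev_mx3 r0 r1 r2 P x y z : pev (lin (mx3 r0 r1 r2) P) x y z =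
  P.@[fun i => x * r0 i + y * r1 i + z * r2 i].
Proof.
by rewrite pev_lin; apply: meval_eq => i; rewrite !mxE /triple /= !inordK.
Qed.

Lemma unitriangular_unit a b c :
  mx3 (triple 1 a b) (triple 0 1 c) (triple 0 0 1) \in unitmx.
Proof.
apply: (@mx3_unit _ _ _ (triple 1 (- a) (a * c - b)) (triple 0 1 (- c)) (triple 0 0 1)).
apply/matrixP => i j; rewrite !mxE !big_ord_recl big_ord0 !mxE.
by case: i j => [[|[|[|//]]] hi] [[|[|[|//]]] hj] /=; rewrite /triple /=; ring.
Qed.

Lemma blowup_unit x0 y0 :
  mx3 (triple x0 y0 1) (triple 0 1 0) (triple 1 0 0) \in unitmx.
Proof.
apply: (@mx3_unit _ _ _ (triple 0 0 1) (triple 0 1 0) (triple 1 (- y0) (- x0))).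
apply/matrixP => i j; rewrite !mxE !big_ord_recl big_ord0 !mxE.
by case: i j => [[|[|[|//]]] hi] [[|[|[|//]]] hj] /=; rewrite /triple /=; ring.
Qed.

(** P on the lines through (x0, y0): the outer variable is the parameter on the
    line, the inner one is the slope. *)
Definition pencil P x0 y0 : {poly {poly R}} :=
  mmap (polyC \o polyC) (triple (x0%:P%:P + 'X) (y0%:P%:P + 'X%:P * 'X) 1) P.

Lemma ev_pencil P x0 y0 e s : ev (pencil P x0 y0) e s = pev P (x0 + e) (y0 + s * e) 1.
Proof.
rewrite /pencil /mmap ev_sum /pev mevalE; apply: eq_bigr => m _.
rewrite evM /= evC hornerC; congr (_ * _).
rewrite /mmap1 /ev !horner_prod; apply: eq_bigr => i _.
rewrite !horner_exp /triple; congr (_ ^+ _).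
by case: (val i) => [|[|_]]; rewrite !evalE.
Qed.

(** Otherwise all lines through the zero meet P there to order 4. When the zero
    is moved to (1, 0, 0), P therefore grows at most like x^2 for fixed y, so it
    has degree at most 2 in x and dominates a square. *)
Lemma no_square_below_pencil P x0 y0 : no_square_below P -> pev P x0 y0 1 = 0 -> (pencil P x0 y0)`_2 != 0.
Proof.
move=> gP P00; apply/eqP => F2; have [hP P0 _ _] := gP.
(* the zero (x0, y0, 1) becomes (1, 0, 0), and inverting the parameter on the lines
   of the pencil gives the coordinate x *)
pose g := mx3 (triple x0 y0 1) (triple 0 1 0) (triple 1 0 0).
have gu : g \in unitmx by exact: blowup_unit.
have gP' := no_square_below_lin gu gP; have [hP' P'0 P'n _] := gP'.
have evP' x s : x != 0 -> ev (aff (lin g P)) x s = x ^+ 6 * ev (pencil P x0 y0) x^-1 s.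
  move=> xn; rewrite ev_aff pev_mx3 ev_pencil -(pev_homog _ _ _ _ hP).
  apply: meval_eq => i; rewrite /triple; case: (val i) => [|[|_]] /=; field => //.
have [|G [C [tG Gn hG]]] :=
    @quadratic_dominates_square R (lin g P) 3 isT hP' P'n P'0.
  apply/leq_sizeP => j j3; apply: poly_values_eq0 => s.
  rewrite -[LHS]/(horner_eval s _) -coef_map -/(fiber s _); apply: nth_default.
  apply: leq_trans j3; set f := fiber s _.
  pose L := fiber s (pencil P x0 y0).
  have L0 e : 0 <= L.[e] by rewrite fiberE ev_pencil; exact: P0.
  have rL : root L 0 by rewrite rootE fiberE ev_pencil mulr0 !addr0 P00.
  have [u [LE u0]] := poly_nonneg_root L0 rL; rewrite subr0 in LE.
  have ru : root u 0.
    rewrite rootE horner_coef0; have : L`_2 = 0.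
      by rewrite coef_map /= F2 /horner_eval horner0.
    by rewrite LE coefXnM /= => ->.
  have [w [uE _]] := poly_nonneg_root u0 ru; rewrite subr0 in uE.
  have [K hK] := poly_disk_bound w 1; have [K' hK'] := poly_disk_bound f 1.
  have f0 x : 0 <= f.[x] by rewrite fiberE aff_nonneg.
  pose M := `|K| + `|K'|.
  have fM x : f.[x] <= M * (x ^+ 2 + 1).
    have M0 : 0 <= M by rewrite addr_ge0.
    have [x1|x1] := leP `|x| 1.
      have := hK' x x1; rewrite ger0_norm // => fK.
      have K'M : K' <= M by rewrite /M; have := ler_norm K'; have := normr_ge0 K; lra.
      by have := mulr_ge0 M0 (sqr_ge0 x); rewrite mulrDr mulr1; lra.
    have xn : x != 0 by apply: contraTneq x1 => ->; rewrite normr0 -leNgt ler01.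
    rewrite fiberE evP' // -fiberE -/L LE uE !evalE.
    have -> : x ^+ 6 * (x^-1 ^+ 2 * (x^-1 ^+ 2 * w.[x^-1])) = x ^+ 2 * w.[x^-1].
      by field.
    have : w.[x^-1] <= M.
      apply: le_trans (ler_norm _) (le_trans (hK _ _) _).
        by rewrite normfV invf_le1 ?(lt_trans ltr01) // ltW.
      by rewrite /M; have := ler_norm K; have := normr_ge0 K'; lra.
    have := sqr_ge0 x => x2 /(ler_wpM2l x2); lra.
  have sM : (size (M *: ('X ^+ 2 + 1)) <= 3)%N.
    apply: leq_trans (size_scale_leq _ _) _.
    by rewrite size_polyDl size_polyXn // size_poly1.
  have sf : (2 * size f <= size f + size (M *: ('X ^+ 2 + 1)))%N.
    by apply: size_sqr_le => x; rewrite !evalE expr2 ler_wpM2l.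
  have := leq_trans sf (leq_add (leqnn (size f)) sM).
  by move: (size f) => k; clear; lia.
by case/eqP: Gn; apply: (no_square_below_aff_eq0 gP' tG hG).
Qed.

End Irreducible.

(** * Contact with a branch at a zero *)
Section Contact.
Variable R : realType.
Implicit Types (p q r G H : {poly {poly R}}) (phi psi : {poly R}).

Definition shift phi p := p \Po ('X + phi%:P).

Lemma horner_ev p (f : {poly R}) y : (p.[f]).[y] = ev p f.[y] y.
Proof. by rewrite -fiberE /fiber -[f.[y]]/(horner_eval y f) horner_map. Qed.

Lemma ev_shift phi p s y : ev (shift phi p) s y = ev p (s + phi.[y]) y.
Proof. by rewrite {1}/ev /shift horner_comp hornerD hornerX hornerC horner_ev hornerD hornerC. Qed.

Lemma shift_shift phi psi p : shift psi (shift phi p) = shift (phi + psi) p.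
Proof.
rewrite /shift -comp_polyA; congr (_ \Po _).
by rewrite comp_polyD comp_polyX comp_polyC polyCD -addrA [_ + phi%:P]addrC addrA.
Qed.

Lemma split3 q : exists r, q = (q`_0)%:P + (q`_1)%:P * 'X + (q`_2)%:P * 'X ^+ 2 + r * 'X ^+ 3.
Proof.
exists (\poly_(i < size q) q`_(i + 3)); apply/polyP => i.
rewrite !(coefD, coefMXn, coefMX, coefC).
case: i => [|[|[|i]]] /=; rewrite ?coefC ?coef_poly ?addr0 ?add0r //=.
rewrite !subSS subn0 addn3; case: ltnP => // si; apply: nth_default.
by rewrite (leq_trans si) // -addn3 leq_addr.
Qed.

(** The terms of higher order in psi are left unspecified: psi will be a
    multiple of a power of y - y0. *)
Lemma shift_coefs psi q r :
    q = (q`_0)%:P + (q`_1)%:P * 'X + (q`_2)%:P * 'X ^+ 2 + r * 'X ^+ 3 ->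
  exists u v w,
  [/\ (shift psi q)`_0 = q`_0 + q`_1 * psi + q`_2 * psi ^+ 2 + psi ^+ 3 * u,
      (shift psi q)`_1 = q`_1 + 2%:R * q`_2 * psi + psi ^+ 2 * v &
      (shift psi q)`_2 = q`_2 + psi * w].
Proof.
set a := q`_0; set b := q`_1; set c := q`_2 => qE.
pose r' := shift psi r.
have -> : shift psi q =
   (a + b * psi + c * psi ^+ 2)%:P + (b + 2%:R * c * psi)%:P * 'X + c%:P * 'X ^+ 2 +
   ((psi ^+ 3)%:P * r' + (3%:R * psi ^+ 2)%:P * (r' * 'X)
   + (3%:R * psi)%:P * (r' * 'X ^+ 2) + r' * 'X ^+ 3).
  rewrite qE /shift !(comp_polyD, comp_polyM, comp_polyC) -/(shift psi r) -/r'.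
  rewrite !rmorphXn /= !comp_polyX !polyCD !polyCM ?polyC_exp ?polyC_natr; ring.
exists r'`_0, (3%:R * r'`_0 + psi * r'`_1), (3%:R * r'`_0 + 3%:R * psi * r'`_1 + psi ^+ 2 * r'`_2).
split; rewrite !(coefD, coefMXn, coefMX, coefCM, coefC) /= ?coefC /=; ring.
Qed.

(** The two complex branches of p at the zero agree with x = phi(y) to order m:
    in the coordinate s = x - phi(y) the Newton polygon of p lies above the
    segment from s^2 to (y - y0)^(2m). *)
Definition contact p x0 y0 phi m :=
  [/\ phi.[y0] = x0, ('X - y0%:P) ^+ (2 * m) %| (shift phi p)`_0,
      ('X - y0%:P) ^+ m %| (shift phi p)`_1 & 0 < ((shift phi p)`_2).[y0]].

(** The part of p on that segment of the Newton polygon is a positive definite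
    form in s and (y - y0)^m, without cross term. *)
Definition definite p x0 y0 phi m :=
  [/\ phi.[y0] = x0,
      exists2 b0, (shift phi p)`_0 = b0 * ('X - y0%:P) ^+ (2 * m) & 0 < b0.[y0],
      ('X - y0%:P) ^+ m.+1 %| (shift phi p)`_1 & 0 < ((shift phi p)`_2).[y0]].

Lemma definite_contact p x0 y0 phi m : definite p x0 y0 phi m -> contact p x0 y0 phi m.
Proof.
case=> h0 [b0 E _] h1 h2; split=> //; first by rewrite E dvdp_mull.
by apply: dvdp_trans h1; rewrite dvdp_exp2l.
Qed.

Lemma shift_coef0_ge0 p phi : (forall x y, 0 <= ev p x y) ->
  forall y, 0 <= ((shift phi p)`_0).[y].
Proof.
move=> p0 y; have := p0 (0 + phi.[y]) y; rewrite -ev_shift /ev polyC0.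
by rewrite horner_coef0.
Qed.

(** Completing the square moves phi by a multiple of (y - y0)^m and removes the
    cross term to leading order. The new constant term is nonnegative, so its
    order is even: it is either exactly 2 m, or at least 2 m + 2. *)
Lemma contact_step p x0 y0 phi m : (0 < m)%N -> (forall x y, 0 <= ev p x y) ->
  contact p x0 y0 phi m ->
  exists phi', contact p x0 y0 phi' m.+1 \/ definite p x0 y0 phi' m.
Proof.
move=> m0 p0 [h0 /dvdpP[b0 e0] /dvdpP[b1 e1] h2].
set q : {poly {poly R}} := shift phi p in e0 e1 h2 *.
set pi : {poly R} := 'X - y0%:P in e0 e1 *.
(* the minimum of b0 + b1 c + q_2 c^2 at y0, where q_2 > 0 *)
pose c := - b1.[y0] / (2 * (q`_2).[y0]).
have [psi psiE] : exists psi, psi = c *: pi ^+ m by exists (c *: pi ^+ m).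
have pi0 : pi.[y0] = 0 by rewrite /pi hornerXsubC subrr.
have pim0 : (pi ^+ m).[y0] = 0 by rewrite horner_exp pi0 expr0n gtn_eqF.
have psi0 : psi.[y0] = 0 by rewrite psiE hornerZ pim0 mulr0.
have [r /shift_coefs - /(_ psi)[u [v [w [E0 E1 E2]]]]] := split3 q.
have s2 : ((shift psi q)`_2).[y0] = (q`_2).[y0] by rewrite E2 !evalE psi0 mul0r addr0.
pose b0' := b0 + b1 * c%:P + q`_2 * (c ^+ 2)%:P + (c ^+ 3)%:P * pi ^+ m * u.
have F0 : (shift psi q)`_0 = b0' * pi ^+ (2 * m).
  by rewrite E0 e0 e1 psiE /b0' -!mul_polyC mulnC exprM !polyC_exp; ring.
pose b1' := b1 + 2%:R * q`_2 * c%:P + (c ^+ 2)%:P * pi ^+ m * v.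
have F1 : (shift psi q)`_1 = b1' * pi ^+ m.
  by rewrite E1 e1 psiE /b1' -!mul_polyC !polyC_exp; ring.
have b1'0 : root b1' y0.
  rewrite rootE /b1' -polyC_natr !evalE subrr expr0n gtn_eqF // mulr0 mul0r addr0 /c.
  by apply/eqP; field; rewrite gt_eqF.
have H1 : pi ^+ m.+1 %| (shift psi q)`_1.
  by rewrite F1 exprS dvdp_mul2r ?expf_neq0 ?polyXsubC_eq0 // dvdp_XsubCl.
have H2 : 0 < ((shift psi q)`_2).[y0] by rewrite s2.
have H0 : (phi + psi).[y0] = x0 by rewrite hornerD psi0 addr0.
have b0'_ge0 y : 0 <= b0'.[y].
  apply: (@poly_ge0_off _ _ y0) => z zy0.
  have := shift_coef0_ge0 (phi + psi) p0 z; rewrite -shift_shift -/q F0 hornerM.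
  rewrite pmulr_lge0 // horner_exp hornerXsubC exprn_even_gt0 ?mul2n ?odd_double //.
  by rewrite subr_eq0 zy0 orbT.
exists (phi + psi); rewrite /contact /definite -shift_shift -/q.
have [r0|nr0] := boolP (root b0' y0); [left|right]; split=> //.
  have [b2 [b2E _]] := poly_nonneg_root b0'_ge0 r0.
  by apply/dvdpP; exists b2; rewrite F0 b2E -/pi mulnS exprD; ring.
by exists b0' => //; rewrite lt_def b0'_ge0 andbT.
Qed.

(** A nonnegative polynomial vanishes doubly on each line through a zero. *)
Lemma contact_start p x0 y0 : (forall x y, 0 <= ev p x y) -> ev p x0 y0 = 0 ->
  ((shift x0%:P p)`_2).[y0] != 0 -> contact p x0 y0 x0%:P 1.
Proof.
move=> p0 pz h2; set q := shift _ p in h2 *.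
have q0 s y : 0 <= ev q s y by rewrite ev_shift.
have qz : ev q 0 y0 = 0 by rewrite ev_shift hornerC add0r.
have f0 s : 0 <= (fiber y0 q).[s] by rewrite fiberE.
have fr : root (fiber y0 q) 0 by rewrite rootE fiberE qz.
have [u [uE u0]] := poly_nonneg_root f0 fr; rewrite subr0 in uE.
have fc i : (fiber y0 q)`_i = (q`_i).[y0] by rewrite coef_map.
split; first by rewrite hornerC.
- have c0 := shift_coef0_ge0 x0%:P p0.
  have [|w [-> _]] := poly_nonneg_root c0 (r := y0); last by rewrite dvdp_mulr ?dvdpp.
  by rewrite rootE -/q -fc -horner_coef0 fiberE qz.
- by rewrite expr1 dvdp_XsubCl rootE -fc uE coefXnM.
- rewrite lt_def h2 /= -fc uE coefXnM /= -horner_coef0; exact: u0.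
Qed.

Lemma contact_dichotomy p x0 y0 N : (0 < N)%N -> (forall x y, 0 <= ev p x y) ->
    ev p x0 y0 = 0 -> ((shift x0%:P p)`_2).[y0] != 0 ->
  exists phi m, [/\ contact p x0 y0 phi m, (0 < m <= N)%N &
    (m < N)%N -> definite p x0 y0 phi m].
Proof.
move=> N0 p0 pz h2; elim: N N0 => // -[_ _|N IH _].
  by exists x0%:P, 1%N; split=> //; exact: contact_start.
have [//|phi [m [hc /andP[m0 mN] hd]]] := IH.
move: mN; rewrite leq_eqVlt => /predU1P[mE|mN]; last first.
  by exists phi, m; split=> // [|_]; [by rewrite m0 (leqW (ltnW mN))|exact: hd].
subst m; have [phi' [h|h]] := contact_step m0 p0 hc.
  by exists phi', N.+2; split=> //; rewrite ?ltnn ?leqnn.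
by exists phi', N.+1; split=> //; [exact: definite_contact|rewrite m0 leqnSn].
Qed.

End Contact.

(** * Estimates along a branch *)
Section LocalAnalysis.
Variable R : realType.
Implicit Types (p q r G H : {poly {poly R}}) (phi psi f : {poly R}).

Lemma poly_near_bound f y0 : exists2 K, 0 < K & forall y : R, `|y - y0| <= 1 -> `|f.[y]| <= K.
Proof.
have [K hK] := poly_disk_bound f (`|y0| + 1); exists (`|K| + 1).
  by rewrite ltr_wpDl.
move=> y hy; apply: le_trans (_ : `|K| <= _); last by rewrite lerDl.
apply: le_trans (hK y _) (ler_norm _).
by rewrite -[y](subrK y0) addrC; apply: le_trans (ler_normD _ _) _; rewrite lerD2l.
Qed.

Lemma ev_near_bound q y0 : exists2 K, 0 < K &
  forall s y : R, `|s| <= 1 -> `|y - y0| <= 1 -> `|ev q s y| <= K.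
Proof.
suff [K K0 hK] : exists2 K, 0 < K & forall s y : R, `|s| <= 1 -> `|y - y0| <= 1 ->
    `|\sum_(i < size q) (q`_i).[y] * s ^+ i| <= K.
  by exists K => // s y s1 y1; rewrite ev_coef; exact: hK.
elim: (size q) => [|n [K K0 hK]].
  by exists 1 => // s y _ _; rewrite big_ord0 normr0.
have [L L0 hL] := poly_near_bound q`_n y0; exists (K + L); first by rewrite addr_gt0.
move=> s y s1 y1; rewrite big_ord_recr /=; apply: le_trans (ler_normD _ _) _.
apply: lerD; first exact: hK.
rewrite normrM normrX -[L]mulr1; apply: ler_pM => //.
- by rewrite exprn_ge0.
- exact: hL.
- by rewrite exprn_ile1.
Qed.

Lemma poly_near_half f y0 : 0 < f.[y0] ->
  exists2 d, 0 < d & forall y : R, `|y - y0| < d -> f.[y0] / 2 <= f.[y].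
Proof.
move=> f0; have f2 : 0 < f.[y0] / 2 by rewrite divr_gt0.
have [d d0 hd] := poly_cont y0 f f2; exists d => // y /hd.
by rewrite ltr_norml => /andP[h _]; lra.
Qed.

Lemma ev_split3 q r s y :
    q = (q`_0)%:P + (q`_1)%:P * 'X + (q`_2)%:P * 'X ^+ 2 + r * 'X ^+ 3 ->
  ev q s y = (q`_0).[y] + (q`_1).[y] * s + (q`_2).[y] * s ^+ 2 + ev r s y * s ^+ 3.
Proof.
have evx : ev 'X s y = s by rewrite /ev hornerX hornerC.
by move=> {1}->; rewrite !(evD, evX, evM, evC) evx.
Qed.

(** Near the zero the cross term and the terms of degree at least 3 in s are
    absorbed by the two squares. *)
Lemma definite_lower_bound p x0 y0 phi n : (0 < n)%N -> definite p x0 y0 phi n ->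
  exists d c, [/\ 0 < d, 0 < c & forall s y : R, `|s| < d -> `|y - y0| < d ->
    c * (`|y - y0| ^+ n ^+ 2 + s ^+ 2) <= ev (shift phi p) s y].
Proof.
move=> n0 [_ [b0 e0 b0_gt0] /dvdpP[b1 e1] h2]; set q := shift phi p in e0 e1 h2 *.
have [r qE] := split3 q.
have [K K0 hK] := ev_near_bound r y0; have [L L0 hL] := poly_near_bound b1 y0.
have [d1 d10 hd1] := poly_near_half b0_gt0.
have [d2 d20 hd2] := poly_near_half h2.
(* alpha is a quarter of q_2(y0): one half of q_2(y0) is a lower bound near y0, and
   a quarter of it absorbs the terms of degree at least 3 *)
pose beta := b0.[y0] / 2; pose alpha := (q`_2).[y0] / 4.
have beta0 : 0 < beta by rewrite divr_gt0.
have alpha0 : 0 < alpha by rewrite divr_gt0.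
pose c := Num.min beta alpha / 2.
have min0 : 0 < Num.min beta alpha by rewrite lt_min beta0.
have c0 : 0 < c by rewrite divr_gt0.
have c2 : 2 * c = Num.min beta alpha by rewrite /c; field.
have cb : 2 * c <= beta by rewrite c2 ge_min lexx.
have ca : 2 * c <= alpha by rewrite c2 ge_min lexx orbT.
have aK : 0 < alpha / K by rewrite divr_gt0.
have cL : 0 < c / L by rewrite divr_gt0.
pose d := Num.min (Num.min d1 d2) (Num.min 1 (Num.min (alpha / K) (c / L))).
exists d, c; split=> //.
  by rewrite !lt_min d10 d20 ltr01 aK cL.
move=> s y; rewrite !lt_min => /andP[_ /and3P[s1 sK _]].
move=> /andP[/andP[/hd1 hb /hd2 hq] /and3P[y1 _ yL]].
rewrite (ev_split3 s y qE) e0 e1 !hornerM !horner_exp !hornerXsubC.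
set t := y - y0 in y1 yL *; set T := `|t| ^+ n.
have T0 : 0 <= T by rewrite exprn_ge0.
have tT : t ^+ (2 * n) = T ^+ 2.
  by rewrite /T -exprM [(n * 2)%N]mulnC !exprM real_normK ?num_real.
have hr : `|ev r s y| <= K by apply: hK; apply: ltW.
have hb1 : `|b1.[y]| <= L by apply: hL; apply: ltW.
have A1 : beta * T ^+ 2 <= b0.[y] * t ^+ (2 * n).
  by rewrite tT ler_wpM2r ?sqr_ge0.
have sK' : `|s| * K <= alpha by rewrite -ler_pdivlMr // ltW.
have tL' : `|t| * L <= c by rewrite -ler_pdivlMr // ltW.
have lerN_norm (a b : R) : `|b| <= a -> - a <= b by rewrite ler_norml => /andP[].
have A2 : - (c * (T * `|s|)) <= b1.[y] * t ^+ n.+1 * s.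
  apply: lerN_norm; rewrite !normrM normrX -/T exprS.
  have -> : `|b1.[y]| * (`|t| * `|t| ^+ n) * `|s| = (`|b1.[y]| * `|t|) * (T * `|s|).
    by rewrite /T; ring.
  apply: ler_wpM2r; first exact: mulr_ge0.
  by apply: le_trans tL'; rewrite mulrC; apply: ler_wpM2l.
have A3 : - (alpha * s ^+ 2) <= ev r s y * s ^+ 3.
  apply: lerN_norm; rewrite normrM normrX.
  have -> : `|ev r s y| * `|s| ^+ 3 = (`|s| * `|ev r s y|) * s ^+ 2.
    by rewrite -[s ^+ 2]real_normK ?num_real //; ring.
  apply: ler_wpM2r; first exact: sqr_ge0.
  by apply: le_trans sK'; apply: ler_wpM2l.
have A4 : 2 * alpha * s ^+ 2 <= (q`_2).[y] * s ^+ 2.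
  by apply: ler_wpM2r; [exact: sqr_ge0|move: hq; rewrite /alpha; lra].
have A5 : 2 * (T * `|s|) <= T ^+ 2 + s ^+ 2.
  by rewrite -[s ^+ 2]real_normK ?num_real //; have := sqr_ge0 (T - `|s|); rewrite sqrrB; lra.
have A6 := ler_wpM2l (ltW c0) A5.
have A7 : 2 * c * T ^+ 2 <= beta * T ^+ 2 by apply: ler_wpM2r => //; exact: sqr_ge0.
have A8 : 2 * c * s ^+ 2 <= alpha * s ^+ 2 by apply: ler_wpM2r => //; exact: sqr_ge0.
have := sqr_ge0 s; have := sqr_ge0 T => ? ?.
have := mulr_ge0 (ltW c0) (sqr_ge0 s); have := mulr_ge0 (ltW c0) (sqr_ge0 T).
lra.
Qed.

(** Near the zero G is O(|y - y0|^n + |x - phi(y)|), and p is at least a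
    multiple of the sum of the squares. *)
Lemma definite_dominated p G x0 y0 phi n : (0 < n)%N -> definite p x0 y0 phi n ->
    ('X - y0%:P) ^+ n %| (shift phi G)`_0 ->
  dominated_near x0 y0 (fun v => ev p v.1 v.2) (fun v => ev G v.1 v.2 ^+ 2).
Proof.
move=> n0 hdef /dvdpP[g0 gE]; have [phi0 _ _ _] := hdef.
have [d [c [d0 c0 hc]]] := definite_lower_bound n0 hdef.
set q := shift phi G in gE.
have [r rE] : exists r, q = g0%:P * (('X - y0%:P) ^+ n)%:P + r * 'X.
  exists (\poly_(i < size q) q`_i.+1); apply/polyP => -[|i].
    by rewrite coefD -polyCM coefC coefMX /= addr0 gE.
  rewrite coefD -polyCM coefC coefMX /= add0r coef_poly; case: ltnP => // si.
  by rewrite nth_default // ltnW.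
have [K K0 hK] := ev_near_bound r y0; have [L L0 hL] := poly_near_bound g0 y0.
pose e := Num.min 1 d / 2.
have min0 : 0 < Num.min 1 d by rewrite lt_min ltr01.
have e0 : 0 < e by rewrite divr_gt0.
have e2 : 2 * e = Num.min 1 d by rewrite /e; field.
have e1 : 2 * e <= 1 by rewrite e2 ge_min lexx.
have ed : 2 * e <= d by rewrite e2 ge_min lexx orbT.
have [d3 d30 h3] := poly_cont y0 phi e0.
exists (Num.min e d3); first by rewrite lt_min e0.
exists (2 * (K ^+ 2 + L ^+ 2) / c).
  by rewrite divr_ge0 ?(ltW c0) // mulr_ge0 // addr_ge0 ?sqr_ge0.
move=> [x y] /= [xe]; rewrite lt_min => /andP[ye /h3 hphi].
move: xe; rewrite lt_min => /andP[xe _].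
pose s := x - phi.[y]; have xs : x = s + phi.[y] by rewrite /s subrK.
have s2e : `|s| < 2 * e.
  have -> : s = (x - x0) - (phi.[y] - phi.[y0]) by rewrite /s phi0; ring.
  by apply: le_lt_trans (ler_normB _ _) _; lra.
rewrite xs -!ev_shift -/q rE evD !evM !evC.
have -> : ev 'X s y = s by rewrite /ev hornerX hornerC.
rewrite horner_exp hornerXsubC.
have sd : `|s| < d by lra.
have yd : `|y - y0| < d by lra.
have y1 : `|y - y0| <= 1 by lra.
have s1 : `|s| <= 1 by lra.
have hcs := hc s y sd yd; have hKs := hK s y s1 y1; have hLy := hL y y1.
set T := `|y - y0| ^+ n in hcs.
have T0 : 0 <= T by rewrite exprn_ge0.
have A1 : `|g0.[y] * (y - y0) ^+ n| <= L * T.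
  by rewrite normrM normrX; apply: ler_wpM2r.
have A2 : `|ev r s y * s| <= K * `|s| by rewrite normrM; apply: ler_wpM2r.
set u := g0.[y] * _ in A1 *; set w := ev r s y * s in A2 *.
have u2 : u ^+ 2 <= L ^+ 2 * T ^+ 2.
  rewrite -exprMn -[u ^+ 2]real_normK ?num_real //.
  by rewrite lerXn2r ?nnegrE // mulr_ge0 // ltW.
have w2 : w ^+ 2 <= K ^+ 2 * s ^+ 2.
  rewrite -[w ^+ 2]real_normK ?num_real // -[s ^+ 2]real_normK ?num_real // -exprMn.
  by rewrite lerXn2r ?nnegrE // mulr_ge0 // ltW.
have uw : (u + w) ^+ 2 <= 2 * u ^+ 2 + 2 * w ^+ 2.
  by have := sqr_ge0 (u - w); rewrite sqrrB sqrrD; lra.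
apply: le_trans uw _.
have B1 := ler_wpM2l (sqr_ge0 K) (sqr_ge0 T).
apply: le_trans (_ : 2 * (K ^+ 2 + L ^+ 2) / c * (c * (T ^+ 2 + s ^+ 2)) <= _); last first.
  apply: ler_wpM2l; last exact: hcs.
  by rewrite divr_ge0 ?(ltW c0) // mulr_ge0 // addr_ge0 ?sqr_ge0.
rewrite mulrA divfK ?gt_eqF //.
have := mulr_ge0 (sqr_ge0 K) (sqr_ge0 T); have := mulr_ge0 (sqr_ge0 L) (sqr_ge0 s).
rewrite !mulrDr !mulrDl; lra.
Qed.

(** Reduction modulo d commutes with the real substitution for the outer
    variable, and a polynomial with infinitely many zeros is 0. *)
Lemma dvdp_of_values (d : {poly R}) F :
  (forall sigma : R, d %| F.[sigma%:P]) -> forall i, d %| F`_i.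
Proof.
move=> h i; pose F' := \poly_(j < size F) (F`_j %% d).
have F'0 : F' = 0.
  apply: ev_eq0 => s y; rewrite /ev.
  have -> : F'.[s%:P] = F.[s%:P] %% d; last by rewrite modp_eq0 // horner0.
  rewrite horner_poly horner_coef.
  rewrite (big_morph (fun f => f %% d) (fun f g => modpD d f g) (mod0p d)).
  by apply: eq_bigr => j _; rewrite -polyC_exp ![_ * _%:P]mulrC !mul_polyC modpZl.
have [si|si] := ltnP i (size F); last by rewrite nth_default ?dvdp0.
apply/modp_eq0P; have := congr1 (fun G : {poly {poly R}} => G`_i) F'0.
by rewrite /= coef0 coef_poly si.
Qed.

(** On the curve x = phi(y) + sigma (y - y0)^m the polynomial p is O((y -
    y0)^(2m)), so H is O((y - y0)^(mK)). Letting sigma vary separates the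
    coefficients of H. *)
Lemma contact_vanishing p H x0 y0 phi m C K : contact p x0 y0 phi m ->
    (forall x y, ev H x y ^+ 2 <= C * ev p x y ^+ K) ->
  forall i, ('X - y0%:P) ^+ (m * (K - i)) %| (shift phi H)`_i.
Proof.
move=> [_ /dvdpP[b0 e0] /dvdpP[b1 e1] _] hH i.
set q := shift phi p in e0 e1; set h := shift phi H.
set pi : {poly R} := 'X - y0%:P in e0 e1 *.
have [ik|ki] := leqP i K; last first.
  by rewrite (_ : (K - i)%N = 0%N) ?muln0 ?expr0 ?dvd1p //; lia.
have key : forall j, pi ^+ (m * K) %| h`_j * pi ^+ (m * j).
  move=> j; pose F := \poly_(l < size h) (h`_l * pi ^+ (m * l)).
  have -> : h`_j * pi ^+ (m * j) = F`_j.
    by rewrite coef_poly; case: ltnP => // sj; rewrite nth_default ?mul0r.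
  move: j; apply: dvdp_of_values => sigma.
  have FE y : (F.[sigma%:P]).[y] = ev h (sigma * (y - y0) ^+ m) y.
    rewrite /F horner_poly ev_coef horner_sum; apply: eq_bigr => l _.
    by rewrite -polyC_exp !hornerM hornerC horner_exp hornerXsubC exprMn exprM; ring.
  have [r qE] := split3 q.
  pose f := (sigma *: pi ^+ m).
  pose w := b0 + b1 * sigma%:P + q`_2 * (sigma ^+ 2)%:P + r.[f] * (sigma ^+ 3)%:P * pi ^+ m.
  have wE y : ev q (sigma * (y - y0) ^+ m) y = (y - y0) ^+ (2 * m) * w.[y].
    rewrite (ev_split3 _ _ qE) e0 e1 /w !(hornerXsubC, hornerD, hornerM, hornerC, horner_exp).
    rewrite horner_ev /f hornerZ horner_exp hornerXsubC.
    set T := (y - y0) ^+ m. have -> : (y - y0) ^+ (2 * m) = T ^+ 2 by rewrite mulnC exprM.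
    ring.
  have [L L0 hL] := poly_near_bound w y0.
  pose A := `|C| * L ^+ K.
  have A0 : 0 <= A by rewrite mulr_ge0 // exprn_ge0 // ltW.
  apply: (@dvdp_of_bound _ _ y0 (1 + A)) => y y1.
  rewrite FE ev_shift; set x := _ + _.
  have bound : ev H x y ^+ 2 <= A * (`|y - y0| ^+ (m * K)) ^+ 2.
    apply: le_trans (hH x y) _; apply: le_trans (ler_norm _) _.
    rewrite normrM normrX /x -ev_shift -/q wE normrM normrX exprMn -mulrA.
    apply: ler_wpM2l => //; rewrite mulrC.
    have -> : (`|y - y0| ^+ (2 * m)) ^+ K = (`|y - y0| ^+ (m * K)) ^+ 2.
      by rewrite -!exprM; congr (_ ^+ _); lia.
    apply: ler_wpM2r; first exact: sqr_ge0.
    by apply: lerXn2r; rewrite ?nnegrE ?(ltW L0) //; exact: hL.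
  set u := _ ^+ (m * K) in bound *.
  have u0 : 0 <= u by rewrite exprn_ge0.
  rewrite -(@ler_pXn2r _ 2) ?nnegrE ?mulr_ge0 ?addr_ge0 //.
  rewrite real_normK ?num_real // exprMn; apply: le_trans bound _.
  apply: ler_wpM2r; first exact: sqr_ge0.
  by have := sqr_ge0 A; rewrite sqrrD; lra.
have := key i; have {1}-> : (m * K = m * (K - i) + m * i)%N by rewrite -mulnDr subnK.
by rewrite exprD dvdp_mul2r // expf_neq0 // polyXsubC_eq0.
Qed.

End LocalAnalysis.

(** * Invariance, order and degree of resultants *)
Section ResultantShift.
Variable A : idomainType.
Implicit Types (F G : {poly A}) (c : A).

Definition shift_mx c n : 'M[A]_n := \matrix_(i, j) (('X + c%:P) ^+ i)`_j.

Lemma size_XaddC_exp c i : size (('X + c%:P) ^+ i) = i.+1.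
Proof. by rewrite -[c]opprK rmorphN size_exp_XsubC. Qed.

Lemma det_shift_mx c n : \det (shift_mx c n) = 1.
Proof.
rewrite det_trig; last first.
  by apply/is_trig_mxP => i j ij; rewrite mxE nth_default // size_XaddC_exp.
apply: big1 => i _; rewrite mxE.
have : ('X + c%:P) ^+ i \is monic by apply: monic_exp; rewrite monicXaddC.
by rewrite monicE lead_coefE size_XaddC_exp => /eqP.
Qed.

Lemma rows_shift_mx c m n (f : 'I_m -> {poly A}) : (forall i, (size (f i) <= n)%N) ->
  (\matrix_(i < m, j < n) (f i)`_j) *m shift_mx c n =
  \matrix_(i < m, j < n) (f i \Po ('X + c%:P))`_j.
Proof.
move=> sf; apply/matrixP => i j; rewrite !mxE.
rewrite /comp_poly (@horner_coef_wide _ n) ?size_map_polyC // coef_sum.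
by apply: eq_bigr => k _; rewrite !mxE coef_map /= coefCM.
Qed.

Lemma SylvesterE F G : Sylvester_mx F G =
  col_mx (\matrix_(i, j) ('X^i * F)`_j) (\matrix_(i, j) ('X^i * G)`_j).
Proof.
apply/matrixP => i j; rewrite Sylvester_mxE mxE.
by case: (split i) => k; rewrite mxE coefXnM ltnNge if_neg -mulrb.
Qed.

(** The translation multiplies the Sylvester matrix on both sides by
    unitriangular matrices. *)
Lemma resultant_shift F G c : F != 0 -> G != 0 ->
  resultant (F \Po ('X + c%:P)) (G \Po ('X + c%:P)) = resultant F G.
Proof.
move=> F0 G0; set L := 'X + c%:P.
have sL H : size (H \Po L) = size H by rewrite size_comp_poly2 // size_XaddC.
have row_shift m n (H : {poly A}) : (m + (size H).-1 <= n)%N -> H != 0 ->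
    (\matrix_(i < m, j < n) ('X^i * H)`_j) *m shift_mx c n =
    shift_mx c m *m (\matrix_(i < m, j < n) ('X^i * (H \Po L))`_j).
  move=> mn H0; rewrite rows_shift_mx => [|i]; last first.
    rewrite size_monicM ?monicXn // size_polyXn addSn /=.
    apply: leq_trans mn; have := size_poly_gt0 H; rewrite H0.
    by case: (size H) => // k _ /=; rewrite addnS -addSn leq_add2r.
  apply/matrixP => i j; rewrite !mxE comp_polyM comp_Xn_poly -/L.
  have {1}-> : L ^+ i = \sum_(k < m) (L ^+ i)`_k *: 'X^k.
    have sLi : (size (L ^+ i) <= m)%N by rewrite size_XaddC_exp.
    by rewrite -poly_def; apply/polyP => k; rewrite coef_poly; case: ltnP => // mk;
      rewrite nth_default // (leq_trans sLi).
  rewrite mulr_suml coef_sum; apply: eq_bigr => k _.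
  by rewrite !mxE -scalerAl coefZ.
have : \det (Sylvester_mx F G *m shift_mx c _) =
    \det (block_mx (shift_mx c (size G).-1) 0 0 (shift_mx c (size F).-1) *m
     (col_mx (\matrix_(i < (size G).-1, j < (size G).-1 + (size F).-1) ('X^i * (F \Po L))`_j)
             (\matrix_(i < (size F).-1, j < (size G).-1 + (size F).-1) ('X^i * (G \Po L))`_j))).
  congr (\det _); rewrite SylvesterE mul_col_mx mul_block_col !mul0mx addr0 add0r.
  by rewrite !row_shift // addnC.
rewrite !det_mulmx det_ublock !det_shift_mx mulr1 !mul1r => E.
by rewrite /resultant E SylvesterE !sL.
Qed.

(** Scaling the rows by pi^(u i) allows pi^(v j) to be taken out of the columns. *)
Lemma det_weighted_dvd n (M : 'M[A]_n) (pi : A) (u v : 'I_n -> nat) :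
    (forall i j, exists w, pi ^+ u i * M i j = pi ^+ v j * w) ->
  exists w, pi ^+ (\sum_i u i) * \det M = pi ^+ (\sum_j v j) * w.
Proof.
move=> h; pose w i j := sval (cid (h i j)).
have wE i j : pi ^+ u i * M i j = pi ^+ v j * w i j := svalP (cid (h i j)).
exists (\det (\matrix_(i, j) w i j)).
have : diag_mx (\row_i pi ^+ u i) *m M = (\matrix_(i, j) w i j) *m diag_mx (\row_j pi ^+ v j).
  by apply/matrixP => i j; rewrite mul_diag_mx mul_mx_diag !mxE wE mulrC.
move/(congr1 determinant); rewrite !det_mulmx !det_diag.
rewrite (eq_bigr (fun i => pi ^+ u i)) => [|i _]; last by rewrite mxE.
rewrite [in RHS](eq_bigr (fun i => pi ^+ v i)) => [|i _]; last by rewrite mxE.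
by rewrite !prodrXr mulrC => ->; rewrite mulrC.
Qed.

End ResultantShift.

Section Degree.
Variable K : fieldType.

(** Each term of the Leibniz formula satisfies the bound. *)
Lemma det_weighted_size n (M : 'M[{poly K}]_n) (u v : 'I_n -> nat) :
    (forall i j, M i j != 0 -> (size (M i j) + v j <= (u i).+1)%N) ->
  \det M != 0 -> (size (\det M) + \sum_j v j <= (\sum_i u i).+1)%N.
Proof.
move=> h; pose B := ((\sum_i u i).+1 - \sum_j v j)%N.
have sz (s : {perm 'I_n}) : (\prod_i M i (s i) != 0) ->
    (size (\prod_i M i (s i))%R + \sum_j v j <= (\sum_i u i).+1)%N.
  move=> /prodf_neq0 hs.
  rewrite [X in (_ + X)%N](reindex_inj (@perm_inj _ s)) /= size_prod; last by move=> i _; exact: hs.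
  have : (\sum_i size (M i (s i)) + \sum_i v (s i) <= \sum_i (u i).+1)%N.
    by rewrite -big_split /=; apply: leq_sum => i _; apply: h; exact: hs.
  have -> : (\sum_i (u i).+1 = \sum_i u i + #|'I_n|)%N.
    rewrite -sum1_card -big_split /=; apply: eq_bigr => i _; by rewrite addn1.
  set a := (\sum_i size _)%N; set b := (\sum_i v _)%N; set c := (\sum_i u i)%N.
  have : (#|'I_n| <= a)%N.
    rewrite -sum1_card; apply: leq_sum => i _; rewrite size_poly_gt0; exact: hs.
  have -> : #|(xpredT : pred 'I_n)| = #|'I_n| by exact: eq_card.
  by move: a b c #|'I_n| => a b c d; clear; lia.
have [vu d0|BV] := leqP (\sum_j v j) (\sum_i u i).+1%N; last first.
  case/negP; apply/eqP; apply: big1 => s _.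
  have [->|/sz] := eqVneq (\prod_i M i (s i)) 0; first by rewrite mulr0.
  by move=> /(leq_trans (leq_addl _ _)); rewrite leqNgt BV.
have : (size (\det M) <= B)%N.
  apply: leq_trans (size_sum _ _ _) _; apply/bigmax_leqP => s _.
  have [->|/sz hs] := eqVneq (\prod_i M i (s i)) 0; first by rewrite mulr0 size_poly0.
  have sB : (size (\prod_i M i (s i))%R <= B)%N.
    by rewrite /B leq_subRL // addnC.
  by rewrite mulr_sign; case: ifP => _; rewrite ?size_polyN.
by rewrite /B leq_subRL // addnC.
Qed.

End Degree.

(** * Intersection numbers with the branches *)
(** Weights on the rows of a Sylvester matrix: the first e rows are multiples of
    one polynomial, the last d of the other. *)
Definition row_weight (e d : nat) (f g : nat -> nat) (i : 'I_(e + d)) : nat :=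
  match split i with inl k => f k | inr k => g k end.

Lemma sum_row_weight e d f g :
  (\sum_i @row_weight e d f g i = \sum_(k < e) f k + \sum_(k < d) g k)%N.
Proof.
rewrite big_split_ord /=; congr (_ + _)%N; apply: eq_bigr => i _; rewrite /row_weight.
  by case: splitP => [k|k] /= E; [congr f|have := ltn_ord i; rewrite E ltnNge leq_addr].
case: splitP => [k|k] /= E; last by congr g; apply/eqP; rewrite -(eqn_add2l e) E.
by have := ltn_ord k; rewrite -E ltnNge leq_addr.
Qed.

(** The excess 18 K of the row weights over the column weights is the product of
    the degrees 6 and 3 K. *)
Lemma degree_weights K e d : d = 6%N ->
  (\sum_(i < e + d) row_weight (fun k => 6 + k) (fun k => 3 * K + k) i =
   18 * K + \sum_(j < e + d) j)%N.
Proof.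
move=> ->; rewrite sum_row_weight big_split_ord /= !big_split /=.
rewrite !sum_nat_const !card_ord; move: (\sum_(k < e) k)%N (\sum_(k < 6) k)%N => a b.
lia.
Qed.

(** The excess of the column weights over the row weights is at least 2 K m, the
    order of vanishing of h on the two branches of p at a contact of order m. *)
Lemma order_weights K e d m : d = 6%N ->
  exists r, (\sum_(j < e + d) m * (K + 2 - j) =
    \sum_(i < e + d) row_weight (fun k => m * (K - k)) (fun k => m * (2 - k)) i + 2 * K * m + r)%N.
Proof.
move=> ->; rewrite sum_row_weight -!big_distrr /=.
have -> : (\sum_(k < 6) (2 - k) = 3)%N by rewrite !big_ord_recr big_ord0.
have -> : (e + 6 = e.+2 + 4)%N by lia.
rewrite big_split_ord /= big_ord_recl big_ord_recl /=.
rewrite (eq_bigr (fun k : 'I_e => (K - k)%N)) => [|k _]; last first.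
  by rewrite /bump /=; lia.
set r := (\sum_(i < 4) _)%N; move: r (\sum_(k < e) _)%N => r s.
exists (m * r)%N; rewrite /bump /=; have -> : (K + 2 - 0 = K + 2)%N by lia.
have -> : (K + 2 - (1 + 0) = K + 1)%N by lia.
lia.
Qed.

Section Resultants.
Variable R : realType.
Implicit Types (p h : {poly {poly R}}).

Lemma resultant_size K p h : size p = 7 -> tdeg 6 p -> tdeg (3 * K) h ->
  resultant p h != 0 -> (size (resultant p h) <= (18 * K).+1)%N.
Proof.
move=> sp /tdegP tp /tdegP th res0.
pose u := row_weight (e := (size h).-1) (d := (size p).-1) (fun k => 6 + k)%N (fun k => 3 * K + k)%N.
have entry (F : {poly {poly R}}) n (k j : nat) : (size (F`_(j - k))%R <= n.+1 - (j - k))%N ->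
    F`_(j - k) *+ (k <= j)%N != 0 -> (size (F`_(j - k) *+ (k <= j)%N)%R + j <= (n + k).+1)%N.
  case: (leqP k j) => kj; last by rewrite /= ?mulr0n eqxx.
  rewrite /= ?mulr1n => sF; rewrite -size_poly_gt0; move: (size _) sF => s; lia.
have := @det_weighted_size R _ (Sylvester_mx p h) u (fun j => j) _ res0.
rewrite degree_weights ?sp // -addSn leq_add2r; apply.
move=> i j; rewrite Sylvester_mxE /u /row_weight; case: (split i) => k.
  exact: entry.
exact: entry.
Qed.

(** The hypotheses say that p and h lie in the second and K-th powers of the
    ideal generated by x and pi^m. *)
Lemma resultant_order K m p h (pi : {poly R}) : pi != 0 -> size p = 7 ->
    (forall i, pi ^+ (m * (2 - i)) %| p`_i) -> (forall i, pi ^+ (m * (K - i)) %| h`_i) ->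
  pi ^+ (2 * K * m) %| resultant p h.
Proof.
move=> pi0 sp hp hh.
pose u := row_weight (e := (size h).-1) (d := (size p).-1) (fun k => m * (K - k))%N (fun k => m * (2 - k))%N.
have entry (F : {poly {poly R}}) a b (k j : nat) : pi ^+ (m * (a - (j - k))) %| F`_(j - k) ->
    (K + 2 = a + b)%N -> exists w, pi ^+ (m * (b - k)) * (F`_(j - k) *+ (k <= j)%N) =
      pi ^+ (m * (K + 2 - j)) * w.
  move=> /dvdpP[w ->] Kab; case: (leqP k j) => kj; last by exists 0; rewrite /= ?mulr0n ?mulr0 // !mulr0.
  exists (w * pi ^+ (m * (b - k + (a - (j - k)) - (K + 2 - j)))); rewrite /= ?mulr1n.
  rewrite mulrCA [RHS]mulrCA -!exprD -!mulnDr; congr (_ * _ ^+ (m * _)); lia.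
have [|w E] := @det_weighted_dvd _ _ (Sylvester_mx p h) pi u (fun j => m * (K + 2 - j))%N.
  move=> i j; rewrite Sylvester_mxE /u /row_weight; case: (split i) => k.
    by apply: (entry p 2) => //; rewrite addnC.
  exact: (entry h K).
have [|r rE] := @order_weights K (size h).-1 (size p).-1 m; first by rewrite sp.
move: E; rewrite rE -addnA exprD -mulrA => /(mulfI (expf_neq0 _ pi0)).
by rewrite exprD -mulrA /resultant => ->; rewrite dvdp_mulr ?dvdpp.
Qed.

Lemma resultant_contact K m p h phi x0 y0 C : size p = 7 -> h != 0 ->
    contact p x0 y0 phi m -> (forall x y, ev h x y ^+ 2 <= C * ev p x y ^+ K) ->
  ('X - y0%:P) ^+ (2 * K * m) %| resultant p h.
Proof.
move=> sp h0 hc hh; have hv := contact_vanishing hc hh.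
have p0 : p != 0 by rewrite -size_poly_gt0 sp.
rewrite -(resultant_shift phi p0 h0); apply: resultant_order => //.
- by rewrite polyXsubC_eq0.
- by rewrite size_comp_poly2 ?size_XaddC.
case: hc => _ c0 c1 _ [|[|i]]; rewrite ?muln1 ?[(m * _)%N]mulnC //.
by rewrite dvd1p.
Qed.

Lemma prod_powers_dvdp (I : eqType) (s : seq I) (y : I -> R) (n : I -> nat) (f : {poly R}) :
    uniq [seq y i | i <- s] -> (forall i, i \in s -> ('X - (y i)%:P) ^+ n i %| f) ->
  \prod_(i <- s) ('X - (y i)%:P) ^+ n i %| f.
Proof.
elim: s => [|i s IH] /=; first by rewrite big_nil dvd1p.
move=> /andP[yi us] h; rewrite big_cons Gauss_dvdp.
  by rewrite h ?mem_head // IH // => j js; rewrite h // in_cons js orbT.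
rewrite coprimep_expl // big_seq; apply: (big_ind (fun q => coprimep ('X - (y i)%:P) q)).
- exact: coprimep1.
- by move=> q r hq hr; rewrite coprimepMr hq.
move=> j js; rewrite coprimep_expr // coprimep_XsubC rootE hornerXsubC subr_eq0.
by apply: contraNneq yi => <-; rewrite map_f.
Qed.

(** The zeros contribute coprime factors (y - y_i)^(2 K m_i), of total degree at
    least 20 K, while the resultant has degree at most 18 K. *)
Lemma resultant_contacts_eq0 (I : eqType) (s : seq I) (x y : I -> R)
    (phi : I -> {poly R}) (m : I -> nat) K p h C :
    size p = 7 -> tdeg 6 p -> tdeg (3 * K) h -> (0 < K)%N ->
    uniq [seq y i | i <- s] ->
    (forall i, i \in s -> contact p (x i) (y i) (phi i) (m i)) ->
    (10 <= \sum_(i <- s) m i)%N ->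
    (forall x y, ev h x y ^+ 2 <= C * ev p x y ^+ K) ->
  resultant p h = 0.
Proof.
move=> sp tp th K0 us hc m10 hh.
have [->|h0] := eqVneq h 0.
  by rewrite /resultant; apply/eqP; rewrite -/(resultant p 0) resultant_eq0 gcdp0 sp.
apply/eqP; apply: contraT => res0.
have := resultant_size sp tp th res0.
have /dvdp_leq -/(_ res0) : \prod_(i <- s) ('X - (y i)%:P) ^+ (2 * K * m i) %| resultant p h.
  by apply: prod_powers_dvdp => // i /hc /resultant_contact; apply.
have -> : size (\prod_(i <- s) ('X - (y i)%:P) ^+ (2 * K * m i)) =
    (2 * K * \sum_(i <- s) m i).+1.
  rewrite big_distrr /=; elim: (s) => [|i t IH]; first by rewrite !big_nil size_poly1.
  rewrite !big_cons size_monicM ?monic_exp ?monicXsubC //.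
    by rewrite size_exp_XsubC IH addSn addnS.
  by rewrite -size_poly_gt0 IH.
move=> h1 h2; have := leq_trans h1 h2; move: m10 K0; clear.
move: (\sum_(i <- s) m i)%N => n; nia.
Qed.

End Resultants.

(** * Ten contacts, and the descent *)
Section GenericChart.
Variable R : realType.
Implicit Types (P Q H : {mpoly R[3]}) (F G h p w : {poly {poly R}}).

Definition cubic_exponents : seq (nat * nat) :=
  [:: (0, 0); (0, 1); (0, 2); (0, 3); (1, 0); (1, 1); (1, 2); (2, 0); (2, 1); (3, 0)]%N.

Definition cubic_exponent (a : nat) := nth (0, 0)%N cubic_exponents a.

Definition cubic_monomial (a : nat) : {poly {poly R}} :=
  ('X^((cubic_exponent a).2))%:P * 'X^((cubic_exponent a).1).

Lemma coef_cubic_monomial a i j :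
  (cubic_monomial a)`_i`_j = (cubic_exponent a == (i, j))%:R.
Proof.
rewrite /cubic_monomial; case: (cubic_exponent a) => k l /=.
rewrite coefMXn coefC xpair_eqE subn_eq0; case: (ltngtP i k) => ik /=.
- by rewrite coef0.
- by rewrite coef0.
- by rewrite coefXn [j == l]eq_sym.
Qed.

Lemma tdeg_cubic_monomial a : tdeg 3 (cubic_monomial a).
Proof.
have : ((cubic_exponent a).2 + (cubic_exponent a).1 <= 3)%N.
  by rewrite /cubic_exponent; do 10!(case: a => [//|a]); rewrite /= nth_nil.
rewrite /cubic_monomial; case: (cubic_exponent a) => k l /= kl.
apply: (tdegW kl); apply: tdegM; first by apply: tdegC; rewrite size_polyXn.
by rewrite -[X in tdeg X]mul1n; apply: tdegX; exact: tdeg_x.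
Qed.

Definition functional_linear (L : {poly {poly R}} -> R) :=
  forall c F G, L (c%:P *: F + G) = c * L F + L G.

(** Cubics form a space of dimension 10. *)
Lemma cubic_with_conditions N (L : 'I_N -> {poly {poly R}} -> R) : (N < 10)%N ->
    (forall b, functional_linear (L b)) ->
  exists G, [/\ tdeg 3 G, G != 0 & forall b, L b G = 0].
Proof.
move=> N9 linL.
pose A : 'M[R]_(10, N) := \matrix_(a, b) L b (cubic_monomial a).
(* N < 10 conditions leave a nonzero row vector in the kernel *)
have /rowV0Pn[v /sub_kermxP vA v0] : kermx A != 0.
  rewrite kermx_eq0 /row_free; apply: contraTneq N9 => rA.
  by rewrite -leqNgt -rA rank_leq_col.
pose G := \sum_(a < 10) (v 0 a)%:P *: cubic_monomial a.
have coefG (a : 'I_10) : G`_((cubic_exponent a).1)`_((cubic_exponent a).2) = v 0 a.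
  rewrite /G !coef_sum (bigD1 a) //= big1 ?addr0 => [|b ba];
    rewrite coefZ coefCM coef_cubic_monomial -surjective_pairing.
    by rewrite eqxx mulr1.
  by rewrite nth_uniq // (negPf ba : (b == a :> nat) = false) mulr0.
exists G; split.
- apply: tdeg_sum => a _; rewrite -mul_polyC -[X in tdeg X]add0n; apply: tdegM.
    by apply: tdegC; exact: size_polyC_leq1.
  exact: tdeg_cubic_monomial.
- apply: contraNneq v0 => G0; apply/eqP/rowP => a; rewrite mxE -coefG G0.
  by rewrite !coef0.
move=> b; have L0 : L b 0 = 0.
  by have := linL b (-1) 0 0; rewrite scaler0 addr0 mulN1r addNr.
have := congr1 (fun M : 'rV_N => M 0 b) vA; rewrite !mxE => <-.
rewrite /G; apply: (big_rec2 (fun x y => L b x = y)) => // a y x _ <-.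
by rewrite linL mxE.
Qed.

(** Contact of order m amounts to m linear conditions, the coefficients of a
    remainder modulo (y - y_i)^m. *)
Lemma cubic_with_contacts (T : eqType) (s : seq T) (y : T -> R)
    (phi : T -> {poly R}) (m : T -> nat) : (\sum_(z <- s) m z < 10)%N ->
  exists G, [/\ tdeg 3 G, G != 0 &
    forall z, z \in s -> ('X - (y z)%:P) ^+ m z %| (shift (phi z) G)`_0].
Proof.
move=> sm; pose conds := flatten [seq [seq (z, l) | l <- iota 0 (m z)] | z <- s].
have szc : size conds = (\sum_(z <- s) m z)%N.
  rewrite /conds size_flatten /shape -map_comp sumnE big_map; apply: eq_bigr => z _.
  by rewrite /= size_map size_iota.
have [->|/negP/negP] := eqVneq s [::].
  have [||G [tG G0 _]] := @cubic_with_conditions 0 (fun _ => fun=> 0).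
  - by [].
  - by move=> b c F G; rewrite mulr0 addr0.
  by exists G; split.
rewrite -size_eq0 -lt0n => s0.
case: s => [//|z0 s] in sm conds szc s0 *; rewrite -szc in sm.
pose L (b : 'I_(size conds)) G : R :=
  let zl := nth (z0, 0%N) conds b in
  (G.[phi zl.1] %% ('X - (y zl.1)%:P) ^+ m zl.1)`_zl.2.
have [|G [tG G0 LG]] := cubic_with_conditions (L := L) sm.
  move=> b c F G; rewrite /L; case: (nth (z0, 0%N) conds b) => z l /=.
  by rewrite hornerD hornerZ mul_polyC modpD modpZl coefD coefZ.
exists G; split=> // z zs; rewrite -horner_coef0 /shift horner_comp !hornerE.
apply/modp_eq0P/polyP => l; rewrite coef0.
have [lm|lm] := ltnP l (m z); last first.
  apply: nth_default; apply: leq_trans lm; rewrite -ltnS.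
  rewrite -(size_exp_XsubC (m z) (y z)) ltn_modpN0 //.
  by rewrite expf_neq0 // polyXsubC_eq0.
have zlc : (z, l) \in conds.
  by apply/flatten_mapP; exists z => //; apply: map_f; rewrite mem_iota.
have ilt : (index (z, l) conds < size conds)%N by rewrite index_mem.
by have := LG (Ordinal ilt); rewrite /L /= nth_index.
Qed.

Definition no_zero_at_infinity P := forall x y, (x != 0) || (y != 0) -> 0 < pev P x y 0.

(** The zeros lie on distinct lines on which y is constant, so that their
    contributions to the resultant are coprime, and P vanishes exactly to order
    2 on each of these lines, so that y parametrizes the branches. *)
Definition generic_zeros P (s : seq (R * R)) :=
  [/\ forall x y, pev P x y 1 = 0 -> (x, y) \in s,
      forall z, z \in s -> pev P z.1 z.2 1 = 0,
      uniq [seq z.2 | z <- s] &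
      forall z, z \in s -> ((shift z.1%:P (aff P))`_2).[z.2] != 0].

(** If the orders of contact added up to 9 or less, all of them would be
    definite, and some nonzero cubic would satisfy all the contact conditions.
    Its square would be dominated by P near each zero, hence everywhere. *)
Lemma no_square_below_has_contacts P s : no_square_below P -> no_zero_at_infinity P -> generic_zeros P s ->
  exists (phi : R * R -> {poly R}) (m : R * R -> nat),
    (forall z, z \in s -> contact (aff P) z.1 z.2 (phi z) (m z)) /\
    (10 <= \sum_(z <- s) m z)%N.
Proof.
move=> gP Pinf [sall szero suniq shess]; have [hP P0 Pn _] := gP.
have p0 := aff_nonneg P0.
have /choice[f hf] : forall z, exists fz : {poly R} * nat, z \in s ->
    [/\ contact (aff P) z.1 z.2 fz.1 fz.2, (0 < fz.2 <= 10)%N &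
      (fz.2 < 10)%N -> definite (aff P) z.1 z.2 fz.1 fz.2].
  move=> z; have [zs|zs] := boolP (z \in s); last by exists (0, 0%N).
  have [|phi [m h]] := @contact_dichotomy R (aff P) z.1 z.2 10 isT p0 _ (shess z zs).
    by rewrite ev_aff szero.
  by exists (phi, m).
exists (fun z => (f z).1), (fun z => (f z).2); split; first by move=> z /hf[].
rewrite leqNgt; apply/negP => sm.
have [G [tG G0 hG]] := cubic_with_contacts snd (fun z => (f z).1) sm.
case/eqP: G0; have hQ : homogenize 3 G ^+ 2 \is (2 * 3).-homog.
  by rewrite mulnC; apply: dhomogMn; exact: homogenize_homog.
have [|C C0 hC] := proj_dominated (e := 3) hP hQ P0 Pinf; last first.
  apply: (no_square_below_aff_eq0 (C := C) gP tG) => x y.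
  by have := hC x y; rewrite pev_exp pev_homogenize1 // ev_aff.
move=> x y; have [Pxy|Pxy] := eqVneq (pev P x y 1) 0; last first.
  by apply: dominated_near_pos; rewrite lt_def Pxy P0.
have zs := sall x y Pxy; have [_ /andP[m0 _] hdef] := hf _ zs.
have m10 : ((f (x, y)).2 < 10)%N.
  by apply: leq_ltn_trans sm; rewrite (big_rem _ zs) /= leq_addr.
have [d d0 [C C0 hC]] := definite_dominated m0 (hdef m10) (hG _ zs).
exists d => //; exists C => // v /hC; rewrite ev_aff pev_exp pev_homogenize1 //.
Qed.

(** By the count of intersections P divides h, and the quotient satisfies the
    same bound with exponent lowered by 2. The descent ends at exponent 1, where
    h is a cubic. *)
Lemma odd_power_bounded_eq0 P s n h C : no_square_below P -> pev P 1 0 0 = 1 ->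
    no_zero_at_infinity P -> generic_zeros P s ->
    tdeg (3 * (2 * n).+1) h ->
    (forall x y, ev h x y ^+ 2 <= C * ev (aff P) x y ^+ (2 * n).+1) ->
  h = 0.
Proof.
move=> gP P1 Pinf gen; have [hP P0 Pn _] := gP.
have [pm p7] := aff_monic hP P1; have tP := tdeg_aff hP.
have [phi [m [hc m10]]] := no_square_below_has_contacts gP Pinf gen.
have [_ _ su _] := gen.
elim: n h => [|n IH] h th hh.
  by apply: (no_square_below_aff_eq0 gP th) => x y; have := hh x y; rewrite expr1.
have res0 := resultant_contacts_eq0 p7 tP th isT su hc m10 hh.
have [w hE] := no_square_below_resultant gP P1 res0.
rewrite hE (IH w) ?mulr0 //.
  apply: (tdeg_cancel pm p7); rewrite -hE.
  by have -> : (6 + 3 * (2 * n).+1 = 3 * (2 * n.+1).+1)%N by lia.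
move=> x y; rewrite -!fiberE -subr_ge0.
have -> : C * (fiber y (aff P)).[x] ^+ (2 * n).+1 - (fiber y w).[x] ^+ 2 =
   (C *: fiber y (aff P) ^+ (2 * n).+1 - fiber y w ^+ 2).[x] by rewrite !evalE.
apply: (@poly_ge0_dense _ _ (fiber y (aff P))).
  by rewrite monic_neq0 // fiber_monic.
move=> {}x px; rewrite !evalE !fiberE in px *.
have := hh x y; rewrite hE evM exprMn.
have -> : ev (aff P) x y ^+ (2 * n.+1).+1 = ev (aff P) x y ^+ 2 * ev (aff P) x y ^+ (2 * n).+1.
  by rewrite -exprD; congr (_ ^+ _); lia.
by rewrite [X in _ <= X]mulrCA ler_pM2l ?subr_ge0 // exprn_even_gt0.
Qed.

End GenericChart.

(** * Generic coordinates *)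
Section Charts.
Variable R : realType.
Implicit Types (P Q H : {mpoly R[3]}) (F G p : {poly {poly R}}).

(** V_k = 0 for all odd k, in the notation of the introduction. *)
Definition no_square_below_odd_powers P := forall n H C, H \is (3 * (2 * n).+1).-homog ->
  (forall x y z, pev H x y z ^+ 2 <= C * pev P x y z ^+ (2 * n).+1) -> H = 0.

Lemma no_square_below_odd_powers_lin g P : g \in unitmx -> no_square_below_odd_powers (lin g P) -> no_square_below_odd_powers P.
Proof.
move=> gu h n H C hH hHP; apply/eqP; apply: contraT => Hn.
have /eqP := lin_neq0 gu hH Hn; case; apply: (h n _ C); first exact: lin_homog.
by move=> x y z; rewrite /pev !meval_lin !meval_pev; exact: hHP.
Qed.

Lemma no_square_below_odd_powers_scale c P : 0 < c -> no_square_below_odd_powers (c *: P) -> no_square_below_odd_powers P.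
Proof.
move=> c0 h n H C hH hHP; apply: (h n H (C / c ^+ (2 * n).+1) hH) => x y z.
by rewrite pevZ exprMn mulrA divfK ?hHP // expf_neq0 // gt_eqF.
Qed.

Lemma no_square_below_scale c P : 0 < c -> no_square_below P -> no_square_below (c *: P).
Proof.
move=> c0 [hP P0 Pn S]; split.
- exact: dhomogZ.
- by move=> x y z; rewrite pevZ mulr_ge0 // ltW.
- by rewrite scaler_eq0 negb_or gt_eqF.
move=> G C hG h; apply: (S G (C * c) hG) => x y z.
by rewrite -mulrA -pevZ.
Qed.

Lemma no_square_below_odd_powers_chart P s : no_square_below P -> 0 < pev P 1 0 0 ->
  no_zero_at_infinity P -> generic_zeros P s -> no_square_below_odd_powers P.
Proof.
move=> gP P1 Pinf [s1 s2 s3 s4].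
pose c := (pev P 1 0 0)^-1; have c0 : 0 < c by rewrite invr_gt0.
apply: (no_square_below_odd_powers_scale c0) => n H C hH hHP.
apply: (aff_eq0 hH); apply: (@odd_power_bounded_eq0 _ (c *: P) s n _ C).
- exact: no_square_below_scale.
- by rewrite pevZ mulVf // gt_eqF.
- by move=> x y xy; rewrite pevZ mulr_gt0 // Pinf.
- split; last first.
  + move=> z /s4; have -> : aff (c *: P) = c%:P *: aff P.
      by rewrite /aff mmapZ /= mul_polyC.
    rewrite /shift comp_polyZ coefZ hornerM hornerC => h.
    by rewrite mulf_neq0 // gt_eqF.
  + exact: s3.
  + by move=> z /s2; rewrite pevZ => ->; rewrite mulr0.
  + by move=> x y; rewrite pevZ => /eqP; rewrite mulf_eq0 gt_eqF //= => /eqP /s1.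
- exact: tdeg_aff.
- by move=> x y; rewrite !ev_aff; exact: hHP.
Qed.

Lemma poly_eq_values (f g : {poly R}) : (forall x, f.[x] = g.[x]) -> f = g.
Proof.
by move=> fg; apply/eqP; rewrite -subr_eq0; apply/eqP/poly_values_eq0 => x;
  rewrite !evalE fg subrr.
Qed.

Lemma avoid_roots (I : eqType) (s : seq I) (f : I -> {poly R}) :
  (forall i, i \in s -> f i != 0) -> exists t, forall i, i \in s -> (f i).[t] != 0.
Proof.
move=> f0; have /ge_cauchy_bound h : \prod_(i <- s) f i != 0.
  by rewrite prodf_seq_neq0; apply/allP => i /f0.
have [T hT] : exists T, ~~ root (\prod_(i <- s) f i) T.
  by exists (cauchy_bound (\prod_(i <- s) f i)); apply: h; rewrite in_itv /= lexx.
exists T => i si; move: hT.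
by rewrite rootE (big_rem _ si) /= hornerM mulf_eq0 negb_or => /andP[].
Qed.

Lemma no_square_below_nonvanishing P : no_square_below P -> exists s r, 0 < pev P 1 s r.
Proof.
move=> [hP P0 Pn _]; apply: contrapT => h.
have Pz s r : pev P 1 s r = 0.
  apply/eqP; rewrite eq_le P0 andbT leNgt; apply/negP => Psr; apply: h.
  by exists s, r.
case/eqP: Pn; apply: (form_eq0 hP) => x y z; apply/eqP; rewrite eq_le P0 andbT.
pose N : {mpoly R[3]} := lin (mx3 (triple 0 0 1) (triple 0 1 0) (triple 1 0 0)) (- P).
have NE a b c : pev N a b c = - pev P c b a.
  rewrite pev_mx3 mevalN; congr (- _); apply: meval_eq => i.
  by rewrite /triple; case: (val i) => [|[|_]] /=; ring.
suff /(_ z y x) : forall a b c, 0 <= pev N a b c by rewrite NE oppr_ge0.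
apply: pev_ge0_dense => a b c c0; rewrite NE; have -> : pev P c b a = c ^+ 6 * pev P 1 (b / c) (a / c).
  rewrite -(pev_homog _ _ _ _ hP); congr (pev _ _ _ _); first by rewrite mulr1.
    by rewrite mulrC divfK.
  by rewrite mulrC divfK.
by rewrite Pz mulr0 oppr0.
Qed.

Lemma double_zero_derivative p x y : (forall x y, 0 <= ev p x y) -> ev p x y = 0 ->
  ev p^`() x y = 0.
Proof.
move=> p0 pz; have f0 s : 0 <= (fiber y p).[s] by rewrite fiberE.
have fr : root (fiber y p) x by rewrite rootE fiberE pz.
have [u [uE _]] := poly_nonneg_root f0 fr.
have -> : ev p^`() x y = ((fiber y p)^`()).[x] by rewrite -fiberE /fiber deriv_map.
by rewrite uE expr2 -mulrA derivM hornerD !hornerM hornerXsubC subrr !mul0r mulr0 addr0.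
Qed.

(** At an affine zero both P and its derivative in x vanish, and their resultant
    is not 0 because P is irreducible. At infinity the zeros are the roots of a
    nonzero polynomial. *)
Lemma no_square_below_finite_zeros P : no_square_below P -> pev P 1 0 0 = 1 ->
  exists s : seq (R * R * R),
    (forall v, v \in s -> [|| v.1.1 != 0, v.1.2 != 0 | v.2 != 0]) /\
    (forall x y z, [|| x != 0, y != 0 | z != 0] -> pev P x y z = 0 ->
      exists2 v, v \in s & exists l, [/\ x = l * v.1.1, y = l * v.1.2 & z = l * v.2]).
Proof.
move=> gP P1; have [hP P0 Pn _] := gP; have [pm p7] := aff_monic hP P1.
pose D := resultant (aff P) (aff P)^`().
have d5 : ((aff P)^`())`_5 != 0.
  by rewrite coef_deriv aff_top // P1 -polyCMn polyC_eq0 pnatr_eq0.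
have dp0 : (aff P)^`() != 0 by apply: contraNneq d5 => ->; rewrite coef0.
have D0 : D != 0.
  apply/eqP => /(no_square_below_resultant gP P1)[w wE].
  have := congr1 (fun F : {poly {poly R}} => size F) wE.
  have w0 : w != 0 by apply: contraNneq dp0 => w0; rewrite wE w0 mulr0.
  rewrite size_monicM // p7 => E; have := lt_size_deriv (monic_neq0 pm).
  rewrite E p7; move: w0; rewrite -size_poly_gt0; by case: (size w).
have [ys hys] := poly_finite_roots D0.
have /choice[xs hxs] : forall y, exists t : seq R, forall x, root (fiber y (aff P)) x -> x \in t.
  by move=> y; apply: poly_finite_roots; rewrite monic_neq0 // fiber_monic.
pose L := line (triple 0 1 0) (triple 1 0 0) P.
have LE x : L.[x] = pev P x 1 0.
  rewrite lineE; apply: meval_eq => i; rewrite /triple.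
  by case: (val i) => [|[|_]] /=; ring.
have L0 : L != 0.
  apply/eqP => L00; pose M := line (triple 1 0 0) (triple 0 1 0) P.
  have ME t : M.[t] = pev P 1 t 0.
    rewrite lineE; apply: meval_eq => i; rewrite /triple.
    by case: (val i) => [|[|_]] /=; ring.
  have /eqP : M * 'X = 0.
    apply: poly_values_eq0 => t; rewrite hornerM hornerX ME.
    have [->|t0] := eqVneq t 0; first by rewrite mulr0.
    have -> : pev P 1 t 0 = t ^+ 6 * pev P t^-1 1 0.
      by rewrite -(pev_homog _ _ _ _ hP) mulfV // mulr1 mulr0.
    by rewrite -LE L00 horner0 mulr0 mul0r.
  rewrite mulf_eq0 polyX_eq0 orbF => /eqP M0.
  by have := ME 0; rewrite M0 horner0 P1 => /eqP; rewrite eq_sym oner_eq0.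
have [ts hts] := poly_finite_roots L0.
exists ([seq (x, y, 1) | y <- ys, x <- xs y] ++ [seq (t, 1, 0) | t <- ts]); split.
  move=> v; rewrite mem_cat => /orP[/allpairsPdep[y [x [_ _ ->]]]|/mapP[t _ ->]] /=.
    by rewrite oner_eq0 !orbT.
  by rewrite oner_eq0 !orbT.
move=> x y z xyz Pxyz; have [z0|z0] := eqVneq z 0; last first.
  have Pz : pev P (x / z) (y / z) 1 = 0.
    have : z ^+ 6 * pev P (x / z) (y / z) 1 = 0.
      by rewrite -(pev_homog _ _ _ _ hP) ![z * (_ / _)]mulrC !divfK // mulr1.
    by move/eqP; rewrite mulf_eq0 expf_eq0 (negPf z0) andbF => /eqP.
  exists (x / z, y / z, 1); last first.
    by exists z => /=; rewrite ![z * (_ / _)]mulrC !divfK // mulr1.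
  rewrite mem_cat; apply/orP; left; apply/allpairsPdep; exists (y / z), (x / z); split=> //.
    apply: hys; rewrite rootE /D.
    have [||[u v] /= _ E] := @resultant_in_ideal _ (aff P) (aff P)^`().
    - by rewrite p7.
    - by rewrite ltnNge; apply: contra d5 => /size1_polyC ->; rewrite coefC.
    have := congr1 (fun F => ev F (x / z) (y / z)) E.
    rewrite /= evC evD !evM => ->.
    rewrite (double_zero_derivative (aff_nonneg P0)) ?ev_aff ?Pz //.
    by rewrite !mulr0 addr0.
  by apply: hxs; rewrite rootE fiberE ev_aff Pz.
have y0 : y != 0.
  apply/eqP => y0; move: xyz Pxyz; rewrite y0 z0 eqxx /= orbF => x0.
  have -> : pev P x 0 0 = x ^+ 6 * pev P 1 0 0.
    by rewrite -(pev_homog _ _ _ _ hP) mulr1 !mulr0.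
  by rewrite P1 mulr1 => /eqP; rewrite expf_eq0 (negPf x0).
exists (x / y, 1, 0); last by exists y => /=; rewrite mulrC divfK // mulr1 mulr0 z0.
rewrite mem_cat; apply/orP; right; apply: map_f; apply: hts; rewrite rootE LE.
have : y ^+ 6 * pev P (x / y) 1 0 = 0.
  by move: Pxyz; rewrite z0 => Pxyz; rewrite -(pev_homog _ _ _ _ hP) [y * (x / y)]mulrC divfK // mulr1 mulr0.
by move/eqP; rewrite mulf_eq0 expf_eq0 (negPf y0).
Qed.

(** For a suitable t the line t^2 x + t y + z = 0 misses the finitely many
    zeros; it is moved to infinity. *)
Lemma no_square_below_affine_zeros P : no_square_below P -> pev P 1 0 0 = 1 ->
  exists t, let g := mx3 (triple 1 0 (- t ^+ 2)) (triple 0 1 (- t)) (triple 0 0 1) in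
    no_zero_at_infinity (lin g P) /\
    exists s : seq (R * R), forall x y, pev (lin g P) x y 1 = 0 -> (x, y) \in s.
Proof.
move=> gP P1; have [hP P0 Pn _] := gP.
have [s [s0 hs]] := no_square_below_finite_zeros gP P1.
pose f (v : R * R * R) : {poly R} := (v.1.1)%:P * 'X ^+ 2 + (v.1.2)%:P * 'X + (v.2)%:P.
have [t ht] : exists t, forall v, v \in s -> (f v).[t] != 0.
  apply: avoid_roots => v /s0; apply: contraTneq => /polyP fv.
  have := fv 0%N; have := fv 1%N; have := fv 2%N.
  rewrite /f !(coefD, coefMXn, coefMX, coefCM, coefC, coef0) /= ?coefC /=.
  by rewrite !addr0 !add0r => -> -> ->; rewrite eqxx.
exists t => g.
have gE x y z : pev (lin g P) x y z = pev P x y (- t ^+ 2 * x - t * y + z).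
  rewrite pev_mx3; apply: meval_eq => i; rewrite /triple.
  by case: (val i) => [|[|_]] /=; ring.
have key x y z : [|| x != 0, y != 0 | z != 0] -> pev (lin g P) x y z = 0 ->
    exists2 v, v \in s & exists l, [/\ x = l * v.1.1, y = l * v.1.2 & z = l * (f v).[t]].
  move=> xyz; rewrite gE => /hs[|v vs [l [xE yE zE]]].
    move: xyz; case: (eqVneq x 0) => //= ->; case: (eqVneq y 0) => //= ->.
    by rewrite !mulr0 subr0 add0r.
  exists v => //; exists l; split=> //; rewrite /f !evalE.
  have -> : z = t ^+ 2 * x + t * y + (- t ^+ 2 * x - t * y + z) by ring.
  by rewrite zE xE yE; ring.
split.
  move=> x y xy; rewrite lt_def (pnonneg_lin g P0) andbT; apply/eqP => Pxy.
  have [|v vs [l [xE yE /esym/eqP]]] := key x y 0 _ Pxy.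
    by rewrite eqxx orbF.
  rewrite mulf_eq0 (negPf (ht v vs)) orbF => /eqP l0.
  by move: xy; rewrite xE yE l0 !mul0r eqxx.
exists [seq (v.1.1 / (f v).[t], v.1.2 / (f v).[t]) | v <- s] => x y /key[|v vs [l [-> -> lE]]].
  by rewrite oner_neq0 !orbT.
apply/mapP; exists v => //.
have -> : l = (f v).[t]^-1 by apply: (mulIf (ht v vs)); rewrite -lE mulVf // ht.
by rewrite ![_^-1 * _]mulrC.
Qed.

(** A slope t is excluded when it is that of a line through two zeros, or when
    the second-order term at a zero vanishes along it: by
    [no_square_below_pencil] there are finitely many. *)
Lemma no_square_below_generic_shear P (s0 : seq (R * R)) : no_square_below P -> no_zero_at_infinity P ->
    (forall x y, pev P x y 1 = 0 -> (x, y) \in s0) ->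
  exists t s, let g := mx3 (triple 1 t 0) (triple 0 1 0) (triple 0 0 1) in
    [/\ no_zero_at_infinity (lin g P), 0 < pev (lin g P) 1 0 0 & generic_zeros (lin g P) s].
Proof.
move=> gP Pinf hs0; have [hP P0 Pn _] := gP.
pose s := undup [seq z <- s0 | pev P z.1 z.2 1 == 0].
have sP z : (z \in s) = (pev P z.1 z.2 1 == 0).
  rewrite mem_undup mem_filter; case: eqP => //= Pz; case: z Pz => x y /= Pz.
  exact: hs0.
pose bad : seq {poly R} := [seq (pencil P z.1 z.2)`_2 | z <- s] ++
    [seq (z.2 - w.2)%:P - (z.1 - w.1) *: 'X | z <- s, w <- [seq w <- s | w != z]].
have [t1 ht1] : exists t, forall i, i \in bad -> i.[t] != 0.
  apply: (@avoid_roots _ _ id) => i; rewrite mem_cat => /orP[/mapP[z zs ->]|].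
    by apply: no_square_below_pencil => //; apply/eqP; rewrite -sP.
  move=> /allpairsPdep[z [w [zs]]]; rewrite mem_filter => /andP[wz _] ->.
  apply: contra_neq wz => /polyP E; have := E 0%N; have := E 1%N.
  rewrite !coef0 !coefB !coefC !coefZ !coefX /= !mulr0 !mulr1 subr0 sub0r.
  move=> /eqP; rewrite oppr_eq0 subr_eq0 => /eqP e1 /eqP; rewrite subr_eq0 => /eqP e2.
  by case: z w e1 e2 {zs E} => [a b] [c d] /= -> ->.
exists t1, [seq (z.1, z.2 - t1 * z.1) | z <- s] => g.
have gE x y z : pev (lin g P) x y z = pev P x (y + t1 * x) z.
  rewrite pev_mx3; apply: meval_eq => i; rewrite /triple.
  by case: (val i) => [|[|_]] /=; ring.
split.
- move=> x y xy; rewrite gE Pinf //; case: (eqVneq x 0) xy => //= ->.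
  by rewrite mulr0 addr0.
- by rewrite gE; apply: Pinf; rewrite oner_neq0.
split.
- move=> x y; rewrite gE => Pxy; apply/mapP; exists (x, y + t1 * x) => /=.
    by rewrite sP Pxy.
  by rewrite addrK.
- by move=> _ /mapP[z zs ->] /=; rewrite gE subrK; apply/eqP; rewrite -sP.
- rewrite -map_comp map_inj_in_uniq ?undup_uniq // => z w zs ws /= E.
  apply/eqP; apply: contraT => zw.
  have /ht1 : (z.2 - w.2)%:P - (z.1 - w.1) *: 'X \in bad.
    rewrite mem_cat; apply/orP; right; apply/allpairsPdep; exists z, w; split=> //.
    by rewrite mem_filter eq_sym zw.
  rewrite !evalE => /eqP; case.
  have -> : z.2 = w.2 - t1 * w.1 + t1 * z.1 by rewrite -E; ring.
  ring.
move=> _ /mapP[z zs ->] /=.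
have -> : ((shift z.1%:P (aff (lin g P)))`_2).[z.2 - t1 * z.1] = ((pencil P z.1 z.2)`_2).[t1].
  have -> : ((pencil P z.1 z.2)`_2).[t1] = (fiber t1 (pencil P z.1 z.2))`_2 by rewrite coef_map.
  rewrite -[LHS]/(horner_eval _ _) -coef_map -/(fiber _ _).
  congr ((polyseq _)`_2); apply: poly_eq_values => e; rewrite !fiberE ev_pencil ev_shift hornerC ev_aff gE.
  by congr (pev _ _ _ _); ring.
by apply: ht1; rewrite mem_cat; apply/orP; left; apply/mapP; exists z.
Qed.

(** Three changes of coordinates: the first makes P monic in x, which gives
    finitely many zeros; the second moves them away from infinity; the third is
    a shear that makes them generic. *)
Lemma no_square_below_inherited P : no_square_below P -> no_square_below_odd_powers P.
Proof.
move=> gP; have [s [r Psr]] := no_square_below_nonvanishing gP.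
have u1 := unitriangular_unit s r 0.
apply: (no_square_below_odd_powers_lin u1); have g1 := no_square_below_lin u1 gP.
set P1 := lin _ P in g1 *.
have P1pos : 0 < pev P1 1 0 0.
  suff -> : pev P1 1 0 0 = pev P 1 s r by [].
  rewrite pev_mx3; apply: meval_eq => i; rewrite /triple.
  by case: (val i) => [|[|_]] /=; ring.
pose c := (pev P1 1 0 0)^-1; have c0 : 0 < c by rewrite invr_gt0.
apply: (no_square_below_odd_powers_scale c0); have g2 := no_square_below_scale c0 g1.
have P21 : pev (c *: P1) 1 0 0 = 1 by rewrite pevZ mulVf // gt_eqF.
have [t [inf3 [s0 hs0]]] := no_square_below_affine_zeros g2 P21.
have u3 := unitriangular_unit 0 (- t ^+ 2) (- t).
apply: (no_square_below_odd_powers_lin u3); have g3 := no_square_below_lin u3 g2.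
have [t1 [s1 [inf4 pos4 gen4]]] := no_square_below_generic_shear g3 inf3 hs0.
have u4 := unitriangular_unit t1 0 0.
apply: (no_square_below_odd_powers_lin u4); have g4 := no_square_below_lin u4 g3.
exact: no_square_below_odd_powers_chart pos4 inf4 gen4.
Qed.

End Charts.

(** * Extremal forms *)

(** G^2 and C P - G^2 are nonnegative forms with sum on the ray of P, so G^2 is
    a multiple of P. *)
Lemma extremal_not_sos_no_square_below (R : realType) (P : {mpoly R[3]}) :
    spans_extreme_ray (@nonneg_form R 3 6) P -> ~ sos_form 6 P -> no_square_below P.
Proof.
move=> [[hP P0] Pn ext] nsos; split=> //; first by move=> x y z; exact: P0.
move=> G C hG hGC; apply/eqP; apply: contraT => Gn; case: nsos.
have hG2 : G ^+ 2 \is 6.-homog by rewrite -[6%N]/(3 * 2)%N; exact: dhomogMn.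
pose c := `|C|.
have hGc x : (G ^+ 2).@[x] <= c * P.@[x].
  rewrite !meval_pev pev_exp; apply: le_trans (hGC _ _ _) _.
  by apply: ler_wpM2r; [rewrite -meval_pev|exact: ler_norm].
have [|||[a a0 E] _] := ext (G ^+ 2) (c *: P - G ^+ 2).
- by split=> // x; rewrite meval_pev pev_exp sqr_ge0.
- split; first by rewrite rpredB // dhomogZ.
  by move=> x; rewrite mevalB mevalZ subr_ge0.
- by exists c; rewrite ?normr_ge0 // addrC subrK.
have an : a != 0.
  by apply: contraNneq Gn => a00; rewrite -sqrf_eq0 E a00 scale0r.
have ap : 0 < a by rewrite lt_def an.
exists 3; split=> //; exists [:: (Num.sqrt a^-1) *: G].
  by move=> h; rewrite inE => /eqP ->; exact: dhomogZ.
rewrite big_seq1 exprZn sqr_sqrtr ?invr_ge0 // E scalerA mulVf // scale1r //.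
Qed.

Theorem theorem1 (R : realType) (P : {mpoly R[3]})
    (P_nonneg : nonneg_form 6 P)
    (P_extremal : spans_extreme_ray (@nonneg_form R 3 6) P)
    (P_not_sos : ~ sos_form 6 P) :
  stubborn 6 P.
Proof.
split=> // k kodd [e [ke [Hs hHs PE]]].
have gP := extremal_not_sos_no_square_below P_extremal P_not_sos.
have nb := no_square_below_inherited gP; have [_ _ Pn _] := gP.
have kE : k = (2 * k./2).+1 by rewrite mul2n -[LHS]odd_double_half kodd.
have eE : e = (3 * (2 * k./2).+1)%N.
  by move: ke kE; move: k./2 => j; lia.
have H0 h : h \in Hs -> h = 0.
  move=> hHs'; apply: (nb k./2 h 1); first by rewrite -eE; exact: hHs.
  move=> x y z; rewrite mul1r -kE -(pev_exp P) PE /pev raddf_sum /= (big_rem _ hHs') /=.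
  rewrite rmorphXn lerDl; apply: sumr_ge0 => i _; rewrite rmorphXn; exact: sqr_ge0.
case/eqP: (expf_neq0 k Pn); rewrite PE big_seq big1 // => h /H0 ->.
by rewrite expr0n.
Qed.
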